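(* Let $v,q$ be an axisymmetric suitable weak solution to the Navier–Stokes equations in $Q=\mathcal C\times]-1,0[$. Let $\frac25\le m_0<1$, $m=\frac{3m_0}{2+m_0}\in[\frac12,1[$, $m_1=2m-1$, $\alpha=2-m$, and let $s_1,l_1>1$ satisfy $\frac3{s_1}+\frac2{l_1}=4$. Assume that $$\sup_{0<R<1}\frac1{R^{\gamma_*l_1}}\int_{-R^2}^0\Big(\int_{\mathcal C(R)}(|\nabla^2v|^{s_1}+|\partial_tv|^{s_1})dx\Big)^{l_1/s_1}dt<\infty,\qquad \gamma_*=1-\Big(\frac3{2s_1}-1\Big)(1-m),$$ that $$m<\frac{4l_1-3}{l_1+1},$$ and that $$\operatorname*{ess\,sup}_{-1<t<0}\int_{\mathcal C}|v(x,t)|^{\bar q}dx<\infty,\qquad \bar q=\frac3{2-m}\in[2,3[.$$ If the origin $z=0$ is a Type II singular point of $v$ for which there exist a sequence $r_k\to0$ and a constant $c_1>0$ with $$\frac1{r_k^{2m_0}}\int_{Q(r_k)}|v|^3dz\ge c_1\quad\text{for all }k,$$ then at least one of the following three conditions is violated: (i) $\displaystyle\sup_{0<R\le1}\Big(\sup_{-R^2<t<0}\frac1{R^{m_1}}\int_{\mathcal C(R)}|v(x,t)|^2dx+\frac1{R^{2m}}\int_{Q(R)}|q|^{3/2}dz+\frac1{R^m}\int_{Q(R)}|\nabla v|^2dz\Big)<\infty$; (ii) there is a constant $c$ such that $|v(x,t)|\le c/|x'|^{\alpha}$ for all $(x,t)\in Q$ with $|x'|>0$; (iii) $l_1\le 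s_1$.
   Context: Notation. For $x=(x_1,x_2,x_3)\in\mathbb R^3$, $x'=(x_1,x_2,0)$; $\mathcal C(a)=\{|x'|<a,\ |x_3|<a\}$, $\mathcal C=\mathcal C(1)$, $Q(a)=\mathcal C(a)\times]-a^2,0[$, $Q=Q(1)$, $z=(x,t)$. Axisymmetric means that in cylindrical coordinates $(r,\vartheta,x_3)$ the components of $v=v_re_r+v_\vartheta e_\vartheta+v_3e_3$ and the pressure $q$ do not depend on $\vartheta$ (swirl $v_\vartheta$ is allowed). Suitable weak solution in $Q$: a pair $v,q$ with $v\in L_\infty(-1,0;L_2(\mathcal C))$, $\nabla v\in L_2(Q)$, $q\in L_{3/2}(Q)$; $\partial_tv+v\cdot\nabla v-\Delta v+\nabla q=0$, ${\rm div}\,v=0$ in $Q$ in the sense of distributions; and for a.a. $t\in]-1,0[$ $$\int_{\mathcal C}\varphi(x,t)|v(x,t)|^2dx+2\int_{-1}^t\int_{\mathcal C}\varphi|\nabla v|^2dxd\tau\le\int_{-1}^t\int_{\mathcal C}\big(|v|^2(\partial_t\varphi+\Delta\varphi)+v\cdot\nabla\varphi(|v|^2+2q)\big)dxd\tau$$ for all smooth nonnegative $\varphi$ vanishing near the parabolic boundary of $Q$. The origin $z=0$ is a regular point of $v$ if $v\in L_\infty(Q(\rho))$ for some $\rho>0$, and a singular point otherwise. It is a Type II singular point (Type II blowup) if it is singular and $g=\infty$, where $g=\inf\{\limsup_{\rho\to0}A(v,\rho),\ \limsup_{\rho\to0}E(v,\rho),\ \limsup_{\rho\to0}C(v,\rho)\}$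 with $A(v,\rho)=\frac1\rho\sup_{-\rho^2<t<0}\int_{\mathcal C(\rho)}|v(x,t)|^2dx$, $E(v,\rho)=\frac1\rho\int_{Q(\rho)}|\nabla v|^2dz$, $C(v,\rho)=\frac1{\rho^2}\int_{Q(\rho)}|v|^3dz$. *)

(* Defs.v *)
From HB Require Import structures.
From mathcomp Require Import all_boot all_order all_algebra.
From mathcomp Require Import all_classical all_reals all_analysis.
From mathcomp Require Import ess_sup_inf.

Set Implicit Arguments.
Unset Strict Implicit.
Unset Printing Implicit Defensive.

Import Order.TTheory GRing.Theory Num.Theory.
Import numFieldNormedType.Exports.

Local Open Scope classical_set_scope.
Local Open Scope ring_scope.

(* Points of R^3 are ((x1, x2), x3), points of space-time are (x, t). *)
Notation Rspace R := (R * R * R)%type.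
Notation Rspacetime R := (R * R * R * R)%type.

Definition leb1 (R : realType) : {measure set (measurableTypeR R) -> \bar R} :=
  @lebesgue_measure R.

Definition leb3 (R : realType) :
    {measure set (Rspace (measurableTypeR R)) -> \bar R} :=
  (@lebesgue_measure R \x @lebesgue_measure R \x @lebesgue_measure R)%E.

Definition leb4 (R : realType) :
    {measure set (Rspacetime (measurableTypeR R)) -> \bar R} :=
  (leb3 R \x @lebesgue_measure R)%E.

(* The library's norm on products and matrices is the sup norm, hence this
   explicit Euclidean norm of a finite family of components. *)
Definition enorm (R : realType) (I : finType) (a : I -> R) : R :=
  Num.sqrt (\sum_(i : I) a i ^+ 2).

Section domains.
Variable R : realType.
Implicit Types (x : Rspace R) (a : R).

(* |x'| *)
Definition axis_dist x : R := Num.sqrt (x.1.1 ^+ 2 + x.1.2 ^+ 2).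

Definition cyl a : set (Rspace R) := [set x | axis_dist x < a /\ `|x.2| < a].

Definition pcyl a : set (Rspacetime R) := cyl a `*` `]- a ^+ 2, 0[.

Definition parabolic_boundary : set (Rspacetime R) :=
  (closure (cyl 1) `*` [set -1])
  `|` ((closure (cyl 1) `\` cyl 1) `*` `[-1, 0]).

End domains.

Section calculus.
Variable R : realType.
Implicit Types (f g phi : Rspacetime R -> R) (w : Rspacetime R).

Definition dirx (i : 'I_3) : Rspacetime R :=
  (((i == 0%N :> nat)%:R, (i == 1%N :> nat)%:R, (i == 2%N :> nat)%:R), 0).

Definition dirt : Rspacetime R := ((0, 0, 0), 1).

Definition laplacian f : Rspacetime R -> R :=
  fun z => \sum_(i < 3) 'D_(dirx i) ('D_(dirx i) f) z.

Fixpoint Ck (k : nat) f : Prop :=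
  match k with
  | 0 => continuous f
  | k'.+1 => continuous f /\
      forall w, (forall z, derivable f z w) /\ Ck k' ('D_w f)
  end.

Definition smooth f : Prop := forall k, Ck k f.

(* C_c^infty(U) *)
Definition test_function (U : set (Rspacetime R)) phi : Prop :=
  [/\ smooth phi, compact (closure [set z | phi z != 0])
    & closure [set z | phi z != 0] `<=` U].

Definition locally_integrable_on (U : set (Rspacetime R)) f : Prop :=
  measurable_fun U f /\
  forall K, compact K -> K `<=` U -> (@leb4 R).-integrable K (EFin \o f).

(* g is the distributional derivative of f in direction w on U *)
Definition weak_derivative (U : set (Rspacetime R)) w f g : Prop :=
  [/\ locally_integrable_on U f, locally_integrable_on U g
    & forall phi, test_function U phi ->
        \int[@leb4 R]_(z in U) (f z * 'D_w phi z) =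
        - \int[@leb4 R]_(z in U) (g z * phi z)].

End calculus.

Section navier_stokes.
Variable R : realType.
Notation Q := (@pcyl R 1).
Notation C := (@cyl R 1).
Notation leb3 := (@leb3 R).
Notation leb4 := (@leb4 R).
Notation leb1 := (@leb1 R).

(* A velocity field v is given by its components v i; Dv i j stands for the
   derivative of v i in the direction x_j. Weak derivatives are unique only up
   to null sets, so they are carried as explicit data and enter below only
   through integrals. *)
Implicit Types (v : 'I_3 -> Rspacetime R -> R) (q : Rspacetime R -> R)
  (Dv : 'I_3 -> 'I_3 -> Rspacetime R -> R)
  (D2v : 'I_3 -> 'I_3 -> 'I_3 -> Rspacetime R -> R).

Definition vabs v (z : Rspacetime R) : R := enorm (fun i => v i z).

Definition grad_abs Dv (z : Rspacetime R) : R :=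
  enorm (fun ij : 'I_3 * 'I_3 => Dv ij.1 ij.2 z).

Definition hess_abs D2v (z : Rspacetime R) : R :=
  enorm (fun ijk : 'I_3 * 'I_3 * 'I_3 => D2v ijk.1.1 ijk.1.2 ijk.2 z).

Definition weak_gradient v Dv : Prop :=
  forall i j, weak_derivative Q (dirx R j) (v i) (Dv i j).

Definition weak_hessian Dv D2v : Prop :=
  forall i j k, weak_derivative Q (dirx R k) (Dv i j) (D2v i j k).

Definition weak_time_derivative v (dtv : 'I_3 -> Rspacetime R -> R) : Prop :=
  forall i, weak_derivative Q (dirt R) (v i) (dtv i).

Definition momentum_equation v q Dv : Prop :=
  forall (i : 'I_3) phi, test_function Q phi ->
    \int[leb4]_(z in Q)
      (- (v i z * 'D_(dirt R) phi z)
       + (\sum_(j < 3) v j z * Dv i j z) * phi z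
       - v i z * laplacian phi z
       - q z * 'D_(dirx R i) phi z) = 0.

Definition divergence_free v : Prop :=
  forall phi, test_function Q phi ->
    \int[leb4]_(z in Q) (\sum_(i < 3) v i z * 'D_(dirx R i) phi z) = 0.

Definition local_energy_test (phi : Rspacetime R -> R) : Prop :=
  [/\ smooth phi, (forall z, Q z -> 0 <= phi z)
    & exists U : set (Rspacetime R),
        [/\ open U, @parabolic_boundary R `<=` U
          & forall z, U z -> Q z -> phi z = 0]].

Definition local_energy_inequality v q Dv : Prop :=
  {ae leb1, forall t, -1 < t < 0 ->
    forall phi, local_energy_test phi ->
    \int[leb3]_(x in C) (phi (x, t) * vabs v (x, t) ^+ 2)
    + 2 * \int[leb4]_(z in C `*` `]-1, t[) (phi z * grad_abs Dv z ^+ 2)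
    <= \int[leb4]_(z in C `*` `]-1, t[)
         (vabs v z ^+ 2 * ('D_(dirt R) phi z + laplacian phi z)
          + (\sum_(i < 3) v i z * 'D_(dirx R i) phi z)
            * (vabs v z ^+ 2 + 2 * q z))}.

(* [f \_ D] extends f by 0 outside D; the functions f below are nonnegative,
   so this does not change their essential supremum over D. *)
Definition suitable_weak_solution v q Dv : Prop :=
  [/\ (forall i, measurable_fun Q (v i))
      /\ (ess_sup leb1
           ((fun t : R => \int[leb3]_(x in C) (vabs v (x, t) ^+ 2)%:E)
            \_ `](-1)%R, 0%R[) < +oo)%E,
      weak_gradient v Dv
      /\ (\int[leb4]_(z in Q) (grad_abs Dv z ^+ 2)%:E < +oo)%E,
      measurable_fun Q q
      /\ (\int[leb4]_(z in Q) (`|q z| `^ (3 / 2))%:E < +oo)%E,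
      momentum_equation v q Dv /\ divergence_free v
    & local_energy_inequality v q Dv].

(* vr, vtheta, v3 are the components of v in the basis
   e_r = (x1, x2, 0) / |x'|, e_theta = (-x2, x1, 0) / |x'|, e_3. *)
Definition axisymmetric v q : Prop :=
  exists vr vtheta v3 p : R -> R -> R -> R,
  {ae leb4, forall z, Q z ->
    let x1 := z.1.1.1 in let x2 := z.1.1.2 in let x3 := z.1.2 in
    let t := z.2 in let r := axis_dist z.1 in
    [/\ v (inord 0) z = vr r x3 t * (x1 / r) - vtheta r x3 t * (x2 / r),
        v (inord 1) z = vr r x3 t * (x2 / r) + vtheta r x3 t * (x1 / r),
        v (inord 2) z = v3 r x3 t
      & q z = p r x3 t]}.

Definition regular_origin v : Prop :=
  exists2 rho : R, 0 < rho &
    (ess_sup leb4 ((fun z => (vabs v z)%:E) \_ (pcyl rho)) < +oo)%E.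

Definition singular_origin v : Prop := ~ regular_origin v.

Definition Afun v (rho : R) : \bar R :=
  ((rho^-1)%:E * ereal_sup
    [set \int[leb3]_(x in cyl rho) (vabs v (x, t) ^+ 2)%:E
      | t in `](- rho ^+ 2)%R, 0%R[])%E.

Definition Efun Dv (rho : R) : \bar R :=
  ((rho^-1)%:E * \int[leb4]_(z in pcyl rho) (grad_abs Dv z ^+ 2)%:E)%E.

Definition Cfun v (rho : R) : \bar R :=
  (((rho ^+ 2)^-1)%:E * \int[leb4]_(z in pcyl rho) (vabs v z ^+ 3)%:E)%E.

Definition g_index v Dv : \bar R :=
  ereal_inf [set limf_esup (Afun v) 0^'+;
                 limf_esup (Efun Dv) 0^'+;
                 limf_esup (Cfun v) 0^'+].

Definition type_II_origin v Dv : Prop :=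
  singular_origin v /\ g_index v Dv = +oo%E.

End navier_stokes.

(* Main.v *)
Require Import Defs.
From HB Require Import structures.
From mathcomp Require Import all_boot all_order all_algebra.
From mathcomp Require Import all_classical all_reals all_analysis.
From mathcomp Require Import ess_sup_inf measurable_realfun ring lra.

Set Implicit Arguments.
Unset Strict Implicit.
Unset Printing Implicit Defensive.

Import Order.TTheory GRing.Theory Num.Theory.
Import numFieldNormedType.Exports.

Local Open Scope classical_set_scope.
Local Open Scope ring_scope.

(** Condition (i) is incompatible with the concentration of |v|^3 along the
    cylinders Q(r_k): it is (i) that gets violated.

    Let K bound the supremum in (i).  A cylinder Q(r) is compared with the larger
    one of radius lambda = r^(2/(3-m)), chosen so that r^2 = lambda^(3-m) and
    r^(2 m0) = lambda^(2m).  At radius lambda, (i) bounds the integral of |v|^2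
    over every time slice by K lambda^(2m-1) and the integral of |grad v|^2 by
    K lambda^m.  The Gagliardo-Nirenberg inequality
      ||v||_3^3 <= C (||v||_2^(3/2) ||grad v||_2^(3/2) + lambda^(-3/2) ||v||_2^3)
    on the slices of C(lambda), integrated over the time span r^2, then bounds the
    integral of |v|^3 by a multiple of lambda^(2m) = r^(2 m0); with this lambda
    both terms on the right have exactly that size.  This is only borderline, but
    the left side is needed on the small set C(r) instead of C(lambda), and there
    the inequality improves by a factor (r/lambda)^(1/4).  Hence
      r^(-2 m0) int_(Q(r)) |v|^3 <= C (r/lambda)^(1/4) -> 0  as r -> 0
    ([cubic_decay]), which rules out the lower bound c1 > 0 ([no_concentration]).

    The localized inequality ([cube_integral_bound], [slice_cube_bound],
    [parabolic_cube_bound]) follows Gagliardo's argument.  On almost every line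
    parallel to an axis, |v|^2 at a point is at most an integral over the line of
    16/l |v|^2 + 2 l |d_j v|^2, with the length l at our disposal
    ([line_sqr_scales]).  So |v|^2 has three majorants, each independent of one of
    the coordinates, and a Loomis-Whitney argument bounds the integral of |v|^3 by
    those of the majorants ([loomis_whitney_cube]).  The gain comes from the third
    majorant: it only has to be integrated over a thin tube around a line, whose
    share of the integral of |v|^2 is controlled by the first majorant.

    The bound along lines ([weak_derivative_line_bound]) is read off directly
    from the definition of weak derivatives.  For a product a of bumps, the
    definition is applied to the product in which the j-th factor a_j is replaced
    by a compactly supported primitive of a_j - c b, where b is a fixed bump
    ([balanced_primitive], [weak_derivative_tested]).  This gives the bound
    integrated against a, and inequalities between integrals against all
    nonnegative product bumps imply inequalities almost everywhere
    ([determining_box]). *)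

(** * Smooth functions of one variable and their tensor products *)

Lemma cvg_is_derive (R : numFieldType) (V W : normedModType R) (f : V -> W)
  (x v : V) (l : W) :
  h^-1 *: (f (h *: v + x) - f x) @[h --> (0:R)^'] --> l -> is_derive x v f l.
Proof.
move=> h; have c : derivable f x v by apply/cvg_ex; exists l.
by split=> //; exact: cvg_lim.
Qed.

Lemma near_is_derive (R : numFieldType) (V W : normedModType R) (f g : V -> W)
  (x v : V) (l : W) :
  (\near x, f x = g x) -> is_derive x v f l -> is_derive x v g l.
Proof.
move=> fg [df dl]; split; first exact: near_eq_derivable fg df.
by rewrite -dl; apply/esym/near_eq_derive.
Qed.

Section flat.
Variable R : realType.
Implicit Types x : R.

(** The factor x^-k makes this family stable under differentiation up to linear
    combinations, which is how smoothness is obtained below. *)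
Definition flat (k : nat) x : R := if 0 < x then x^-1 ^+ k * expR (- x^-1) else 0.

Lemma flat_ge0 k x : 0 <= flat k x.
Proof.
rewrite /flat; case: ifP => // x0.
by rewrite mulr_ge0 ?expR_ge0// exprn_ge0// invr_ge0 ltW.
Qed.

(** From y^n/n! <= exp y at y = 1/x; quadratic decay at 0 is what makes the
    function differentiable there. *)
Lemma flat_le k x : flat k x <= (k.+2)`!%:R * x ^+ 2.
Proof.
rewrite /flat; case: ifP => x0; last by rewrite mulr_ge0// sqr_ge0.
have y0 : 0 < x^-1 by rewrite invr_gt0.
have := expR_ge1Dxn k.+1 (ltW y0); move: x^-1 (invrK x) y0 => y <- y0 h.
have fk : (0 : R) < (k.+2)`!%:R by rewrite ltr0n fact_gt0.
have {}h : y ^+ k.+2 <= (k.+2)`!%:R * expR y.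
  rewrite mulrC -ler_pdivrMr//; apply: le_trans h; by rewrite lerDr.
rewrite expRN ler_pdivrMr ?expR_gt0// mulrAC exprVn ler_pdivlMr ?exprn_gt0//.
by rewrite -exprD addn2.
Qed.

Lemma is_derive_flat k x :
  is_derive x 1 (flat k) (flat k.+2 x - k%:R * flat k.+1 x).
Proof.
have [x0|x0|->] := ltgtP x 0.
- have -> : flat k.+2 x - k%:R * flat k.+1 x = 0.
    by rewrite /flat ltNge (ltW x0)/= mulr0 subr0.
  apply: (near_is_derive _ (is_derive_cst (0 : R) x 1)).
  near=> y; rewrite /flat ifF//; apply/negbTE; rewrite -leNgt ltW//; near: y.
  exact: lt_nbhsl.
- apply: (near_is_derive (f := fun y : R => y^-1 ^+ k * expR (- y^-1))).
    near=> y; rewrite /flat ifT//; near: y; exact: lt_nbhsr.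
  have x1 : x != 0 by rewrite gt_eqF.
  have dV : is_derive x 1 (fun y : R => y^-1) (- x ^- 2 *: 1).
    exact: (@is_deriveV _ id x 1 1 x1 (is_derive_id _ _)).
  have dE : is_derive x 1 (fun y : R => expR (- y^-1)) (expR (- x^-1) * x ^- 2).
    have dN : is_derive x 1 (fun y : R => - y^-1) (x ^- 2).
      by have := is_deriveN dV; rewrite scaleNr opprK /GRing.scale/= mulr1.
    exact: (@is_derive1_comp _ expR (fun y : R => - y^-1)).
  have dP : is_derive x 1 (fun y : R => y^-1 ^+ k) (- k%:R * x^-1 ^+ k.+1).
    case: k => [|k]; first by rewrite oppr0 mul0r; exact: is_derive_cst.
    have := @is_deriveX _ _ _ k.+1 _ _ _ dV; congr is_derive; last first.
      by rewrite /GRing.scale/= -exprVn mulr1 !mulrN mulNr -mulrA -exprD addn2.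
    by apply/funext => y; rewrite fctE.
  have := is_deriveM dP dE; congr is_derive.
  rewrite /flat x0 /GRing.scale/= -exprVn.
  rewrite -[k.+2]addn2 exprD.
  move: (expR _) (x^-1 ^+ k) (x^-1 ^+ 2) (x^-1 ^+ k.+1) k%:R => e a b c d.
  by ring.
- have -> : flat k.+2 0 - k%:R * flat k.+1 0 = 0.
    by rewrite /flat ltxx mulr0 subr0.
  apply: cvg_is_derive.
  have -> : (fun h : R => h^-1 *: (flat k (h *: 1 + 0) - flat k 0)) =
            (fun h => h^-1 * flat k h).
    by apply/funext => h; rewrite addr0 /GRing.scale/= mulr1 {2}/flat ltxx subr0.
  apply/cvgr0Pnorm_le => e e0; near=> h.
  have h0 : h != 0 by near: h; exact: nbhs_dnbhs_neq.
  have fk : (0 : R) < (k.+2)`!%:R by rewrite ltr0n fact_gt0.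
  rewrite normrM normfV ger0_norm ?flat_ge0// mulrC ler_pdivrMr ?normr_gt0//.
  apply: (le_trans (flat_le _ _)); rewrite -[h ^+ 2]ger0_norm ?sqr_ge0// normrX.
  rewrite expr2 mulrA ler_wpM2r// -ler_pdivlMl//.
  near: h; apply: dnbhs0_le; by rewrite mulr_gt0// invr_gt0.
Unshelve. all: by end_near. Qed.

End flat.

Section smooth_classes.
Variable R : realType.

(** A class of functions closed under differentiation, so that its members are
    infinitely differentiable, and rich enough to contain bumps and the
    primitives needed to test weak derivatives. *)
Inductive smooth1 : (R -> R) -> Prop :=
| smooth1_flat k a b : smooth1 (fun x => flat k (a * x + b))
| smooth1Z c f : smooth1 f -> smooth1 (fun x => c * f x)
| smooth1D f g : smooth1 f -> smooth1 g -> smooth1 (fun x => f x + g x)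
| smooth1M f g : smooth1 f -> smooth1 g -> smooth1 (fun x => f x * g x)
| smooth1_prim (F f : R -> R) : smooth1 f -> (forall x : R, is_derive x 1 F (f x)) -> smooth1 F.

Lemma smooth1_derive f : smooth1 f ->
  exists2 f', smooth1 f' & forall x : R, is_derive x 1 f (f' x).
Proof.
elim=> [k a b|c {}f _ [f' sf df]|{}f g _ [f' sf df] _ [g' sg dg]
  |{}f g sf0 [f' sf df] sg0 [g' sg dg]|F {}f sf _ dF].
- exists (fun x => a * (flat k.+2 (a * x + b) + (- k%:R) * flat k.+1 (a * x + b))).
    by apply: smooth1Z; apply: smooth1D; [exact: smooth1_flat|
      apply: smooth1Z; exact: smooth1_flat].
  move=> x.
  have dl : is_derive x 1 (fun x : R => a * x + b) a.
    have := is_deriveD (is_deriveZ a (is_derive_id x (1:R))) (is_derive_cst b x 1).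
    by rewrite addr0 /GRing.scale/= mulr1.
  have := @is_derive1_comp _ _ (fun x : R => a * x + b) _ _ _ (is_derive_flat k (a * x + b)) dl.
  by rewrite mulrC mulNr.
- exists (fun x => c * f' x); first exact: smooth1Z.
  by move=> x; exact: is_deriveZ.
- exists (fun x => f' x + g' x); first exact: smooth1D.
  by move=> x; exact: is_deriveD.
- exists (fun x => f x * g' x + g x * f' x).
    by apply: smooth1D; apply: smooth1M.
  by move=> x; exact: is_deriveM.
- by exists f.
Qed.

Lemma is_derive1_dir (f : R -> R) (x w d : R) : is_derive x 1 f d ->
  is_derive x w f (w * d).
Proof.
move=> df; have dff : differentiable f x by apply/derivable1_diffP; case: df.
split; first exact: diff_derivable.
rewrite deriveE//; case: df => _; rewrite deriveE// => <-.
by rewrite -{1}[w]mulr1 -[w * 1]/(w *: (1:R)) linearZ.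
Qed.

Lemma smooth1_continuous f : smooth1 f -> continuous f.
Proof.
move=> /smooth1_derive[f' _ df] x; apply: differentiable_continuous.
by apply/derivable1_diffP; case: (df x).
Qed.

(** Closed under all directional derivatives by the Leibniz rule; this gives
    smoothness without any theory of higher derivatives in several variables. *)
Inductive tensor : (Rspacetime R -> R) -> Prop :=
| tensor_prod a b c d : smooth1 a -> smooth1 b -> smooth1 c -> smooth1 d ->
    tensor (fun z => a z.1.1.1 * b z.1.1.2 * c z.1.2 * d z.2)
| tensorZ c f : tensor f -> tensor (fun z => c * f z)
| tensorD f g : tensor f -> tensor g -> tensor (fun z => f z + g z).

Lemma is_derive_prod4 (a b c d a' b' c' d' : R -> R) (z w : Rspacetime R) :
  (forall x : R, is_derive x 1 a (a' x)) -> (forall x : R, is_derive x 1 b (b' x)) ->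
  (forall x : R, is_derive x 1 c (c' x)) -> (forall x : R, is_derive x 1 d (d' x)) ->
  is_derive z w (fun z : Rspacetime R => a z.1.1.1 * b z.1.1.2 * c z.1.2 * d z.2)
   (w.1.1.1 * (a' z.1.1.1 * b z.1.1.2 * c z.1.2 * d z.2) +
    w.1.1.2 * (a z.1.1.1 * b' z.1.1.2 * c z.1.2 * d z.2) +
    w.1.2 * (a z.1.1.1 * b z.1.1.2 * c' z.1.2 * d z.2) +
    w.2 * (a z.1.1.1 * b z.1.1.2 * c z.1.2 * d' z.2)).
Proof.
move=> da db dc dd.
have Da : is_derive z w (fun z : Rspacetime R => a z.1.1.1) (w.1.1.1 * a' z.1.1.1).
  by case: (is_derive1_dir w.1.1.1 (da z.1.1.1)) => h1 h2; split.
have Db : is_derive z w (fun z : Rspacetime R => b z.1.1.2) (w.1.1.2 * b' z.1.1.2).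
  by case: (is_derive1_dir w.1.1.2 (db z.1.1.2)) => h1 h2; split.
have Dc : is_derive z w (fun z : Rspacetime R => c z.1.2) (w.1.2 * c' z.1.2).
  by case: (is_derive1_dir w.1.2 (dc z.1.2)) => h1 h2; split.
have Dd : is_derive z w (fun z : Rspacetime R => d z.2) (w.2 * d' z.2).
  by case: (is_derive1_dir w.2 (dd z.2)) => h1 h2; split.
have := is_deriveM (is_deriveM (is_deriveM Da Db) Dc) Dd.
congr is_derive; rewrite /GRing.scale/= !fctE.
ring.
Qed.

Lemma tensor_derive f w : tensor f ->
  exists2 f', tensor f' & forall z, is_derive z w f (f' z).
Proof.
elim=> [a b c d sa sb sc sd|c {}f _ [f' sf df]|{}f g _ [f' sf df] _ [g' sg dg]].
- have [a' sa' da] := smooth1_derive sa; have [b' sb' db] := smooth1_derive sb.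
  have [c' sc' dc] := smooth1_derive sc; have [d' sd' dd] := smooth1_derive sd.
  eexists; last by move=> z; exact: (is_derive_prod4 z w da db dc dd).
  by do 3?apply: tensorD; apply: tensorZ;
    [apply: (tensor_prod (a := a'))|apply: (tensor_prod (b := b'))|
     apply: (tensor_prod (c := c'))|apply: (tensor_prod (d := d'))].
- exists (fun z => c * f' z); first exact: tensorZ.
  by move=> z; exact: is_deriveZ.
- exists (fun x => f' x + g' x); first exact: tensorD.
  by move=> x; exact: is_deriveD.
Qed.

Lemma tensor_continuous f : tensor f -> continuous f.
Proof.
elim=> [a b c d sa sb sc sd|c {}f _ cf|{}f g _ cf _ cg] z.
- have c1 : {for z, continuous (fun z : Rspacetime R => z.1.1.1)}.
    by apply: continuous_comp; [apply: continuous_comp; exact: cvg_fst|exact: cvg_fst].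
  have c2 : {for z, continuous (fun z : Rspacetime R => z.1.1.2)}.
    by apply: continuous_comp; [apply: continuous_comp; exact: cvg_fst|exact: cvg_snd].
  have c3 : {for z, continuous (fun z : Rspacetime R => z.1.2)}.
    by apply: continuous_comp; [exact: cvg_fst|exact: cvg_snd].
  have c4 : {for z, continuous (fun z : Rspacetime R => z.2)}.
    exact: cvg_snd.
  have Ca : {for z, continuous (fun z : Rspacetime R => a z.1.1.1)}.
    by apply: continuous_comp c1 _; exact: smooth1_continuous.
  have Cb : {for z, continuous (fun z : Rspacetime R => b z.1.1.2)}.
    by apply: continuous_comp c2 _; exact: smooth1_continuous.
  have Cc : {for z, continuous (fun z : Rspacetime R => c z.1.2)}.
    by apply: continuous_comp c3 _; exact: smooth1_continuous.
  have Cd : {for z, continuous (fun z : Rspacetime R => d z.2)}.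
    by apply: continuous_comp c4 _; exact: smooth1_continuous.
  exact: (continuousM (continuousM (continuousM Ca Cb) Cc) Cd).
- by apply: continuousM; [exact: cst_continuous|exact: cf].
- by apply: continuousD; [exact: cf|exact: cg].
Qed.

Lemma tensor_smooth f : tensor f -> smooth f.
Proof.
move=> tf k; elim: k f tf => [|k ih] f tf /=; first exact: tensor_continuous.
split; first exact: tensor_continuous.
move=> w; have [f' tf' df] := tensor_derive w tf.
split; first by move=> z; case: (df z).
have -> : 'D_w f = f' by apply/funext => z; case: (df z).
exact: ih.
Qed.

End smooth_classes.

(** * Bumps converging to the indicator of an interval *)

Section bump.
Variable R : realType.

Definition bump (p q : R) (n : nat) (s : R) : R :=
  flat 0 (n.+1%:R * s - n.+1%:R * p) * flat 0 (- n.+1%:R * s + n.+1%:R * q).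

Lemma smooth1_bump p q n : smooth1 (bump p q n).
Proof. by apply: smooth1M; exact: smooth1_flat. Qed.

Lemma flat0_le1 (x : R) : flat 0 x <= 1.
Proof.
rewrite /flat; case: ifP => // x0; rewrite expr0 mul1r -[leRHS]expR0 ler_expR.
by rewrite oppr_le0 invr_ge0 ltW.
Qed.

Lemma bump_ge0 p q n s : 0 <= bump p q n s.
Proof. by rewrite mulr_ge0 ?flat_ge0. Qed.

Lemma bump_le1 p q n s : bump p q n s <= 1.
Proof. by rewrite mulr_ile1 ?flat_ge0 ?flat0_le1. Qed.

Lemma bump_out p q n s : ~~ (p < s < q) -> bump p q n s = 0.
Proof.
have n0 : (0 : R) < n.+1%:R by rewrite ltr0n.
rewrite negb_and /bump /flat => /orP[]; rewrite -leNgt => h.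
- by rewrite ifF ?mul0r// -mulrBr pmulr_rgt0// subr_gt0 ltNge h.
- by rewrite [X in _ * X]ifF ?mulr0// mulNr [- _ + _]addrC -mulrBr pmulr_rgt0// subr_gt0 ltNge h.
Qed.

Lemma flat0_cvg (c : R) : 0 < c -> flat 0 (n.+1%:R * c) @[n --> \oo] --> (1 : R).
Proof.
move=> c0.
have -> : (fun n => flat 0 (n.+1%:R * c)) = (fun n : nat => expR (- (c^-1 * n.+1%:R^-1))).
  by apply/funext => n; rewrite /flat mulr_gt0// expr0 mul1r invfM mulrC.
rewrite -[X in _ --> X]expR0.
have h : (fun n : nat => - (c^-1 * n.+1%:R^-1)) @ \oo --> (0 : R).
  rewrite -[X in _ --> X]oppr0; apply: cvgN; rewrite -[X in _ --> X](mulr0 c^-1).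
  by apply: cvgMr; exact: cvg_harmonic.
by apply: continuous_cvg => //; exact: continuous_expR.
Qed.

Lemma bump_cvg p q s :
  bump p q n s @[n --> \oo] --> (\1_(`]p, q[%classic) s : R).
Proof.
rewrite indicE; have [|h] := boolP (p < s < q).
- move=> /andP[ps sq]; rewrite mem_set/= ?in_itv/= ?ps ?sq// -[X in _ --> X]mulr1.
  have -> : (fun n => bump p q n s) =
      (fun n => flat 0 (n.+1%:R * (s - p)) * flat 0 (n.+1%:R * (q - s))).
    by apply/funext => n; rewrite /bump mulNr [- _ + _]addrC -!mulrBr.
  by apply: cvgM; apply: flat0_cvg; rewrite subr_gt0.
- rewrite memNset/= ?in_itv/=; last exact/negP.
  under eq_fun do rewrite bump_out//.
  exact: cvg_cst.
Qed.

Lemma measurable_bump p q n : measurable_fun setT (bump p q n).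
Proof. apply: continuous_measurable_fun; apply: smooth1_continuous; exact: smooth1_bump. Qed.

End bump.

Lemma integrableM_bounded d (T : measurableType d) (R : realType)
    (mu : {measure set T -> \bar R}) (D : set T) (f g : T -> R) (M : R) :
  measurable D -> mu.-integrable D (EFin \o f) -> measurable_fun D g ->
  (forall x, `|g x| <= M) -> mu.-integrable D (EFin \o (fun x => f x * g x)).
Proof.
move=> mD fi mg gM.
have mf : measurable_fun D f by apply/measurable_EFinP; case/integrableP: fi.
have Mfi : mu.-integrable D (EFin \o (fun x => M * f x)).
  by have := @integrableZl _ _ _ mu D mD M _ fi.
apply: le_integrable Mfi => //.
  by apply/measurable_EFinP; apply: measurable_funM.
move=> x _ /=; rewrite lee_fin normrM [leRHS]normrM mulrC ler_wpM2r//.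
by apply: (le_trans (gM x)); exact: ler_norm.
Qed.

Lemma integrableM_le1 d (T : measurableType d) (R : realType)
    (mu : {measure set T -> \bar R}) (D : set T) (f g : T -> R) :
  measurable D -> mu.-integrable D (EFin \o f) -> measurable_fun D g ->
  (forall x, `|g x| <= 1) -> mu.-integrable D (EFin \o (fun x => f x * g x)).
Proof. by move=> mD fi mg; exact: integrableM_bounded. Qed.

(** Hence the integrals of f against bumps determine those over intervals. *)
Lemma bump_integral_cvg (R : realType) (f : R -> R) (p q : R) :
  (@lebesgue_measure R).-integrable setT (EFin \o f) ->
  (\int[@lebesgue_measure R]_x (f x * bump p q n x)%:E @[n --> \oo] -->
   \int[@lebesgue_measure R]_(x in `]p, q[) (f x)%:E)%E.
Proof.
move=> fi; rewrite integral_mkcond/=.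
have mf : measurable_fun setT f.
  by apply/measurable_EFinP; case/integrableP: fi.
have := @dominated_convergence _ _ _ (@lebesgue_measure R) setT measurableT
  (fun n x => (f x * bump p q n x)%:E) ((EFin \o f) \_ `]p, q[)
  (fun x => `|(f x)%:E|)%E.
case => //.
- move=> n; apply/measurable_EFinP; apply: measurable_funM => //.
  exact: measurable_bump.
- by apply/(measurable_restrictT (EFin \o f)) => //; apply: measurable_funTS; exact/measurable_EFinP.
- apply: aeW => x _; rewrite patchE.
  have -> : (if x \in `]p, q[%classic then (f x)%:E else 0%E) =
      (f x * \1_(`]p, q[%classic) x)%:E.
    by rewrite indicE; case: ifP => _; rewrite ?mulr1 ?mulr0.
  by apply: cvg_EFin; [exact: nearW|apply: cvgMr; exact: bump_cvg].
- by move: fi => /integrable_abse.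
- apply: aeW => x n _; rewrite lee_fin normrM [`|bump _ _ _ _|]ger0_norm ?bump_ge0//.
  by rewrite ler_piMr ?bump_le1.
Qed.

(** * Determining families of test functions *)

Section sigma_finite_product.
Context d1 d2 (T1 : measurableType d1) (T2 : measurableType d2) (R : realType).
Variables (m1 : {sigma_finite_measure set T1 -> \bar R})
  (m2 : {sigma_finite_measure set T2 -> \bar R}).

(** A name for the product measure that carries its sigma-finiteness, so that
    products can be iterated. *)
Definition sprod : set (T1 * T2) -> \bar R := (m1 \x m2)%E.

HB.instance Definition _ := Measure.copy sprod (m1 \x m2)%E.

Let sprod_sigma_finite : sigma_finite setT sprod.
Proof.
have [F FT Foo] := sigma_finiteT m1; have [G GT Goo] := sigma_finiteT m2.
exists (fun n => if unpickle n is Some (i, j) then F i `*` G j else set0).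
  apply/seteqP; split=> // -[x y] _.
  have [i _ Fx] : (\bigcup_i F i) x by rewrite -FT.
  have [j _ Gy] : (\bigcup_i G i) y by rewrite -GT.
  by exists (pickle (i, j)) => //=; rewrite pickleK.
move=> n; case: (unpickle n) => [[i j]|]; last by rewrite measure0.
have [mF Fi] := Foo i; have [mG Gj] := Goo j.
split; first exact: measurableX.
by rewrite /sprod product_measure1E// lte_mul_pinfty// ge0_fin_numE.
Qed.

HB.instance Definition _ := Measure_isSigmaFinite.Build _ _ _ sprod
  sprod_sigma_finite.

End sigma_finite_product.

Lemma ae_forall_count d (T : measurableType d) (R : realType)
    (mu : {measure set T -> \bar R}) (I : countType) (P : I -> T -> Prop) :
  (forall i, {ae mu, forall x, P i x}) -> {ae mu, forall x, forall i, P i x}.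
Proof.
move=> h.
have : {ae mu, forall x, forall n, if unpickle n is Some i then P i x else True}.
  apply: ae_foralln => n; case: (unpickle n) => [i|]; first exact: h.
  exact: aeW.
by apply: filterS => x hx i; have := hx (pickle i); rewrite pickleK.
Qed.

Section determining.
Context d (T : measurableType d) (R : realType).

(** Inequalities are used instead of equations because the bounds for a function
    in terms of its weak derivative are inequalities. *)
Definition determining (mu : {measure set T -> \bar R}) (D : set T)
    (F : set (T -> R)) :=
  forall f : T -> R, mu.-integrable setT (EFin \o f) ->
    (forall phi, F phi -> (\int[mu]_x (f x * phi x)%:E <= 0)%E) ->
    {ae mu, forall x, D x -> f x <= 0}.

Definition unit_valued (F : set (T -> R)) :=
  forall phi, F phi -> measurable_fun setT phi /\ forall x, 0 <= phi x <= 1.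

End determining.

Lemma determiningS d (T : measurableType d) (R : realType)
    (mu : {measure set T -> \bar R}) D F F' :
  F `<=` F' -> determining mu D F -> determining mu D F'.
Proof. by move=> FF' h f fi hf; apply: h => // phi /FF'; exact: hf. Qed.

Lemma unit_valued_prod d1 d2 (T1 : measurableType d1) (T2 : measurableType d2)
    (R : realType) (F : set (T1 -> R)) (G : set (T2 -> R)) : unit_valued F -> unit_valued G ->
  unit_valued [set phi | exists a b, [/\ F a, G b & phi = (fun z : T1 * T2 => a z.1 * b z.2)]].
Proof.
move=> uF uG phi [a [b [/uF[ma a01] /uG[mb b01] ->]]]; split.
  by apply: measurable_funM; exact: measurableT_comp.
move=> z; have /andP[a0 a1] := a01 z.1; have /andP[b0 b1] := b01 z.2.
by rewrite mulr_ge0// mulr_ile1.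
Qed.

Section determining_prod.
Context d1 d2 (T1 : measurableType d1) (T2 : measurableType d2) (R : realType).
Variables (mu1 : {sigma_finite_measure set T1 -> \bar R})
  (mu2 : {sigma_finite_measure set T2 -> \bar R}).

(** The measurability of P cannot be dropped: this is the converse direction of
    Fubini for null sets. *)
Lemma ae_product (P : set (T1 * T2)) : measurable P ->
  {ae mu1, forall x, {ae mu2, forall y, P (x, y)}} ->
  {ae sprod mu1 mu2, forall z, P z}.
Proof.
move=> mP h; have mC : measurable (~` P) by exact: measurableC.
apply/negligibleP => //=; rewrite /sprod /product_measure1/=.
rewrite (@ae_eq_integral _ _ _ mu1 setT (cst 0%E)) ?integral0//.
  exact: measurable_fun_xsection.
apply: filterS h => x hx _ /=; apply/negligibleP; first exact: measurable_xsection.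
by apply: negligibleS hx => y /=; rewrite /xsection/= inE.
Qed.

Lemma ae_ysection (P : set (T1 * T2)) :
  {ae sprod mu1 mu2, forall z, P z} -> {ae mu2, forall y, {ae mu1, forall x, P (x, y)}}.
Proof.
move=> [N [mN N0 PN]].
have mf := measurable_fun_ysection mu1 mN.
have := @ae_eq_integral_abs _ _ _ mu2 setT measurableT _ mf.
have -> : (\int[mu2]_x `|(mu1 \o ysection N) x| = 0)%E.
  rewrite -N0; transitivity ((mu1 \x^ mu2)%E N).
    by rewrite /product_measure2/=; apply: eq_integral => x _; rewrite gee0_abs.
  by apply/esym; rewrite /sprod; apply: product_measure_unique => // A B mA mB; exact: product_measure2E.
case=> h _; have {h} := h erefl; apply: filterS => y /= /(_ I) h.
exists (ysection N y); split => //; first exact: measurable_ysection.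
by move=> x /= nP; rewrite /ysection/= inE; apply: PN.
Qed.

(** Freezing the second test function G i and integrating f against it gives a
    function of the first variable that F can test.  Countability of the second
    family lets all the resulting exceptional null sets be collected in one. *)
Lemma determining_prod (J : countType) (S : set J) (G : J -> T2 -> R)
   (D1 : set T1) (D2 : set T2) (F : set (T1 -> R)) :
  measurable D1 -> measurable D2 ->
  unit_valued F -> unit_valued (G @` S) ->
  determining mu1 D1 F -> determining mu2 D2 (G @` S) ->
  determining (sprod mu1 mu2) (D1 `*` D2)
    [set phi | exists a b, [/\ F a, (G @` S) b & phi = (fun z => a z.1 * b z.2)]].
Proof.
move=> mD1 mD2 uF uG dF dG f fi hf.
have mf : measurable_fun setT f by apply/measurable_EFinP; case/integrableP: fi.
have h1 : forall i, S i -> {ae mu1, forall x, D1 x ->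
    (\int[mu2]_y (f (x, y) * G i y)%:E <= 0)%E}.
  move=> i Si; have [mG G01] : measurable_fun setT (G i) /\ (forall y, 0 <= G i y <= 1).
    by apply: uG; exists i.
  have fGi : (mu1 \x mu2)%E.-integrable setT (EFin \o (fun z => f z * G i z.2)).
    apply: integrableM_le1 => //; first exact: measurableT_comp.
    by move=> z; have /andP[? ?] := G01 z.2; rewrite ger0_norm.
  have hi := integrable_fubini_F fGi.
  pose h x := fine (\int[mu2]_y (f (x, y) * G i y)%:E)%E.
  have aefin := integrable_ae measurableT hi.
  have mh : measurable_fun setT h.
    by apply: measurableT_comp => //; exact: (measurable_int _ hi).
  have hint : mu1.-integrable setT (EFin \o h).
    apply: le_integrable hi => //; first exact/measurable_EFinP.
    by move=> x _ /=; rewrite /h /fubini_F /=; case: (integral _ _ _) => [r||] /=; rewrite ?lee_fin ?normr0 ?leey.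
  have : {ae mu1, forall x, D1 x -> h x <= 0}.
    apply: dF => // phi Fphi; have [mphi phi01] := uF _ Fphi.
    have phi1 x : `|phi x| <= 1.
      by have /andP[? ?] := phi01 x; rewrite ger0_norm.
    have fGphi : (mu1 \x mu2)%E.-integrable setT
        (EFin \o (fun z => f z * G i z.2 * phi z.1)).
      by apply: integrableM_le1 => //; exact: measurableT_comp.
    have -> : (\int[mu1]_x (h x * phi x)%:E =
        \int[mu1 \x mu2]_z (f z * (phi z.1 * G i z.2))%:E)%E.
      rewrite (eq_integral (EFin \o (fun z => f z * G i z.2 * phi z.1))); last first.
        by move=> z _ /=; rewrite -mulrA [G i _ * _]mulrC.
      rewrite -integral12_prod_meas1//.
      apply: ae_eq_integral => //.
      - by apply/measurable_EFinP; apply: measurable_funM.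
      - exact: (measurable_int _ (integrable_fubini_F fGphi)).
      - apply: filterS (ae_integrable1 fGi) => x fx _.
        rewrite /fubini_F/= /h EFinM fineK; last exact: integrable_fin_num.
        rewrite -integralZr//; apply: eq_integral => y _; by rewrite !EFinM.
    by apply: hf; exists phi, (G i); split => //; exists i.
  apply: filterS2 aefin => x /(_ I) fx hx D1x; have := hx D1x.
  by rewrite /h -lee_fin fineK.
have h2 : {ae mu1, forall x, forall i, S i -> D1 x ->
    (\int[mu2]_y (f (x, y) * G i y)%:E <= 0)%E}.
  apply: ae_forall_count => i; have [Si|nSi] := pselect (S i); last exact: aeW.
  by apply: filterS (h1 i Si) => x hx _.
apply: (@ae_product (fun z => (D1 `*` D2) z -> f z <= 0)).
  have -> : (fun z => (D1 `*` D2) z -> f z <= 0) = ~` (D1 `*` D2) `|` (f @^-1` `]-oo, 0]).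
    apply/seteqP; split => z /=; rewrite in_itv/=.
      by move=> h; have [/h|] := pselect ((D1 `*` D2) z); [right|left].
    by case.
  apply: measurableU; first by apply: measurableC; exact: measurableX.
  by rewrite -[_ @^-1` _]setTI; exact: mf.
apply: filterS2 (ae_integrable1 fi) h2 => x fx hx.
have [D1x|nD1x] := pselect (D1 x); last by apply: aeW => y [].
have := dG (fun y => f (x, y)) fx; case.
  by move=> _ [i Si <-]; exact: hx.
move=> N [mN N0 h]; exists N; split => //; apply: subset_trans h => y /= + hy.
by apply => -[_ /=]; exact: hy.
Qed.
End determining_prod.

Section determining1.
Variable R : realType.
Notation leb := (@lebesgue_measure R).

(** Rational endpoints make the family countable, as products of determining
    families require. *)
Definition rbump (i : rat * rat * nat) : R -> R :=
  bump (ratr i.1.1) (ratr i.1.2) i.2.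

Definition rbump_in (A B : R) : set (rat * rat * nat) :=
  [set i | A < ratr i.1.1 /\ ratr i.1.2 < B].

Lemma rbump_unit_valued A B : unit_valued (rbump @` (rbump_in A B)).
Proof.
move=> _ [i _ <-]; split; first exact: measurable_bump.
by move=> x; rewrite bump_ge0 bump_le1.
Qed.

(** Letting the bumps converge to indicators, the primitive of f decreases along
    rational points; at a Lebesgue point with f x > 0 its derivative would be
    positive. *)
Lemma determining_rbump A B : determining leb `]A, B[ (rbump @` (rbump_in A B)).
Proof.
move=> f fi hf.
pose F y := (\int[leb]_(t in `]-oo, y]) f t)%R.
have fiS (D : set R) : measurable D -> leb.-integrable D (EFin \o f).
  by move=> mD; apply: integrableS fi.
have Fle (p q : rat) : A < ratr p -> ratr p < ratr q :> R -> ratr q < B ->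
    F (ratr q) <= F (ratr p).
  move=> Ap pq qB; rewrite -subr_le0 /F Rintegral_itvB//; last 2 first.
  - exact: fiS.
  - by rewrite bnd_simp ltW.
  rewrite -Rintegral_itv_bndo_bndc; last exact: fiS.
  rewrite -lee_fin /Rintegral fineK; last by apply: integrable_fin_num => //; exact: fiS.
  apply: (@cvge_to_le _ _ _ _ _ _ _ (@bump_integral_cvg R f (ratr p) (ratr q) fi)).
  apply: nearW => n; apply: hf; by exists (p, q, n).
have lp := lebesgue_differentiation (open_integrable_locally openT fi).
apply: (@filterS _ _ (ae_filter_ringOfSetsType leb) _ _ _ lp).
move=> x fx /=; rewrite in_itv/= => /andP[Ax xB].
rewrite leNgt; apply/negP => fx0.
have [dF F'] := @FTC1_lebesgue_pt R f -oo%O x (x + 1) (ltr_pwDr ltr01 (lexx x))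
  (fiS _ (measurable_itv _)) (ltNyr x) fx.
have qF : (fun h : R => h^-1 *: (F (h *: 1 + x) - F x)) @ 0^' --> f x.
  by rewrite -F'; rewrite derive1E; exact: dF.
have : \forall h \near 0^', 0 < h^-1 *: (F (h *: 1 + x) - F x).
  exact: cvgr_gt qF _ fx0.
rewrite /dnbhs /within/= => /nbhs_ballP[e /= e0 he].
have {}he h : h != 0 -> `|h| < e -> 0 < h^-1 * (F (h + x) - F x).
  move=> h0 hlt; have := he h; rewrite /GRing.scale/= mulr1; apply => //.
  by rewrite /ball/= sub0r normrN.
have mx : Num.max A (x - e) < x by rewrite gt_max Ax ltrBlDr ltrDl.
have xm : x < Num.min B (x + e) by rewrite lt_min xB ltrDl.
have [p hp] := rat_in_itvoo mx; have [q hq] := rat_in_itvoo xm.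
move: hp hq; rewrite !in_itv/= gt_max lt_min -!andbA => /and3P[Ap pe px] /and3P[xq qB qe].

have rpq : ratr p < ratr q :> R by exact: lt_trans px xq.
have := Fle p q Ap rpq qB; rewrite leNgt => /negP; apply.
apply: (@lt_trans _ _ (F x)).
- have := he (ratr p - x); rewrite subrK subr_eq0 lt_eqF// ltr0_norm ?subr_lt0//.
  rewrite opprB => /(_ isT); rewrite ltrBlDl -ltrBlDr => /(_ pe).
  by rewrite nmulr_rgt0 ?invr_lt0 ?subr_lt0// .
- have := he (ratr q - x); rewrite subrK subr_eq0 gt_eqF// gtr0_norm ?subr_gt0//.
  by rewrite ltrBlDl => /(_ isT qe); rewrite pmulr_rgt0 ?invr_gt0 ?subr_gt0.
Qed.
End determining1.

(** * Integrals along coordinate lines *)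

Section swap.
Context dS (S : measurableType dS) (R : realType).
Variable nu : {sigma_finite_measure set S -> \bar R}.

(** Here c reads off a coordinate of a point and u overwrites it.  The property
    is the Tonelli theorem for the exchange of that coordinate with an independent
    copy s of it; it passes to products, hence to all coordinates of
    space-time. *)
Definition swappable d (T : measurableType d) (mu : {measure set T -> \bar R})
    (c : T -> S) (u : T -> S -> T) :=
  [/\ measurable_fun setT c, measurable_fun setT (fun z : T * S => u z.1 z.2) &
    forall H : T * S -> \bar R, measurable_fun setT H ->
    (forall z, 0 <= H z)%E ->
    (\int[mu]_z \int[nu]_s H (z, s) =
     \int[mu]_z \int[nu]_s H (u z s, c z))%E].

Lemma swappable_id : swappable nu id (fun=> id).
Proof.
split; [exact: measurable_id|exact: measurable_snd|].
move=> H mH H0; exact: (fubini_tonelli H mH H0).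
Qed.

Lemma swappable_snd d (T : measurableType d)
    (mu : {sigma_finite_measure set T -> \bar R}) :
  swappable (sprod mu nu) snd (fun z s => (z.1, s)).
Proof.
split; [exact: measurable_snd| |].
  by apply: measurable_fun_pair => //; apply: measurableT_comp.
move=> H mH H0.
pose F z := (\int[nu]_s H (z, s))%E.
pose G z := (\int[nu]_s H ((z.1, s), z.2))%E.
have mu' : measurable_fun setT (fun z : (T * S) * S => ((z.1.1, z.2), z.1.2)).
  apply: measurable_fun_pair.
    by apply: measurable_fun_pair => //; apply: measurableT_comp.
  by apply: measurableT_comp => //; exact: measurable_fst.
have mF : measurable_fun setT F by exact: (measurable_fun_fubini_tonelli_F H).
have mG : measurable_fun setT G.
  exact: (measurable_fun_fubini_tonelli_F (fun z : (T * S) * S => H ((z.1.1, z.2), z.1.2))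
    (measurableT_comp mH mu') (fun z => H0 _)).
transitivity (\int[mu]_x \int[nu]_y F (x, y))%E.
  by apply: (fubini_tonelli1 F mF) => z; exact: integral_ge0.
transitivity (\int[mu]_x \int[nu]_y G (x, y))%E; last first.
  by apply/esym/(fubini_tonelli1 G mG) => z; exact: integral_ge0.
apply: eq_integral => x _.
apply: (fubini_tonelli (fun z : S * S => H ((x, z.1), z.2))) => //.
apply: (measurableT_comp mH (g := fun z : S * S => ((x, z.1), z.2))).
apply: measurable_fun_pair => //.
by apply: measurable_fun_pair => //; exact: measurable_fst.
Qed.

Lemma swappable_fst d1 d2 (T1 : measurableType d1) (T2 : measurableType d2)
    (mu1 : {sigma_finite_measure set T1 -> \bar R})
    (mu2 : {sigma_finite_measure set T2 -> \bar R}) c u :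
  swappable mu1 c u ->
  swappable (sprod mu1 mu2) (c \o fst) (fun z s => (u z.1 s, z.2)).
Proof.
move=> [mc mu' sw].
have mu1' : measurable_fun setT (fun z : T1 * T2 * S => (u z.1.1 z.2, z.1.2)).
  apply: measurable_fun_pair.
    apply: (measurableT_comp mu' (g := fun z : T1 * T2 * S => (z.1.1, z.2))).
    by apply: measurable_fun_pair => //; apply: measurableT_comp.
  by apply: measurableT_comp => //; exact: measurable_fst.
split => //; first exact: measurableT_comp.
move=> H mH H0.
pose F z := (\int[nu]_s H (z, s))%E.
pose G z := (\int[nu]_s H ((u z.1 s, z.2), c z.1))%E.
have mF : measurable_fun setT F by exact: (measurable_fun_fubini_tonelli_F H).
have mG : measurable_fun setT G.
  apply: (measurable_fun_fubini_tonelli_F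
    (fun z : (T1 * T2) * S => H ((u z.1.1 z.2, z.1.2), c z.1.1)) _ (fun z => H0 _)).
  apply: (measurableT_comp mH (g := fun z : (T1 * T2) * S => ((u z.1.1 z.2, z.1.2), c z.1.1))).
  apply: measurable_fun_pair => //.
  by apply: measurableT_comp => //; apply: measurableT_comp.
transitivity (\int[mu2]_y \int[mu1]_x F (x, y))%E.
  by apply: (fubini_tonelli2 F mF) => z; exact: integral_ge0.
transitivity (\int[mu2]_y \int[mu1]_x G (x, y))%E; last first.
  by apply/esym/(fubini_tonelli2 G mG) => z; exact: integral_ge0.
apply: eq_integral => y _.
apply: (sw (fun z => H ((z.1, y), z.2))) => //.
apply: (measurableT_comp mH (g := fun z : T1 * S => ((z.1, y), z.2))).
apply: measurable_fun_pair => //.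
by apply: measurable_fun_pair => //; exact: measurable_fst.
Qed.

End swap.

Section line_integral.
Context dS dT (S : measurableType dS) (T : measurableType dT) (R : realType).
Variables (nu : {sigma_finite_measure set S -> \bar R})
  (mu : {sigma_finite_measure set T -> \bar R})
  (c : T -> S) (u : T -> S -> T) (I : set S).
Hypotheses (sw : swappable nu mu c u) (cu : forall z s, c (u z s) = s)
  (uu : forall z s, u (u z s) (c z) = z) (mI : measurable I).
Implicit Types h : T -> R.

Definition line_int h (z : T) : \bar R := (\int[nu]_(s in I) (h (u z s))%:E)%E.

Lemma line_int_indic h z :
  line_int h z = (\int[nu]_s (\1_I s * h (u z s))%:E)%E.
Proof.
rewrite /line_int integral_mkcond; apply: eq_integral => s _.
by rewrite patchE indicE; case: ifP => _; rewrite ?mul1r ?mul0r.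
Qed.

Variable h : T -> R.
Hypotheses (h0 : forall z, 0 <= h z) (mh : measurable_fun setT h).

Lemma line_int_ge0 z : (0 <= line_int h z)%E.
Proof. by apply: integral_ge0 => s _; rewrite lee_fin. Qed.

Let mc : measurable_fun setT c. Proof. by case: sw. Qed.

Let mIs : measurable_fun setT (\1_I : S -> R).
Proof. exact: measurable_indic. Qed.

Lemma measurable_line_integrand :
  measurable_fun setT (fun w : T * S => \1_I w.2 * h (u w.1 w.2)).
Proof.
have [_ mupd _] := sw.
apply: measurable_funM; last exact: measurableT_comp mh mupd.
exact: measurableT_comp.
Qed.

Lemma measurable_line_int : measurable_fun setT (line_int h).
Proof.
have -> : line_int h = (fun z => \int[nu]_s (\1_I s * h (u z s))%:E)%E.
  by apply/funext => z; exact: line_int_indic.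
apply: (measurable_fun_fubini_tonelli_F
  (fun w : T * S => (\1_I w.2 * h (u w.1 w.2))%:E)).
  by apply/measurable_EFinP; exact: measurable_line_integrand.
by move=> w; rewrite lee_fin mulr_ge0.
Qed.

(** Exchanging the coordinate c z with the integration variable turns the integral
    of line integrals against a product a (c z) * b z into the product of the
    integral of a with the integral of h against b over the slab c z in I. *)
Lemma line_int_swap (a : S -> R) (b : T -> R) :
  measurable_fun setT a -> measurable_fun setT b ->
  (forall s, 0 <= a s) -> (forall z, 0 <= b z) ->
  (forall z s, b (u z s) = b z) ->
  (\int[mu]_z ((a (c z) * b z)%:E * line_int h z) =
   (\int[nu]_s (a s)%:E) * \int[mu]_z (\1_I (c z) * h z * b z)%:E)%E.
Proof.
move=> ma mb a0 b0 bu; have [_ mupd swap] := sw.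
have mIc : measurable_fun setT (fun z => \1_I (c z) : R) by exact: measurableT_comp.
have mIhb : measurable_fun setT (fun z => \1_I (c z) * h z * b z).
  by do 2?apply: measurable_funM.
pose H (w : T * S) := ((\1_I (c w.1) * h w.1 * b w.1) * a w.2)%:E.
have mH : measurable_fun setT H.
  apply/measurable_EFinP; apply: measurable_funM; last exact: measurableT_comp.
  exact: (measurableT_comp mIhb).
have H0 w : (0 <= H w)%E by rewrite lee_fin !mulr_ge0.
have /= := swap H mH H0; rewrite /H /=.
under eq_integral => z _.
  under eq_integral do rewrite EFinM.
  rewrite ge0_integralZl//; last 3 first.
  - exact/measurable_EFinP.
  - by move=> s _; rewrite lee_fin.
  - by rewrite lee_fin !mulr_ge0.
  over.
rewrite ge0_integralZr//; last 3 first.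
- exact/measurable_EFinP.
- by move=> z _; rewrite lee_fin !mulr_ge0.
- by apply: integral_ge0 => s _; rewrite lee_fin.
rewrite [LHS]muleC => ->.
apply: eq_integral => z _.
under [RHS]eq_integral do rewrite cu bu -mulrA [b z * _]mulrC EFinM muleC.
rewrite ge0_integralZl// ?line_int_indic//.
- apply/measurable_EFinP.
  exact: (measurableT_comp measurable_line_integrand (pair1_measurable z)).
- by move=> s _; rewrite lee_fin mulr_ge0.
- by rewrite lee_fin mulr_ge0.
Qed.

(** Exchanging coordinates bounds the integral by nu I times that of h. *)
Lemma line_int_integrable (B : set T) : measurable B ->
  mu.-integrable setT (EFin \o h) -> (nu I < +oo)%E ->
  (forall z, B z -> I (c z)) ->
  mu.-integrable B (line_int h).
Proof.
move=> mB hi nuI BI; have [_ mupd swap] := sw.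
have mIB : measurable_fun setT (\1_B : T -> R) by exact: measurable_indic.
apply/integrableP; split; first exact: measurable_funTS measurable_line_int.
under eq_integral do rewrite gee0_abs ?line_int_ge0//.
pose H (w : T * S) := (\1_I (c w.1) * h w.1 * \1_B (u w.1 w.2))%:E.
have mH : measurable_fun setT H.
  apply/measurable_EFinP; apply: measurable_funM.
    by apply: measurable_funM; apply: measurableT_comp => //; exact: measurableT_comp.
  exact: (measurableT_comp mIB mupd).
have H0 w : (0 <= H w)%E by rewrite lee_fin !mulr_ge0.
have -> : (\int[mu]_(z in B) line_int h z = \int[mu]_z \int[nu]_s H (u z s, c z))%E.
  rewrite integral_mkcond; apply: eq_integral => z _; rewrite patchE /H /=.
  under eq_integral do rewrite cu uu.
  rewrite indicE; case: ifP => _.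
    by rewrite line_int_indic; apply: eq_integral => s _; rewrite mulr1.
  by rewrite integral0_eq// => s _; rewrite mulr0.
rewrite -(swap H mH H0).
have nuIf : nu I \is a fin_num by rewrite ge0_fin_numE.
apply: (@le_lt_trans _ _ (\int[mu]_z ((h z)%:E * nu I))%E); last first.
  rewrite ge0_integralZr//; last 2 first.
  - exact/measurable_EFinP.
  - by move=> z _; rewrite lee_fin.
  rewrite lte_mul_pinfty//.
  - by apply: integral_ge0 => z _; rewrite lee_fin.
  - exact: integrable_fin_num.
apply: ge0_le_integral => //.
- by move=> z _; exact: integral_ge0.
- exact: measurable_fun_fubini_tonelli_F.
- by apply: emeasurable_funM => //; exact/measurable_EFinP.
have -> : nu I = (\int[nu]_s (\1_I s)%:E)%E by rewrite integral_indic// setIT.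
move=> z _; rewrite -ge0_integralZl//; last 2 first.
- exact/measurable_EFinP.
- by rewrite lee_fin.
apply: ge0_le_integral => //.
- exact: (measurableT_comp mH (pair1_measurable z)).
- apply: emeasurable_funM => //; exact/measurable_EFinP.
move=> s _; rewrite /H/= -EFinM lee_fin [_ * h z]mulrC -mulrA ler_wpM2l//.
rewrite !indicE; case: (boolP (u z s \in B)) => [uB|]; last by rewrite mulr0.
have Is : I s by rewrite -(cu z s); apply: BI; exact/set_mem.
by rewrite (mem_set Is) mulr1 ler_nat leq_b1.
Qed.

(** The hypothesis on the tests is the inequality to be proved, integrated against
    phi and rewritten by [line_int_swap]; a determining family then gives it
    almost everywhere. *)
Lemma le_line_int_of_tests (D : set T) (F : set (T -> R)) (v : T -> R) :
  measurable D -> (nu I < +oo)%E -> (forall z, D z -> I (c z)) ->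
  mu.-integrable setT (EFin \o h) -> mu.-integrable setT (EFin \o v) ->
  unit_valued F -> determining mu D F ->
  (forall phi, F phi -> exists (a : S -> R) (b : T -> R),
    [/\ measurable_fun setT a, measurable_fun setT b,
      (forall s, 0 <= a s) /\ (forall z, 0 <= b z),
      (forall z s, b (u z s) = b z) &
      [/\ phi = (fun z => a (c z) * b z), (forall z, ~ D z -> phi z = 0) &
      (\int[mu]_z (v z * phi z)%:E <=
       (\int[nu]_s (a s)%:E) * \int[mu]_z (\1_I (c z) * h z * b z)%:E)%E]]) ->
  {ae mu, forall z, D z -> ((v z)%:E <= line_int h z)%E}.
Proof.
move=> mD nuI DI hi vi uF dF tests.
have WDi := line_int_integrable mD hi nuI DI.
have mW := measurable_line_int.
pose w z := fine ((line_int h \_ D) z).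
have WDi' : mu.-integrable setT (line_int h \_ D) by apply/(integrable_mkcond _ mD).
have mw : measurable_fun setT w.
  by apply: measurableT_comp => //; exact: (measurable_int _ WDi').
have wi : mu.-integrable setT (EFin \o w).
  apply: le_integrable WDi' => //; first exact/measurable_EFinP.
  by move=> z _ /=; rewrite /w; case: ((line_int h \_ D) z) => [r||] /=;
    rewrite ?lee_fin ?normr0 ?leey.
have fi : mu.-integrable setT (EFin \o (v \- w)).
  by have := integrableB measurableT vi wi; apply: eq_integrable.
have := dF _ fi; case=> [phi Fphi|].
  have [mphi phi01] := uF _ Fphi.
  have [a [b [ma mb [a0 b0] bu [phiE phi0 le]]]] := tests phi Fphi.
  have phi1 z : `|phi z| <= 1 by have /andP[? ?] := phi01 z; rewrite ger0_norm.
  have vphi : mu.-integrable setT (EFin \o (fun z => v z * phi z)).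
    exact: integrableM_le1.
  have wphi : mu.-integrable setT (EFin \o (fun z => w z * phi z)).
    exact: integrableM_le1.
  have -> : (\int[mu]_z ((v \- w) z * phi z)%:E =
      \int[mu]_z (v z * phi z)%:E - \int[mu]_z (w z * phi z)%:E)%E.
    rewrite -integralB//; apply: eq_integral => z _.
    by rewrite -EFinB mulrBl.
  rewrite sube_le0.
  apply: (le_trans le); rewrite -line_int_swap//.
  rewrite le_eqVlt; apply/orP; left; apply/eqP.
  apply: ae_eq_integral => //.
  - apply: emeasurable_funM => //; apply/measurable_EFinP.
    by move: mphi; rewrite phiE.
  - apply/measurable_EFinP; exact: measurable_funM.
  - apply: filterS (integrable_ae measurableT WDi') => z /(_ Logic.I) Wfin _.
    have -> : a (c z) * b z = phi z by rewrite phiE.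
    have [Dz|nDz] := pselect (D z).
      rewrite EFinM /w fineK// patchE mem_set// muleC//.
    by rewrite phi0// mul0e mulr0.
move=> N [mN N0 h1]; exists N; split => //; apply: subset_trans h1 => z /= + hz.
apply => Dz; have := hz Dz; rewrite subr_le0 /w patchE mem_set// => vw.
apply: (@le_trans _ _ (fine (line_int h z))%:E); first by rewrite lee_fin.
by case: (line_int h z) (line_int_ge0 z).
Qed.

End line_integral.

Section coordinates.
Variable R : realType.
Implicit Types (z : Rspacetime R) (j : nat).

(** Coordinates 0, 1, 2 are spatial and 3 is time; the default cases also return
    time. *)
Definition crd j z : R :=
  match j with 0%N => z.1.1.1 | 1%N => z.1.1.2 | 2%N => z.1.2 | _ => z.2 end.

Definition upd j z (s : R) : Rspacetime R :=
  match j with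
  | 0%N => ((s, z.1.1.2), z.1.2, z.2)
  | 1%N => ((z.1.1.1, s), z.1.2, z.2)
  | 2%N => (z.1.1, s, z.2)
  | _ => (z.1, s) end.

Lemma crd_upd j k z s : (j < 4)%N -> (k < 4)%N ->
  crd k (upd j z s) = if k == j then s else crd k z.
Proof. by case: j => [|[|[|[|j]]]]; case: k => [|[|[|[|k]]]]. Qed.

(** These are convertible to [leb3] and [leb4], with sigma-finiteness attached. *)
Definition lam3 := sprod (sprod (@lebesgue_measure R) (@lebesgue_measure R))
  (@lebesgue_measure R).
HB.instance Definition _ := SigmaFiniteMeasure.on lam3.
Definition lam4 := sprod lam3 (@lebesgue_measure R).
HB.instance Definition _ := SigmaFiniteMeasure.on lam4.

Lemma swappable_crd (j : 'I_3) : swappable (@lebesgue_measure R) lam4 (crd j) (upd j).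
Proof.
case: j => -[|[|[|//]]] /= _.
- have s1 := swappable_fst (@lebesgue_measure R) (swappable_id (@lebesgue_measure R)).
  have s2 := swappable_fst (@lebesgue_measure R) s1.
  exact: (swappable_fst (@lebesgue_measure R) s2).
- have s2 := swappable_fst (@lebesgue_measure R) (swappable_snd (@lebesgue_measure R) (@lebesgue_measure R)).
  exact: (swappable_fst (@lebesgue_measure R) s2).
- have s3 := swappable_snd (@lebesgue_measure R) (sprod (@lebesgue_measure R) (@lebesgue_measure R)).
  exact: (swappable_fst (@lebesgue_measure R) s3).
Qed.
End coordinates.

(** * Tensor products of bumps *)

Section tensor_products.
Variable R : realType.
Implicit Types (z : Rspacetime R) (a : nat -> R -> R) (A B : nat -> R).

Definition tens a z : R :=
  a 0%N (crd 0 z) * a 1%N (crd 1 z) * a 2%N (crd 2 z) * a 3%N (crd 3 z).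

(** With psi = 1 this removes the j-th factor of a tensor product. *)
Definition repl a (j : nat) (psi : R -> R) : nat -> R -> R :=
  fun k => if k == j then psi else a k.

Definition box A B : set (Rspacetime R) :=
  `]A 0%N, B 0%N[ `*` `]A 1%N, B 1%N[ `*` `]A 2%N, B 2%N[ `*` `]A 3%N, B 3%N[.

Lemma boxP A B z : box A B z <-> forall k, (k < 4)%N -> A k < crd k z < B k.
Proof.
rewrite /box /=; split.
  by rewrite !in_itv/= => -[[[h0 h1] h2] h3] [|[|[|[|k]]]].
move=> h; rewrite !in_itv/=.
by rewrite (h 0%N)// (h 1%N)// (h 2%N)// (h 3%N).
Qed.

Lemma measurable_box A B : measurable (box A B : set (Rspacetime (measurableTypeR R))).
Proof. by do 3?apply: measurableX => //. Qed.

Lemma determining_box A B : determining (@lam4 R) (box A B)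
  [set phi | exists2 i : nat -> rat * rat * nat,
     (forall k, (k < 4)%N -> rbump_in (A k) (B k) (i k)) &
     phi = tens (fun k => @rbump R (i k))].
Proof.
have d1 k := @determining_rbump R (A k) (B k).
have u1 k := @rbump_unit_valued R (A k) (B k).
have mI k : measurable (`]A k, B k[ : set (measurableTypeR R)) by exact: measurable_itv.
have d2 := determining_prod (mI 0%N) (mI 1%N) (u1 0%N) (u1 1%N) (d1 0%N) (d1 1%N).
have u2 := unit_valued_prod (u1 0%N) (u1 1%N).
have m2 := measurableX (mI 0%N) (mI 1%N).
have d3 := determining_prod m2 (mI 2%N) u2 (u1 2%N) d2 (d1 2%N).
have u3 := unit_valued_prod u2 (u1 2%N).
have m3 := measurableX m2 (mI 2%N).
have d4 := determining_prod m3 (mI 3%N) u3 (u1 3%N) d3 (d1 3%N).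
apply: determiningS d4 => phi [_ [_ [[_ [_ [[_ [_ [[i0 h0 <-] [i1 h1 <-] ->]]] [i2 h2 <-] ->]]] [i3 h3 <-] ->]]].
by exists (nth i3 [:: i0; i1; i2; i3]) => // -[|[|[|[|k]]]].
Qed.

Lemma tens_replE a j psi z : (j < 4)%N ->
  tens (repl a j psi) z = psi (crd j z) * tens (repl a j (cst 1)) z.
Proof. by rewrite /tens /repl; case: j => [|[|[|[|j]]]] //= _; ring. Qed.

Lemma repl_id a j : repl a j (a j) = a.
Proof. by apply/funext => k; rewrite /repl; case: eqP => [->|]. Qed.

Lemma tens_upd a j z s : (j < 4)%N ->
  tens (repl a j (cst 1)) (upd j z s) = tens (repl a j (cst 1)) z.
Proof. by rewrite /tens /repl; case: j => [|[|[|[|j]]]]. Qed.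

Lemma tens_neq0 a z k : (k < 4)%N -> tens a z != 0 -> a k (crd k z) != 0.
Proof.
rewrite /tens !mulf_eq0 !negb_or -!andbA => + /and4P[? ? ? ?].
by case: k => [|[|[|[|k]]]].
Qed.

Lemma tensor_tens a : (forall k, (k < 4)%N -> smooth1 (a k)) -> tensor (tens a).
Proof.
move=> sa; exact: (tensor_prod (sa 0%N isT) (sa 1%N isT) (sa 2%N isT) (sa 3%N isT)).
Qed.

Lemma derive_tens a (j : 'I_3) psi psi' z :
  (forall k, (k < 4)%N -> smooth1 (a k)) ->
  (forall x : R, is_derive x 1 psi (psi' x)) ->
  'D_(dirx R j) (tens (repl a j psi)) z = tens (repl a j psi') z.
Proof.
move=> sa dpsi.
pose b := repl a j psi.
have db k : (k < 4)%N -> exists b', forall x : R, is_derive x 1 (b k) (b' x).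
  rewrite /b /repl; case: eqP => [_ _|_ k4]; first by exists psi'.
  by have [b' _ h] := smooth1_derive (sa k k4); exists b'.
have [b0 d0] := db 0%N isT; have [b1 d1] := db 1%N isT.
have [b2 d2] := db 2%N isT; have [b3 d3] := db 3%N isT.
have [_ ->] := is_derive_prod4 z (dirx R j) d0 d1 d2 d3.
rewrite /tens /b /repl; move: d0 d1 d2; rewrite /b /repl.
have uniqd (f f1 f2 : R -> R) : (forall x : R, is_derive x 1 f (f1 x)) ->
    (forall x : R, is_derive x 1 f (f2 x)) -> f1 = f2.
  by move=> h1 h2; apply/funext => x; have [_ <-] := h1 x; have [_ <-] := h2 x.
clear db d3 b; case: j => -[|[|[|//]]] /= _ e0 e1 e2.
- by rewrite (uniqd _ _ _ e0 dpsi); ring.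
- by rewrite (uniqd _ _ _ e1 dpsi); ring.
- by rewrite (uniqd _ _ _ e2 dpsi); ring.
Qed.

End tensor_products.

(** * Compactly supported primitives *)

Section primitive.
Variable R : realType.
Notation mu := (@lebesgue_measure R).
Implicit Types (a b h : R -> R) (p q x : R).

Lemma lebesgue_itvoo p q : p < q -> mu `]p, q[%classic = (q - p)%:E.
Proof. by move=> pq; rewrite lebesgue_measure_itv/= lte_fin pq EFinB. Qed.

Lemma integrable_bump p q n : mu.-integrable setT (EFin \o bump p q n).
Proof.
apply: (@le_integrable _ _ _ mu setT measurableT _ (EFin \o \1_(`]p, q[%classic))).
- by apply/measurable_EFinP; exact: measurable_bump.
- move=> x _ /=; rewrite lee_fin ger0_norm ?bump_ge0// ger0_norm// indicE.
  have [pxq|npxq] := boolP (p < x < q).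
    by rewrite mem_set/= ?in_itv// bump_le1.
  by rewrite bump_out.
- exact: integrable_indic_itv.
Qed.

Lemma Rintegral_le_total h (D : set R) : measurable D ->
  mu.-integrable setT (EFin \o h) -> (forall x, 0 <= h x) ->
  0 <= \int[mu]_(x in D) h x <= \int[mu]_x h x.
Proof.
move=> mD hi h0; rewrite Rintegral_ge0//=.
have mh : measurable_fun setT h by apply/measurable_EFinP; case/integrableP: hi.
apply: fine_le.
- apply: integrable_fin_num => //; exact: integrableS hi.
- exact: integrable_fin_num.
- apply: ge0_subset_integral => //; first exact/measurable_EFinP.
  by move=> x _; rewrite lee_fin.
Qed.

(** The function a - c b has integral zero, so its primitive vanishes on both
    sides of ]p, q[ and is a legitimate test function; the partial integrals of a
    and of c b both lie in the interval from 0 to A, which gives the bound on psi. *)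
Lemma balanced_primitive p q a b : p < q -> smooth1 a -> smooth1 b ->
  (forall x, 0 <= a x) -> (forall x, 0 <= b x) ->
  mu.-integrable setT (EFin \o a) -> mu.-integrable setT (EFin \o b) ->
  (forall x, ~~ (p < x < q) -> a x = 0) -> (forall x, ~~ (p < x < q) -> b x = 0) ->
  0 < \int[mu]_x b x ->
  let A := \int[mu]_x a x in let c := A / \int[mu]_x b x in
  exists psi : R -> R, [/\ smooth1 psi,
    forall x, is_derive x 1 psi (a x - c * b x),
    forall x, ~~ (p < x < q) -> psi x = 0 & forall x, `|psi x| <= A].
Proof.
move=> pq sa sb a0 b0 ia ib oa ob B0 A c.
have A0 : 0 <= A by exact: Rintegral_ge0.
have c0 : 0 <= c by rewrite divr_ge0// ltW.
pose f x := a x - c * b x.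
have icb : mu.-integrable setT (EFin \o (fun x => c * b x)).
  by have := @integrableZl _ _ _ mu setT measurableT c _ ib.
have fi : mu.-integrable setT (EFin \o f).
  have := @integrableB _ _ _ mu setT measurableT _ _ ia icb.
  by apply: eq_integrable => // x _; rewrite /= EFinB.
have iS (h : R -> R) (D : set R) : measurable D -> mu.-integrable setT (EFin \o h) ->
    mu.-integrable D (EFin \o h).
  by move=> mD; exact: integrableS.
have mI x : measurable (`]-oo, x] : set R) by exact: measurable_itv.
have sf : smooth1 f.
  have -> : f = (fun x => a x + (-1) * (c * b x)).
    by apply/funext => x; rewrite mulN1r.
  by apply: smooth1D => //; do 2!apply: smooth1Z.
pose psi x := \int[mu]_(t in `]-oo, x]) f t.
have dpsi x : is_derive x 1 psi (f x).
  have [d dE] := @continuous_FTC1 R f -oo%O x (x + 1) (ltr_pwDr ltr01 (lexx x))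
    (iS _ _ (mI _) fi) (ltNyr x) (@smooth1_continuous R f sf x).
  apply: DeriveDef; [exact: d|by rewrite -derive1E; exact: dE].
have psiE x : psi x = \int[mu]_(t in `]-oo, x]) a t - c * \int[mu]_(t in `]-oo, x]) b t.
  rewrite -RintegralZl//; last exact: iS.
  by rewrite -RintegralB//; exact: iS.
exists psi; split => //.
- exact: smooth1_prim sf dpsi.
- move=> x; rewrite negb_and -!leNgt => /orP[xp|qx].
    rewrite /psi -(Rintegral_set0 mu f) [LHS]Rintegral_mkcond [RHS]Rintegral_mkcond.
    apply: eq_Rintegral => y _; rewrite patchE [RHS]patchE in_set0.
    case: ifPn => //; rewrite inE/= in_itv/= => yx.
    have ny : ~~ (p < y < q) by rewrite negb_and -leNgt (le_trans yx xp).
    by rewrite /f oa// ob// mulr0 subr0.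
  rewrite psiE.
  have E h : (forall x, ~~ (p < x < q) -> h x = 0) ->
      \int[mu]_(t in `]-oo, x]) h t = \int[mu]_t h t.
    move=> oh; rewrite Rintegral_mkcond; apply: eq_Rintegral => y _.
    rewrite patchE; case: ifPn => //; rewrite notin_setE/= in_itv/= => /negP.
    rewrite -ltNge => xy; rewrite oh// negb_and -!leNgt.
    by rewrite (le_trans qx (ltW xy)) orbT.
  by rewrite !E// /c divfK ?subrr// gt_eqF.
- move=> x; rewrite psiE.
  have /andP[a1 a2] := Rintegral_le_total (mI x) ia a0.
  have /andP[b1 b2] := Rintegral_le_total (mI x) ib b0.
  have cb : 0 <= c * (\int[mu]_(t in `]-oo, x]) b t) <= A.
    rewrite mulr_ge0//=; apply: (@le_trans _ _ (c * \int[mu]_x b x)).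
      exact: ler_wpM2l.
    by rewrite /c divfK// gt_eqF.
  move: a1 a2 cb; rewrite -/A => a1 a2 /andP[cb1 cb2].
  by rewrite ler_norml (le_trans _ (lerB a1 cb2)) ?sub0r// (le_trans (lerB a2 cb1))// subr0.
Qed.

(** Gives a b for [balanced_primitive] with c <= 2 A / (q - p), uniformly in
    a. *)
Lemma bump_mass p q : p < q -> exists n, (q - p) / 2 < \int[mu]_x bump p q n x.
Proof.
move=> pq.
pose f : R -> R := \1_(`]p, q[%classic).
have fi : mu.-integrable setT (EFin \o f) by exact: integrable_indic_itv.
have := @bump_integral_cvg R f p q fi.
have -> : (\int[mu]_(x in `]p, q[) (f x)%:E = (q - p)%:E)%E.
  by rewrite /f integral_indic// setIid; exact: lebesgue_itvoo.
move=> cv; apply: contrapT => /forallNP h.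
have : ((q - p)%:E <= ((q - p) / 2)%:E)%E.
  apply: (cvge_to_le cv); apply: nearW => n.
  have := h n; move/negP; rewrite -leNgt => hn.
  have -> : (\int[mu]_x (f x * bump p q n x)%:E = \int[mu]_x (bump p q n x)%:E)%E.
    apply: eq_integral => x _; rewrite /f indicE.
    have [pxq|npxq] := boolP (p < x < q).
      by rewrite mem_set/= ?in_itv// mul1r.
    by rewrite bump_out// mulr0.
  rewrite -[leLHS]fineK ?lee_fin//.
  exact: (integrable_fin_num measurableT (integrable_bump p q n)).
by rewrite lee_fin; lra.
Qed.
End primitive.

Section test_functions.
Variable R : realType.
Implicit Types (z : Rspacetime R) (a : nat -> R -> R) (l r : nat -> R).

(** A cube of half side lambda/2 fits in the cylinder because
    (1/2)^2 + (1/2)^2 < 1. *)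
Lemma cyl_cube (x : Rspace R) (rho lam : R) : 0 < lam -> rho <= lam / 2 ->
  `|x.1.1| <= rho -> `|x.1.2| <= rho -> `|x.2| <= rho -> cyl lam x.
Proof.
move=> l0 rl h1 h2 h3; split; last by apply: (le_lt_trans h3); lra.
have rho0 : 0 <= rho by apply: le_trans h1.
have s1 : x.1.1 ^+ 2 <= (lam / 2) ^+ 2.
  by rewrite -[leLHS]real_normK ?num_real// lerXn2r ?nnegrE ?divr_ge0 ?(le_trans h1)// ltW.
have s2 : x.1.2 ^+ 2 <= (lam / 2) ^+ 2.
  by rewrite -[leLHS]real_normK ?num_real// lerXn2r ?nnegrE ?divr_ge0 ?(le_trans h2)// ltW.
rewrite /axis_dist -[ltRHS]ger0_norm ?ltW// -sqrtr_sqr ltr_sqrt ?exprn_gt0//.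
apply: (le_lt_trans (lerD s1 s2)); have := exprn_gt0 2 l0.
by rewrite expr2 expr2; lra.
Qed.

Lemma pcyl1_box z : (forall k, (k < 3)%N -> `|crd k z| <= 1 / 2) ->
  -1 < crd 3 z < 0 -> pcyl 1 z.
Proof.
move=> h ht; split; last by rewrite /= in_itv/= expr1n.
by apply: (@cyl_cube _ (1/2)) => //; [exact: (h 0%N)|exact: (h 1%N)|exact: (h 2%N)].
Qed.

Lemma test_function_tens a l r :
  (forall k, (k < 4)%N -> smooth1 (a k)) ->
  (forall k, (k < 4)%N -> forall x, ~~ (l k < x < r k) -> a k x = 0) ->
  (forall k, (k < 3)%N -> - (1 / 2) <= l k /\ r k <= 1 / 2) ->
  -1 < l 3%N -> r 3%N < 0 -> test_function (pcyl 1) (tens a).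
Proof.
move=> sa oa lr l3 r3.
pose K : set (Rspacetime R) :=
  `[l 0%N, r 0%N] `*` `[l 1%N, r 1%N] `*` `[l 2%N, r 2%N] `*` `[l 3%N, r 3%N].
have cK : compact K by do 3?apply: compact_setX; exact: segment_compact.
have sK : [set z | tens a z != 0] `<=` K.
  move=> z /= nz.
  have h k : (k < 4)%N -> l k <= crd k z <= r k.
    move=> k4; have := tens_neq0 k4 nz; apply: contraNT => hk; apply/eqP/oa => //.
    by apply: contra hk => /andP[h1 h2]; rewrite !ltW.
  split; [split; [split|]|]; rewrite /= in_itv/=.
  - exact: (h 0%N).
  - exact: (h 1%N).
  - exact: (h 2%N).
  - exact: (h 3%N).
have sclK : closure [set z | tens a z != 0] `<=` K.
  rewrite (closure_id K).1; first exact: closure_subset.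
  by apply: compact_closed => //; exact: norm_hausdorff.
split.
- by apply: tensor_smooth; exact: tensor_tens.
- by apply: subclosed_compact cK sclK; exact: closed_closure.
- move=> z /sclK [[[/= h0 h1] h2] h3]; move: h0 h1 h2 h3; rewrite !in_itv/=.
  move=> h0 h1 h2 /andP[h3 h4]; apply: pcyl1_box.
    have key k x : (k < 3)%N -> l k <= x <= r k -> `|x| <= 1/2.
      move=> k3 /andP[lx xr]; have [? ?] := lr k k3.
      by rewrite ler_norml; apply/andP; split; lra.
    move=> [|[|[|//]]] _; [exact: (key 0%N)|exact: (key 1%N)|exact: (key 2%N)].
  by rewrite /=; apply/andP; split; lra.
Qed.
End test_functions.

(** Integration by parts moves u * phi = u * (dpsi + c * chi) onto terms that do
    not involve phi. *)
Lemma Rintegral_by_parts_bound d (T : measurableType d) (R : realType)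
    (mu : {measure set T -> \bar R}) (D : set T)
    (u g phi chi psi dpsi M : T -> R) (c K : R) :
  measurable D -> mu.-integrable D (EFin \o u) -> mu.-integrable D (EFin \o g) ->
  measurable_fun D phi -> measurable_fun D chi -> measurable_fun D psi ->
  (forall z, `|phi z| <= 1) -> (forall z, `|chi z| <= 1) ->
  (forall z, `|psi z| <= K) -> mu.-integrable D (EFin \o M) ->
  (forall z, D z -> dpsi z = phi z - c * chi z) ->
  (\int[mu]_(z in D) (u z * dpsi z) = - (\int[mu]_(z in D) (g z * psi z)))%R ->
  (forall z, D z -> `|c * (u z * chi z) - g z * psi z| <= M z) ->
  `|\int[mu]_(z in D) (u z * phi z)| <= \int[mu]_(z in D) M z.
Proof.
move=> mD ui gi mphi mchi mpsi phi1 chi1 psiK Mi dpsiE parts le.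
have uphi : mu.-integrable D (EFin \o (fun z => u z * phi z)) by exact: integrableM_bounded.
have uchi : mu.-integrable D (EFin \o (fun z => u z * chi z)) by exact: integrableM_bounded.
have gpsi : mu.-integrable D (EFin \o (fun z => g z * psi z)) by exact: integrableM_bounded.
have cuchi : mu.-integrable D (EFin \o (fun z => c * (u z * chi z))).
  by have := @integrableZl _ _ _ mu D mD c _ uchi.
have di : mu.-integrable D (EFin \o (fun z => c * (u z * chi z) - g z * psi z)).
  by have := integrableB mD cuchi gpsi; apply: eq_integrable.
have -> : \int[mu]_(z in D) (u z * phi z) =
    \int[mu]_(z in D) (c * (u z * chi z) - g z * psi z).
  rewrite RintegralB// -parts.
  transitivity (\int[mu]_(z in D) (u z * phi z) - \int[mu]_(z in D) (c * (u z * chi z))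
     + \int[mu]_(z in D) (c * (u z * chi z))); first by rewrite subrK.
  rewrite -RintegralB// addrC; congr (_ + _).
  apply: eq_Rintegral => z /set_mem Dz; rewrite dpsiE//; ring.
apply: (le_trans (le_normr_Rintegral mD di)).
apply: le_Rintegral => //.
exact: (@integrable_norm _ _ _ mu D _ di).
Qed.

(** * Weak derivatives control a function along lines *)

Section weak_derivative_lines.
Variable R : realType.
Notation mu := (@lebesgue_measure R).
Notation lam4 := (@lam4 R).
Implicit Types (z : Rspacetime R) (u g : Rspacetime R -> R) (a : nat -> R -> R).

Lemma upd_upd (j : nat) z s : upd j (upd j z s) (crd j z) = z.
Proof. by case: j z => [|[|[|j]]] [[[x y] w] t]. Qed.

Lemma crd_upd_same (j : nat) z s : crd j (upd j z s) = s.
Proof. by case: j => [|[|[|j]]]. Qed.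

Lemma measurable_crd (j : nat) :
  measurable_fun setT (crd j : Rspacetime (measurableTypeR R) -> measurableTypeR R).
Proof.
case: j => [|[|[|j]]].
- by apply: measurableT_comp => //; apply: measurableT_comp.
- by apply: measurableT_comp => //; apply: measurableT_comp.
- exact: measurableT_comp.
- exact: measurable_snd.
Qed.

Lemma measurable_tens a : (forall k, (k < 4)%N -> measurable_fun setT (a k)) ->
  measurable_fun setT (tens a : Rspacetime (measurableTypeR R) -> R).
Proof.
move=> ma; rewrite /tens; do 3?apply: measurable_funM.
- exact: measurableT_comp (ma 0%N isT) (measurable_crd 0).
- exact: measurableT_comp (ma 1%N isT) (measurable_crd 1).
- exact: measurableT_comp (ma 2%N isT) (measurable_crd 2).
- exact: measurableT_comp (ma 3%N isT) (measurable_crd 3).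
Qed.

Lemma tens_01 a z : (forall k, (k < 4)%N -> forall x, 0 <= a k x <= 1) ->
  0 <= tens a z <= 1.
Proof.
move=> h; rewrite /tens.
have /andP[a0 b0] := h 0%N isT (crd 0 z); have /andP[a1 b1] := h 1%N isT (crd 1 z).
have /andP[a2 b2] := h 2%N isT (crd 2 z); have /andP[a3 b3] := h 3%N isT (crd 3 z).
by rewrite !mulr_ge0// !mulr_ile1 ?mulr_ge0.
Qed.

Notation Q := (@pcyl R 1).

Lemma measurable_axis_dist :
  measurable_fun setT (@axis_dist R : Rspace (measurableTypeR R) -> measurableTypeR R).
Proof.
apply: (measurableT_comp (f := @Num.sqrt R)).
  by apply: continuous_measurable_fun; exact: sqrt_continuous.
apply: measurable_funD; apply: measurable_funX; apply: measurableT_comp => //;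
  exact: measurableT_comp.
Qed.

Lemma measurable_cyl (rho : R) :
  measurable (cyl rho : set (Rspace (measurableTypeR R))).
Proof.
have -> : cyl rho = (@axis_dist R @^-1` `]-oo, rho[) `&`
    ((fun x : Rspace R => `|x.2|) @^-1` `]-oo, rho[).
  by apply/seteqP; split => x; rewrite /cyl/= !in_itv.
apply: measurableI; rewrite -[X in measurable X]setTI.
  exact: measurable_axis_dist.
have mabs : measurable_fun setT ((fun x => `|x.2|) : Rspace (measurableTypeR R) -> R).
  by apply: measurableT_comp => //; exact: measurable_snd.
exact: mabs.
Qed.

Lemma measurable_pcyl (rho : R) :
  measurable (pcyl rho : set (Rspacetime (measurableTypeR R))).
Proof. by apply: measurableX; [exact: measurable_cyl|exact: measurable_itv]. Qed.

(** The box is a window ]p, q[ in direction j times fixed sides in the other directions,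
    short enough for the box to lie in the cylinder Q when ]p, q[ does in ]-1/2, 1/2[. *)
Definition side_lo (j : 'I_3) (p : R) (k : nat) : R :=
  if k == j then p else if (k < 3)%N then - (1 / 2) else -1.
Definition side_hi (j : 'I_3) (q : R) (k : nat) : R :=
  if k == j then q else if (k < 3)%N then 1 / 2 else 0.

Lemma tested_pointwise_bound (c A k x y b w C : R) : 0 <= c -> c <= A * k ->
  0 <= b -> b <= 1 -> `|w| <= A -> 0 <= C ->
  `|c * (x * (b * C)) - y * (w * C)| <= A * ((k * `|x| + `|y|) * C).
Proof.
move=> c0 cA b0 b1 wA C0; apply: (le_trans (ler_normB _ _)).
rewrite !normrM (ger0_norm c0) (ger0_norm C0) (ger0_norm b0).
rewrite [leLHS](_ : _ = (c * b * `|x| + `|w| * `|y|) * C); last by ring.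
rewrite mulrA ler_wpM2r// mulrDr lerD// ?mulrA; last by rewrite ler_wpM2r.
by rewrite ler_wpM2r// (le_trans _ cA)// ler_piMr.
Qed.

(** This is the bound of [weak_derivative_line_bound] integrated against a product
    of bumps, in the form produced by [line_int_swap]: the factor a_j has been
    replaced by its integral, while the other factors are unchanged. *)
Lemma weak_derivative_tested (j : 'I_3) (p q : R) (u g : Rspacetime R -> R)
    (i : nat -> rat * rat * nat) (a : nat -> R -> R) :
  a = (fun k => @rbump R (i k)) -> - (1 / 2) <= p -> p < q -> q <= 1 / 2 ->
  weak_derivative Q (dirx R j) u g ->
  lam4.-integrable Q (EFin \o u) -> lam4.-integrable Q (EFin \o g) ->
  (forall k, (k < 4)%N -> rbump_in (side_lo j p k) (side_hi j q k) (i k)) ->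
  `|\int[lam4]_(z in Q) (u z * tens a z)| <=
  \int[lam4]_(z in Q) ((\int[mu]_s a j s) *
    (\1_(`]p, q[%classic : set R) (crd j z) * (2 / (q - p) * `|u z| + `|g z|)
      * tens (repl a j (cst 1)) z)).
Proof.
move=> aE p12 pq q12 [_ _ wd] ui gi hi.
have sa k : (k < 4)%N -> smooth1 (a k) by move=> _; rewrite aE; exact: smooth1_bump.
have ma k : measurable_fun setT (a k) by rewrite aE; exact: measurable_bump.
have a01 k x : 0 <= a k x <= 1 by rewrite aE bump_ge0 bump_le1.
have ia k : mu.-integrable setT (EFin \o a k) by rewrite aE; exact: integrable_bump.
have j4 : (j < 4)%N by rewrite (ltn_trans (ltn_ord j)).
have [pj jq] : p < ratr (i j).1.1 /\ ratr (i j).1.2 < q.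
  by have := hi j j4; rewrite /rbump_in/= /side_lo /side_hi eqxx.
have oaj x : ~~ (p < x < q) -> a j x = 0.
  move=> hx; rewrite aE; apply: bump_out; apply: contra hx => /andP[h1 h2].
  by rewrite (lt_trans pj h1) (lt_trans h2 jq).
have [n hn] := bump_mass pq.
pose b := bump p q n.
have B0 : 0 < \int[mu]_x b x by apply: lt_trans hn; rewrite divr_gt0// subr_gt0.
have [psi [spsi dpsi opsi psiA]] := balanced_primitive pq (sa j j4) (smooth1_bump p q n)
  (fun x => (andP (a01 j x)).1) (bump_ge0 p q n)
  (ia j) (integrable_bump p q n) oaj (fun x hx => bump_out n hx) B0.
have A0 : 0 <= \int[mu]_x a j x.
  by apply: Rintegral_ge0 => x _; have /andP[] := a01 j x.
set A := \int[mu]_x a j x in psiA A0 *.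
set c := A / _ in dpsi.
have smooth_repl f : smooth1 f -> forall k, (k < 4)%N -> smooth1 (repl a j f k).
  by move=> sf k k4; rewrite /repl; case: eqP => // _; exact: sa.
have smooth_measurable f : smooth1 f -> measurable_fun setT f.
  by move=> sf; apply: continuous_measurable_fun; exact: smooth1_continuous.
have m_repl f : measurable_fun setT f ->
    measurable_fun setT (tens (repl a j f) : Rspacetime (measurableTypeR R) -> R).
  by move=> mf; apply: measurable_tens => k _; rewrite /repl; case: eqP.
have test : test_function Q (tens (repl a j psi)).
  apply: (@test_function_tens R _
    (fun k => if k == j then p else ratr (i k).1.1)
    (fun k => if k == j then q else ratr (i k).1.2)).
  - exact: smooth_repl.
  - move=> k k4 x; rewrite /repl; case: eqP => [_|_ hx]; first exact: opsi.
    by rewrite aE; exact: bump_out.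
  - move=> k k3; case: eqP => [_|/eqP kj]; first by [].
    have := hi k (ltnW k3); rewrite /rbump_in /side_lo /side_hi/= (negbTE kj) k3.
    by case=> h1 h2; split; exact: ltW.
  - rewrite gtn_eqF//; have := hi 3%N isT; rewrite /rbump_in /side_lo/= gtn_eqF//.
    by case.
  - rewrite gtn_eqF//; have := hi 3%N isT; rewrite /rbump_in /side_hi/= gtn_eqF//.
    by case.
have parts := wd _ test.
have mQ := measurable_pcyl 1.
have tc z : 0 <= tens (repl a j (cst 1)) z <= 1.
  by apply: tens_01 => k _ x; rewrite /repl; case: eqP => // _ /=; rewrite ler01 lexx.
have EC f z : tens (repl a j f) z = f (crd j z) * tens (repl a j (cst 1)) z.
  exact: tens_replE.
have Ea z : tens a z = a j (crd j z) * tens (repl a j (cst 1)) z.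
  by rewrite -EC repl_id.
apply: (@Rintegral_by_parts_bound _ _ R lam4 Q u g (tens a) (tens (repl a j b))
  (tens (repl a j psi)) ('D_(dirx R j) (tens (repl a j psi))) _ c A) => //.
- apply: measurable_funTS; exact: measurable_tens.
- apply: measurable_funTS; apply: m_repl; exact: measurable_bump.
- apply: measurable_funTS; apply: m_repl; exact: smooth_measurable.
- by move=> z; have /andP[h0 h1] := tens_01 z (fun k _ => a01 k); rewrite ger0_norm.
- move=> z; rewrite (EC b) normrM; have /andP[h0 h1] := tc z.
  by rewrite (ger0_norm h0) ger0_norm ?bump_ge0// mulr_ile1 ?bump_ge0 ?bump_le1.
- move=> z; rewrite (EC psi) normrM; have /andP[h0 h1] := tc z.
  by rewrite (ger0_norm h0) -[leRHS]mulr1 ler_pM.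
- have ki : lam4.-integrable Q (EFin \o (fun z => 2 / (q - p) * `|u z| + `|g z|)).
    have ui' := integrableZl mQ (2 / (q - p)) (integrable_norm ui).
    have := integrableD mQ ui' (integrable_norm gi); exact: eq_integrable.
  have mIC : measurable_fun setT ((fun z => A * (\1_(`]p, q[%classic : set R) (crd j z)
      * tens (repl a j (cst 1)) z)) : Rspacetime (measurableTypeR R) -> R).
    apply: measurable_funM => //; apply: measurable_funM.
      by apply: measurableT_comp (measurable_crd j); exact: measurable_indic.
    by apply: m_repl; exact: measurable_cst.
  have ICA z : `|A * (\1_(`]p, q[%classic : set R) (crd j z) * tens (repl a j (cst 1)) z)| <= A.
    have /andP[C0 C1] := tc z.
    rewrite normrM (ger0_norm A0) -[leRHS]mulr1 ler_wpM2l// normrM (ger0_norm C0).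
    by rewrite mulr_ile1// indicE ger0_norm// lern1 leq_b1.
  have := integrableM_bounded mQ ki (measurable_funTS mIC) ICA.
  by apply: eq_integrable => // z _; congr EFin; ring.
- move=> z _; rewrite (derive_tens j z sa dpsi).
  by rewrite (EC (fun x => _)) Ea (EC b) mulrBl mulrA.
- move=> z Qz; rewrite (EC b) (EC psi).
  have k0 : 0 <= 2 / (q - p) by rewrite divr_ge0// subr_ge0 ltW.
  have /andP[C0 _] := tc z; move: (tens (repl a j (cst 1)) z) C0 => C C0.
  have [hz|hz] := boolP (p < crd j z < q); last first.
    rewrite opsi// /b bump_out// !(mul0r, mulr0) subrr normr0 mulr_ge0//.
    by do 2?apply: mulr_ge0 => //; apply: addr_ge0 => //; exact: mulr_ge0.
  rewrite indicE mem_set/= ?in_itv// mul1r.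
  have b1 := bump_le1 p q n (crd j z); have b0 := bump_ge0 p q n (crd j z).
  have c0 : 0 <= c by rewrite /c divr_ge0// ltW.
  have cA : c <= A * (2 / (q - p)).
    rewrite /c ler_wpM2l// -[leRHS]invrK lef_pV2 ?posrE ?invr_gt0 ?divr_gt0 ?subr_gt0//.
    by rewrite invf_div ltW.
  exact: tested_pointwise_bound.
Qed.

End weak_derivative_lines.

Section line_bound.
Variable R : realType.
Notation mu := (@lebesgue_measure R).
Notation lam4 := (@lam4 R).
Notation Q := (@pcyl R 1).
Implicit Types (z : Rspacetime R) (u g : Rspacetime R -> R).

Lemma ltn_ord34 (j : 'I_3) : (j < 4)%N.
Proof. exact: ltn_trans (ltn_ord j) _. Qed.

Lemma box_side_pcyl1 (j : 'I_3) (p q : R) z : - (1 / 2) <= p -> q <= 1 / 2 ->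
  box (side_lo j p) (side_hi j q) z -> pcyl 1 z.
Proof.
move=> p12 q12 /boxP h; apply: pcyl1_box.
  move=> k k3; have := h k (ltnW k3); rewrite /side_lo /side_hi k3.
  by case: eqP => _ /andP[h1 h2]; rewrite ler_norml; apply/andP; split; lra.
by have := h 3%N isT; rewrite /side_lo /side_hi gtn_eqF.
Qed.

Lemma box_side_upd (j : 'I_3) (p q : R) z s : p < s < q ->
  box (side_lo j p) (side_hi j q) z -> box (side_lo j p) (side_hi j q) (upd j z s).
Proof.
move=> pq /boxP h; apply/boxP => k k4.
rewrite crd_upd ?(ltn_trans (ltn_ord j))//.
case: eqP => [->|_]; last exact: h.
by rewrite /side_lo /side_hi eqxx.
Qed.

(** On lines this is the fundamental theorem of calculus: a point value differs
    from a mean over the window by at most the integral of the derivative.  The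
    factor 2 comes from comparing with the mean against a bump of mass more than
    (q - p) / 2. *)
Lemma weak_derivative_line_bound (j : 'I_3) (p q : R) u g :
  - (1 / 2) <= p -> p < q -> q <= 1 / 2 ->
  weak_derivative Q (dirx R j) u g ->
  lam4.-integrable Q (EFin \o u) -> lam4.-integrable Q (EFin \o g) ->
  {ae lam4, forall z, box (side_lo j p) (side_hi j q) z ->
    (`|u z|%:E <= \int[mu]_(s in `]p, q[)
       (2 / (q - p) * `|u (upd j z s)| + `|g (upd j z s)|)%:E)%E}.
Proof.
move=> p12 pq q12 wd ui gi.
have mQ := @measurable_pcyl R 1.
have k0 : 0 <= 2 / (q - p) by rewrite divr_ge0// subr_ge0 ltW.
pose h0 z := 2 / (q - p) * `|u z| + `|g z|.
pose h : Rspacetime R -> R := h0 \_ Q.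
have hge0 z : 0 <= h z.
  by rewrite /h patchE; case: ifP => // _; rewrite addr_ge0// mulr_ge0.
have h0i : lam4.-integrable Q (EFin \o h0).
  have ui' := integrableZl mQ (2 / (q - p)) (integrable_norm ui).
  have := integrableD mQ ui' (integrable_norm gi); exact: eq_integrable.
have hi : lam4.-integrable setT (EFin \o h).
  rewrite /h -restrict_EFin; exact/(integrable_mkcond _ mQ).
have mh : measurable_fun setT h by apply/measurable_EFinP; case/integrableP: hi.
have uQi : lam4.-integrable setT (EFin \o (u \_ Q)).
  rewrite -restrict_EFin; exact/(integrable_mkcond _ mQ).
pose B := box (side_lo j p) (side_hi j q).
have BI z : B z -> `]p, q[%classic (crd j z).
  move=> /boxP /(_ j (ltn_ord34 j)).
  by rewrite /side_lo /side_hi eqxx/= in_itv.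
have nuI : (mu `]p, q[%classic < +oo)%E by rewrite lebesgue_itvoo// ltry.
pose F := [set phi | exists2 i : nat -> rat * rat * nat,
     (forall k, (k < 4)%N -> rbump_in (side_lo j p k) (side_hi j q k) (i k)) &
     phi = tens (fun k => @rbump R (i k))].
have uF : unit_valued (F : set (Rspacetime (measurableTypeR R) -> R)).
  move=> _ [i hi' ->]; split.
    by apply: measurable_tens => k _; exact: measurable_bump.
  by move=> z; apply: tens_01 => k _ x; rewrite bump_ge0 bump_le1.
have dF : determining lam4 B F by exact: determining_box.
(* Applied to u and to -u, this bounds the absolute value of u. *)
have key (v : Rspacetime R -> R) : (v = u \_ Q \/ v = (fun z => - (u \_ Q) z)) ->
    {ae lam4, forall z, B z -> ((v z)%:E <= line_int mu (upd j) `]p, q[%classic h z)%E}.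
  move=> vE.
  have vi : lam4.-integrable setT (EFin \o v).
    by case: vE => ->; [exact: uQi|exact: integrableN uQi].
  apply: (le_line_int_of_tests (swappable_crd R j) (crd_upd_same j)
    (@upd_upd R j) (measurable_itv _) hge0 mh (measurable_box _ _) nuI BI hi vi uF dF).
  move=> _ [i hi' ->].
  have bound := weak_derivative_tested (erefl _) p12 pq q12 wd ui gi hi'.
  have a01 k x : 0 <= @rbump R (i k) x <= 1 by rewrite bump_ge0 bump_le1.
  set aa := fun k => @rbump R (i k) in bound *.
  have C01 z : 0 <= tens (repl aa j (cst 1)) z <= 1.
    by apply: tens_01 => k _ x; rewrite /repl; case: eqP => _ /=; rewrite ?ler01 ?lexx ?a01.
  have mC : measurable_fun setT (tens (repl aa j (cst 1)) : Rspacetime (measurableTypeR R) -> R).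
    by apply: measurable_tens => k _; rewrite /repl; case: eqP => // _; exact: measurable_bump.
  have mphi : measurable_fun setT (tens aa : Rspacetime (measurableTypeR R) -> R).
    by apply: measurable_tens => k _; exact: measurable_bump.
  have phi1 z : `|tens aa z| <= 1.
    by have /andP[h0' h1] := tens_01 z (fun k _ => a01 k); rewrite ger0_norm.
  exists (aa j), (tens (repl aa j (cst 1))); split => //.
  - exact: measurable_bump.
  - split; first by move=> s; have /andP[] := a01 j s.
    by move=> z; have /andP[] := C01 z.
  - by move=> z s; rewrite tens_upd// ltn_ord34.
  split.
  - by apply/funext => z; rewrite -tens_replE ?repl_id// ltn_ord34.
  - move=> z nBz; apply/eqP; apply: contra_notT nBz => nz; apply/boxP => k k4.
    have ak := tens_neq0 k4 nz.
    have [lo hi_] := hi' k k4.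
    have /andP[x1 x2] : ratr (i k).1.1 < crd k z < ratr (i k).1.2.
      by apply: contraNT ak => hx; apply/eqP; exact: bump_out.
    by rewrite (lt_trans lo x1) (lt_trans x2 hi_).
  have uphi : lam4.-integrable Q (EFin \o (fun z => u z * tens aa z)).
    by apply: integrableM_le1 => //; exact: measurable_funTS.
  have EL : (\int[lam4]_z ((u \_ Q) z * tens aa z)%:E =
      (\int[lam4]_(z in Q) (u z * tens aa z))%:E)%E.
    rewrite /Rintegral fineK; last exact: integrable_fin_num.
    rewrite [RHS]integral_mkcond; apply: eq_integral => z _; rewrite !patchE.
    by case: ifP => // _; rewrite mul0r.
  have L : (\int[lam4]_z (v z * tens aa z)%:E <=
      `|\int[lam4]_(z in Q) (u z * tens aa z)|%:E)%E.
    case: vE => ->; first by rewrite EL lee_fin ler_norm.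
    rewrite (_ : (fun z => _) = (fun z => - ((u \_ Q) z * tens aa z)%:E)%E).
      rewrite integralN; first by rewrite EL -EFinN lee_fin -normrN ler_norm.
      apply: integrable_add_def => //.
      exact: (integrableM_le1 measurableT uQi mphi phi1).
    by apply/funext => z; rewrite mulNr.
  apply: (le_trans L).
  apply: (@le_trans _ _ (\int[lam4]_(z in Q)
          (\int[mu]_s aa j s *
           (\1_(`]p, q[%classic : set R) (crd j z) * h0 z *
            tens (repl aa j (cst 1)) z)))%:E); first by rewrite lee_fin.
  have A0 : 0 <= \int[mu]_s aa j s.
    by apply: Rintegral_ge0 => s _; have /andP[] := a01 j s.
  have aE : (\int[mu]_s (aa j s)%:E = (\int[mu]_s aa j s)%:E)%E.
    by rewrite /Rintegral fineK//; apply: integrable_fin_num => //; exact: integrable_bump.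
  rewrite aE; move: (\int[mu]_s aa j s) A0 => A A0.
  apply: (@le_trans _ _ (\int[lam4]_(z in Q) (A *
     (\1_(`]p, q[%classic : set R) (crd j z) * h0 z * tens (repl aa j (cst 1)) z))%:E)%E).
    rewrite /Rintegral.
    have : (0 <= \int[lam4]_(z in Q) (A * (\1_(`]p, q[%classic : set R) (crd j z) * h0 z *
        tens (repl aa j (cst 1)) z))%:E)%E.
      apply: integral_ge0 => z _; rewrite lee_fin; apply: mulr_ge0 => //.
      apply: mulr_ge0; last by have /andP[] := C01 z.
      by apply: mulr_ge0 => //; apply: addr_ge0 => //; exact: mulr_ge0.
    by case: (\int[lam4]_(z in Q) _)%E => [r||] //= _; exact: leey.
  have mihc : measurable_fun setT ((fun z => (\1_(`]p, q[%classic : set R) (crd j z) * h z *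
      tens (repl aa j (cst 1)) z)%:E) : Rspacetime (measurableTypeR R) -> \bar R).
    apply/measurable_EFinP; apply: measurable_funM => //; apply: measurable_funM => //.
    by apply: measurableT_comp (measurable_crd j); exact: measurable_indic.
  rewrite integral_mkcond.
  have -> : (A%:E * \int[lam4]_z (\1_(`]p, q[%classic : set R) (crd j z) * h z *
      tens (repl aa j (cst 1)) z)%:E = \int[lam4]_z (A%:E *
      (\1_(`]p, q[%classic : set R) (crd j z) * h z * tens (repl aa j (cst 1)) z)%:E))%E.
    apply/esym; apply: ge0_integralZl => // z _; rewrite lee_fin.
    by apply: mulr_ge0; [exact: mulr_ge0|have /andP[] := C01 z].
  rewrite le_eqVlt; apply/orP; left; apply/eqP; apply: eq_integral => z _.
  rewrite patchE /h patchE -EFinM; case: ifP => // _.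
  by rewrite mulr0 mul0r mulr0.
have kp := key _ (or_introl erefl); have kn := key _ (or_intror erefl).
apply: (@filterS2 _ _ (ae_filter_ringOfSetsType lam4) _ _ _ _ kp kn) => z h1 h2 Bz.
have Qz := box_side_pcyl1 p12 q12 Bz.
have <- : line_int mu (upd j) `]p, q[%classic h z =
   (\int[mu]_(s in `]p, q[) (2 / (q - p) * `|u (upd j z s)| + `|g (upd j z s)|)%:E)%E.
  apply: eq_integral => s; rewrite inE/= in_itv/= => pqs; rewrite /h patchE mem_set//.
  exact: (box_side_pcyl1 p12 q12 (box_side_upd pqs Bz)).
have := h1 Bz; have := h2 Bz; rewrite patchE mem_set//.
by case: (ger0P (u z)).
Qed.

End line_bound.

(** * Loomis-Whitney inequality for cubes of functions *)

(** Cauchy-Schwarz, proved by integrating the arithmetic-geometric inequality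
    f <= L/(2y) f^2 + y/(2L). *)
Lemma sqr_le_integral_sqr d (T : measurableType d) (R : realType)
    (mu : {measure set T -> \bar R}) (I : set T) (f : T -> R) (L y : R) :
  measurable I -> mu I = L%:E -> 0 < L -> measurable_fun I f ->
  (forall x, 0 <= f x) -> 0 <= y ->
  (y%:E <= \int[mu]_(x in I) (f x)%:E)%E ->
  ((y ^+ 2)%:E <= L%:E * \int[mu]_(x in I) (f x ^+ 2)%:E)%E.
Proof.
move=> mI muI L0 mf f0 y0 le.
set X := (\int[mu]_(x in I) (f x ^+ 2)%:E)%E.
have X0 : (0 <= X)%E by apply: integral_ge0 => x _; rewrite lee_fin sqr_ge0.
have [->|yn0] := eqVneq y 0.
  by rewrite expr0n/= mule_ge0// lee_fin ltW.
have {}y0 : 0 < y by rewrite lt_neqAle eq_sym yn0.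
have t0 : 0 < y / L by rewrite divr_gt0.
have mf2 : measurable_fun I (fun x => (f x ^+ 2)%:E).
  by apply/measurable_EFinP; exact: measurable_funX.
have : (y%:E <= (L / y / 2)%:E * X + (y / 2)%:E)%E.
  apply: (le_trans le).
  have -> : ((L / y / 2)%:E * X + (y / 2)%:E =
      \int[mu]_(x in I) ((L / y / 2) * f x ^+ 2 + (y / L) / 2)%:E)%E.
    under eq_integral do rewrite EFinD EFinM.
    rewrite ge0_integralD//; last 3 first.
    - by move=> x _; rewrite -EFinM lee_fin mulr_ge0 ?sqr_ge0// !divr_ge0// ltW.
    - by apply: emeasurable_funM.
    - by move=> x _; rewrite lee_fin !divr_ge0// ltW.
    rewrite ge0_integralZl//; last 2 first.
    - by move=> x _; rewrite lee_fin sqr_ge0.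
    - by rewrite lee_fin !divr_ge0// ltW.
    congr (_ + _)%E; rewrite integral_cst// muI -EFinM; congr EFin.
    by field; rewrite gt_eqF.
  apply: ge0_le_integral => //.
  - by move=> x _; rewrite lee_fin.
  - exact/measurable_EFinP.
  - apply/measurable_EFinP; apply: measurable_funD => //.
    by apply: measurable_funM => //; exact: measurable_funX.
  move=> x _; rewrite lee_fin -subr_ge0.
  have -> : L / y / 2 * f x ^+ 2 + y / L / 2 - f x =
      (L / y / 2) * (f x - y / L) ^+ 2 by field; rewrite !gt_eqF.
  by rewrite mulr_ge0 ?sqr_ge0// !divr_ge0// ltW.
case: X X0 => [X||] //=; last by move=> _ _; rewrite mulry gtr0_sg// mul1e leey.
rewrite !lee_fin => X0 h.
have : y * y <= y * (L / y / 2 * X + y / 2) by rewrite ler_wpM2l// ltW.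
have -> : y * (L / y / 2 * X + y / 2) = L * X / 2 + y * y / 2 by field; rewrite gt_eqF.
by rewrite expr2; lra.
Qed.

Section loomis_whitney.
Context d1 d2 d3 (T1 : measurableType d1) (T2 : measurableType d2)
  (T3 : measurableType d3) (R : realType).
Variables (mu1 : {sigma_finite_measure set T1 -> \bar R})
  (mu2 : {sigma_finite_measure set T2 -> \bar R})
  (mu3 : {sigma_finite_measure set T3 -> \bar R}).

Lemma cube_le_sqr (x k t : R) : 0 <= x -> 0 < t ->
  x ^+ 3 <= t / 2 * x ^+ 4 + (2 * t)^-1 * x ^+ 2.
Proof.
move=> x0 t0; rewrite -subr_ge0.
have -> : t / 2 * x ^+ 4 + (2 * t)^-1 * x ^+ 2 - x ^+ 3 =
   t / 2 * (x * (x - t^-1)) ^+ 2 by field; rewrite gt_eqF.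
by rewrite mulr_ge0 ?sqr_ge0// divr_ge0// ltW.
Qed.

(** By Cauchy-Schwarz the integral of f^3 = f^2 * f is at most the square root of
    int f^4 * int f^2; the majorants bound these by int w1 * int w2 (since
    f^4 <= w1 w2 with separated variables) and by K^2.  The product of the roots of int w1
    and int w2 is then estimated by their half sum, so that the bound is linear in the
    majorants and can be integrated in a third variable. *)
Lemma plane_cube_bound (f : T1 * T2 -> R) (w1 : T2 -> \bar R) (w2 : T1 -> \bar R)
    (w3 : T1 * T2 -> \bar R) (K : R) :
  measurable_fun setT f -> (forall x, 0 <= f x) ->
  measurable_fun setT w1 -> (forall x, 0 <= w1 x)%E ->
  measurable_fun setT w2 -> (forall x, 0 <= w2 x)%E ->
  measurable_fun setT w3 -> (forall x, 0 <= w3 x)%E ->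
  {ae sprod mu1 mu2, forall x, [/\ ((f x ^+ 2)%:E <= w1 x.2)%E,
     ((f x ^+ 2)%:E <= w2 x.1)%E & ((f x ^+ 2)%:E <= w3 x)%E]} ->
  0 < K -> (\int[sprod mu1 mu2]_x w3 x <= (K ^+ 2)%:E)%E ->
  (\int[sprod mu1 mu2]_x (f x ^+ 3)%:E <=
    (K / 2)%:E * (\int[mu2]_y w1 y + \int[mu1]_x w2 x))%E.
Proof.
move=> mf f0 mw1 w10 mw2 w20 mw3 w30 ae K0 W3.
set A := (\int[mu2]_y w1 y)%E; set B := (\int[mu1]_x w2 x)%E.
have A0 : (0 <= A)%E by exact: integral_ge0.
have B0 : (0 <= B)%E by exact: integral_ge0.
have mw12 : measurable_fun setT (fun x : T1 * T2 => (w2 x.1 * w1 x.2)%E).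
  by apply: emeasurable_funM; exact: measurableT_comp.
have W12 : (\int[sprod mu1 mu2]_x (w2 x.1 * w1 x.2) = A * B)%E.
  transitivity (\int[mu1]_x \int[mu2]_y (w2 x * w1 y))%E.
    apply: (fubini_tonelli1 (fun x : T1 * T2 => w2 x.1 * w1 x.2)%E) => //.
    by move=> x; exact: mule_ge0.
  under eq_integral do rewrite ge0_integralZl//.
  by rewrite ge0_integralZr// muleC.
have key t : 0 < t -> (\int[sprod mu1 mu2]_x (f x ^+ 3)%:E <=
   (t / 2)%:E * (A * B) + ((2 * t)^-1 * K ^+ 2)%:E)%E.
  move=> t0.
  have h1 : 0 <= t / 2 by rewrite divr_ge0// ltW.
  have h2 : 0 <= (2 * t)^-1 by rewrite invr_ge0 mulr_ge0// ltW.
  apply: (@le_trans _ _ (\int[sprod mu1 mu2]_x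
     ((t / 2)%:E * (w2 x.1 * w1 x.2) + ((2 * t)^-1)%:E * w3 x))%E).
    apply: ae_ge0_le_integral => //.
    - by move=> x _; rewrite lee_fin exprn_ge0.
    - by apply/measurable_EFinP; exact: measurable_funX.
    - by move=> x _; rewrite adde_ge0// !mule_ge0// lee_fin.
    - by apply: emeasurable_funD; apply: emeasurable_funM.
    apply: filterS ae => x [b1 b2 b3] _.
    apply: (@le_trans _ _ ((t / 2 * f x ^+ 4 + (2 * t)^-1 * f x ^+ 2)%:E)).
      by rewrite lee_fin cube_le_sqr.
    rewrite EFinD; apply: leeD; rewrite EFinM; apply: lee_wpmul2l => //; rewrite ?lee_fin//.
    rewrite (_ : f x ^+ 4 = f x ^+ 2 * f x ^+ 2); last by rewrite -exprD.
    by rewrite EFinM; apply: lee_pmul => //; rewrite lee_fin sqr_ge0.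
  rewrite ge0_integralD//; last 4 first.
  - by move=> x _; rewrite !mule_ge0// lee_fin.
  - by apply: emeasurable_funM.
  - by move=> x _; rewrite mule_ge0// lee_fin.
  - by apply: emeasurable_funM.
  have -> : (\int[sprod mu1 mu2]_x ((t / 2)%:E * (w2 x.1 * w1 x.2)) =
      (t / 2)%:E * \int[sprod mu1 mu2]_x (w2 x.1 * w1 x.2))%E.
    by apply: ge0_integralZl => // x _; exact: mule_ge0.
  have -> : (\int[sprod mu1 mu2]_x (((2 * t)^-1)%:E * w3 x) =
      ((2 * t)^-1)%:E * \int[sprod mu1 mu2]_x w3 x)%E by exact: ge0_integralZl.
  rewrite W12 [X in (_ <= _ + X)%E]EFinM; apply: leeD => //.
  by apply: lee_wpmul2l => //; rewrite lee_fin.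

have [Aoo|] := eqVneq A +oo%E.
  by rewrite Aoo addye ?gt_eqF ?(lt_le_trans _ B0)// gt0_muley ?leey// lte_fin divr_gt0.
rewrite -ltey => Alt; have [Boo|] := eqVneq B +oo%E.
  by rewrite Boo addey ?gt_eqF ?(lt_le_trans _ A0)// gt0_muley ?leey// lte_fin divr_gt0.
rewrite -ltey => Blt.
move: key; rewrite -(@fineK _ A) ?ge0_fin_numE// -(@fineK _ B) ?ge0_fin_numE//.
have : 0 <= fine A by exact: fine_ge0.
have : 0 <= fine B by exact: fine_ge0.
move: (fine A) (fine B) => {W12 A0 B0 Alt Blt}a b b0 a0 key.
have [ab0|ab0] := ltP 0 (a + b).
  (* The value t = K (a b)^(-1/2) would be optimal; this one avoids the root. *)
  have t0 : 0 < 2 * K / (a + b) by rewrite divr_gt0// mulr_gt0.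
  apply: (le_trans (key _ t0)); rewrite -!EFinM -!EFinD lee_fin -subr_ge0.
  have -> : K / 2 * (a + b) - (2 * K / (a + b) / 2 * (a * b) +
      (2 * (2 * K / (a + b)))^-1 * K ^+ 2) = K / (4 * (a + b)) * (a - b) ^+ 2.
    by field; rewrite !gt_eqF.
  by rewrite mulr_ge0 ?sqr_ge0// divr_ge0// ltW// mulr_gt0.
rewrite -EFinD; have -> : a + b = 0 by apply/eqP; rewrite eq_le ab0 addr_ge0.
rewrite mule0; apply/lee_addgt0Pr => e e0; rewrite add0e.
have t0 : 0 < K ^+ 2 / (2 * e) by rewrite divr_gt0 ?mulr_gt0 ?exprn_gt0.
have a0' : a = 0 by apply/eqP; rewrite eq_le a0 andbT; lra.
have := key _ t0; rewrite a0' mul0e mule0 add0e; congr (_ <= _%:E)%E.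
by field; rewrite !gt_eqF.
Qed.

(** The plane bound on each slice x3 = z, where w3 does not depend on z. *)
Lemma loomis_whitney_cube (f : T1 * T2 * T3 -> R) (w1 : T2 * T3 -> \bar R)
    (w2 : T1 * T3 -> \bar R) (w3 : T1 * T2 -> \bar R) (K M : R) :
  measurable_fun setT f -> (forall x, 0 <= f x) ->
  measurable_fun setT w1 -> (forall x, 0 <= w1 x)%E ->
  measurable_fun setT w2 -> (forall x, 0 <= w2 x)%E ->
  measurable_fun setT w3 -> (forall x, 0 <= w3 x)%E ->
  {ae sprod (sprod mu1 mu2) mu3, forall x, [/\ ((f x ^+ 2)%:E <= w1 (x.1.2, x.2))%E,
     ((f x ^+ 2)%:E <= w2 (x.1.1, x.2))%E & ((f x ^+ 2)%:E <= w3 x.1)%E]} ->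
  0 < K -> (\int[sprod mu1 mu2]_x w3 x <= (K ^+ 2)%:E)%E ->
  (\int[sprod mu2 mu3]_x w1 x <= M%:E)%E ->
  (\int[sprod mu1 mu3]_x w2 x <= M%:E)%E ->
  (\int[sprod (sprod mu1 mu2) mu3]_x (f x ^+ 3)%:E <= (K * M)%:E)%E.
Proof.
move=> mf f0 mw1 w10 mw2 w20 mw3 w30 ae K0 W3 W1 W2.
have mf3 : measurable_fun setT (fun x => (f x ^+ 3)%:E).
  by apply/measurable_EFinP; exact: measurable_funX.
have f30 x : (0 <= (f x ^+ 3)%:E)%E by rewrite lee_fin exprn_ge0.
pose al z := (\int[mu2]_y w1 (y, z))%E.
pose be z := (\int[mu1]_x w2 (x, z))%E.
have mal : measurable_fun setT al by exact: measurable_fun_fubini_tonelli_G.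
have mbe : measurable_fun setT be by exact: measurable_fun_fubini_tonelli_G.
have al0 z : (0 <= al z)%E by exact: integral_ge0.
have be0 z : (0 <= be z)%E by exact: integral_ge0.
have Wal : (\int[mu3]_z al z <= M%:E)%E.
  by apply: le_trans W1; rewrite (fubini_tonelli2 w1 mw1).
have Wbe : (\int[mu3]_z be z <= M%:E)%E.
  by apply: le_trans W2; rewrite (fubini_tonelli2 w2 mw2).
have K20 : 0 <= K / 2 by rewrite divr_ge0// ltW.
rewrite [leLHS](fubini_tonelli2 (fun x => (f x ^+ 3)%:E))//.
apply: (@le_trans _ _ (\int[mu3]_z ((K / 2)%:E * (al z + be z)))%E).
  apply: ae_ge0_le_integral => //.
  - by move=> z _; exact: integral_ge0.
  - exact: measurable_fun_fubini_tonelli_G.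
  - by move=> z _; rewrite mule_ge0// adde_ge0.
  - by apply: emeasurable_funM => //; exact: emeasurable_funD.
  apply: filterS (ae_ysection ae) => z aez _.
  apply: (plane_cube_bound (f := fun x => f (x, z)) (w1 := fun y => w1 (y, z))
    (w2 := fun x => w2 (x, z)) (w3 := w3)) => //.
  - exact: (measurableT_comp mf (pair2_measurable z)).
  - exact: (measurableT_comp mw1 (pair2_measurable z)).
  - exact: (measurableT_comp mw2 (pair2_measurable z)).
have -> : (\int[mu3]_z ((K / 2)%:E * (al z + be z)) =
    (K / 2)%:E * \int[mu3]_z (al z + be z))%E.
  apply: ge0_integralZl => //; first exact: emeasurable_funD.
  by move=> z _; exact: adde_ge0.
rewrite ge0_integralD//.
apply: (@le_trans _ _ ((K / 2)%:E * (M%:E + M%:E))%E).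
  by apply: lee_wpmul2l => //; exact: leeD.
by rewrite -EFinD -EFinM lee_fin; lra.
Qed.

End loomis_whitney.

(** * Integrating along one of three coordinates *)

Section triple_fubini.
Context d1 d2 d3 (T1 : measurableType d1) (T2 : measurableType d2)
  (T3 : measurableType d3) (R : realType).
Variables (mu1 : {sigma_finite_measure set T1 -> \bar R})
  (mu2 : {sigma_finite_measure set T2 -> \bar R})
  (mu3 : {sigma_finite_measure set T3 -> \bar R}).
Notation mu := (sprod (sprod mu1 mu2) mu3).
Variable V : T1 * T2 * T3 -> \bar R.
Hypotheses (mV : measurable_fun setT V) (V0 : forall x, (0 <= V x)%E).

Let m1 : measurable_fun setT (fun x : (T2 * T3) * T1 => ((x.2, x.1.1), x.1.2)).
Proof.
apply: measurable_fun_pair; last by apply: measurableT_comp => //; exact: measurable_fst.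
by apply: measurable_fun_pair => //; apply: measurableT_comp.
Qed.

Let m2 : measurable_fun setT (fun x : (T1 * T3) * T2 => ((x.1.1, x.2), x.1.2)).
Proof.
apply: measurable_fun_pair; last by apply: measurableT_comp => //; exact: measurable_fst.
by apply: measurable_fun_pair => //; apply: measurableT_comp.
Qed.

Lemma measurable_line1 :
  measurable_fun setT (fun y : T2 * T3 => \int[mu1]_x V ((x, y.1), y.2))%E.
Proof.
exact: (measurable_fun_fubini_tonelli_F (fun x : (T2 * T3) * T1 => V ((x.2, x.1.1), x.1.2))
  (measurableT_comp mV m1) (fun x => V0 _)).
Qed.

Lemma measurable_line2 :
  measurable_fun setT (fun y : T1 * T3 => \int[mu2]_x V ((y.1, x), y.2))%E.
Proof.
exact: (measurable_fun_fubini_tonelli_F (fun x : (T1 * T3) * T2 => V ((x.1.1, x.2), x.1.2))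
  (measurableT_comp mV m2) (fun x => V0 _)).
Qed.

Lemma measurable_line3 :
  measurable_fun setT (fun y : T1 * T2 => \int[mu3]_x V (y, x))%E.
Proof. exact: (measurable_fun_fubini_tonelli_F V mV V0). Qed.

Lemma triple_fubini3 : (\int[sprod mu1 mu2]_y \int[mu3]_x V (y, x) = \int[mu]_x V x)%E.
Proof. by rewrite [RHS](fubini_tonelli1 V mV V0). Qed.

Lemma triple_fubini1 :
  (\int[sprod mu2 mu3]_y \int[mu1]_x V ((x, y.1), y.2) = \int[mu]_x V x)%E.
Proof.
rewrite [LHS](fubini_tonelli2 (fun y : T2 * T3 => \int[mu1]_x V ((x, y.1), y.2))%E
  measurable_line1)//; last by move=> y; exact: integral_ge0.
rewrite [RHS](fubini_tonelli2 V mV V0); apply: eq_integral => z _.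
rewrite /fubini_G/=.
apply/esym/(fubini_tonelli2 (fun y : T1 * T2 => V (y, z))) => //.
exact: (measurableT_comp mV (pair2_measurable z)).
Qed.

Lemma triple_fubini2 :
  (\int[sprod mu1 mu3]_y \int[mu2]_x V ((y.1, x), y.2) = \int[mu]_x V x)%E.
Proof.
rewrite [LHS](fubini_tonelli2 (fun y : T1 * T3 => \int[mu2]_x V ((y.1, x), y.2))%E
  measurable_line2)//; last by move=> y; exact: integral_ge0.
rewrite [RHS](fubini_tonelli2 V mV V0); apply: eq_integral => z _.
rewrite /fubini_G/=.
apply/esym/(fubini_tonelli1 (fun y : T1 * T2 => V (y, z))) => //.
exact: (measurableT_comp mV (pair2_measurable z)).
Qed.

End triple_fubini.

(** * Localized Gagliardo-Nirenberg inequality *)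

Section gagliardo_nirenberg.
Context d1 d2 d3 (T1 : measurableType d1) (T2 : measurableType d2)
  (T3 : measurableType d3) (R : realType).
Variables (mu1 : {sigma_finite_measure set T1 -> \bar R})
  (mu2 : {sigma_finite_measure set T2 -> \bar R})
  (mu3 : {sigma_finite_measure set T3 -> \bar R}).
Notation mu := (sprod (sprod mu1 mu2) mu3).
Variables (S1 s1 : set T1) (S2 s2 : set T2) (S3 s3 : set T3).
Hypotheses (mS1 : measurable S1) (mS2 : measurable S2) (mS3 : measurable S3)
  (ms1 : measurable s1) (ms2 : measurable s2) (ms3 : measurable s3)
  (sS1 : s1 `<=` S1) (sS2 : s2 `<=` S2) (sS3 : s3 `<=` S3).
Notation D := (S1 `*` S2 `*` S3).
Variables (f : T1 * T2 * T3 -> R) (G1 G2 G3 : T1 * T2 * T3 -> R).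
Notation U := (fun x => f x ^+ 2).
Hypotheses (mf : measurable_fun setT f) (f0 : forall x, 0 <= f x)
  (mG1 : measurable_fun setT G1) (G10 : forall x, 0 <= G1 x)
  (mG2 : measurable_fun setT G2) (G20 : forall x, 0 <= G2 x)
  (mG3 : measurable_fun setT G3) (G30 : forall x, 0 <= G3 x).
(* In the application S = ]-rho, rho[ and s = ]-r, r[ with r = rho e^2, so that e
   measures the smallness of the inner cube; Y^2 is the normalized Dirichlet
   integral, 1 + rho^2 b / a. *)
Variables (rho e a b Y : R).
Hypotheses (rho0 : 0 < rho) (e0 : 0 < e) (e1 : e <= 1) (a0 : 0 < a) (Y1 : 1 <= Y)
  (bY : b <= a / rho ^+ 2 * Y ^+ 2)
  (mu1s1 : mu1 s1 = (2 * rho * e ^+ 2)%:E).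
Notation line_bound x I := (forall l : R, 0 < l -> l <= rho ->
  ((f x ^+ 2)%:E <= I l)%E).
Hypotheses
  (H1 : {ae mu, forall x, D x -> line_bound x (fun l : R => \int[mu1]_(s in S1)
     (16 / l * f ((s, x.1.2), x.2) ^+ 2 + 2 * l * G1 ((s, x.1.2), x.2))%:E)%E})
  (H2 : {ae mu, forall x, D x -> line_bound x (fun l : R => \int[mu2]_(s in S2)
     (16 / l * f ((x.1.1, s), x.2) ^+ 2 + 2 * l * G2 ((x.1.1, s), x.2))%:E)%E})
  (H3 : {ae mu, forall x, D x -> line_bound x (fun l : R => \int[mu3]_(s in S3)
     (16 / l * f (x.1, s) ^+ 2 + 2 * l * G3 (x.1, s))%:E)%E})
  (Ua : (\int[mu]_(x in D) (f x ^+ 2)%:E <= a%:E)%E)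
  (G1b : (\int[mu]_(x in D) (G1 x)%:E <= b%:E)%E)
  (G2b : (\int[mu]_(x in D) (G2 x)%:E <= b%:E)%E)
  (G3b : (\int[mu]_(x in D) (G3 x)%:E <= b%:E)%E).

Let wt (l : R) (G : T1 * T2 * T3 -> R) x := 16 / l * f x ^+ 2 + 2 * l * G x.

Let wt_ge0 (l : R) (G : T1 * T2 * T3 -> R) : 0 < l -> (forall x, 0 <= G x) -> forall x, 0 <= wt l G x.
Proof.
move=> l0 G0 x; rewrite addr_ge0// mulr_ge0// ?sqr_ge0//.
  by rewrite divr_ge0// ltW.
by rewrite mulr_ge0// ltW.
Qed.

Let mwt (l : R) (G : T1 * T2 * T3 -> R) : measurable_fun setT G -> measurable_fun setT (wt l G).
Proof.
move=> mG; apply: measurable_funD; apply: measurable_funM => //.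
exact: measurable_funX.
Qed.

Let int_wt (l : R) (G : T1 * T2 * T3 -> R) (E : set (T1 * T2 * T3)) (A B : R) : measurable E -> 0 < l ->
  measurable_fun setT G -> (forall x, 0 <= G x) ->
  (\int[mu]_(x in E) (f x ^+ 2)%:E <= A%:E)%E -> (\int[mu]_(x in E) (G x)%:E <= B%:E)%E ->
  (\int[mu]_x ((wt l G \_ E) x)%:E <= (16 / l * A + 2 * l * B)%:E)%E.
Proof.
move=> mE l0 mG G0 UA GB.
have -> : (\int[mu]_x ((wt l G \_ E) x)%:E = \int[mu]_(x in E) (wt l G x)%:E)%E.
  by rewrite [RHS]integral_mkcond; apply: eq_integral => x _;
    rewrite !patchE; case: ifP.
have c1 : 0 <= 16 / l by rewrite divr_ge0// ltW.
have c2 : 0 <= 2 * l by rewrite mulr_ge0// ltW.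
rewrite /wt; under eq_integral do rewrite EFinD (EFinM (16 / l)) (EFinM (2 * l)).
have mfE : measurable_fun E (fun x => (f x ^+ 2)%:E).
  by apply: measurable_funTS; apply/measurable_EFinP; exact: measurable_funX.
have mGE : measurable_fun E (fun x => (G x)%:E).
  by apply: measurable_funTS; exact/measurable_EFinP.
rewrite ge0_integralD//; last 4 first.
- by move=> x _; rewrite -EFinM lee_fin mulr_ge0 ?sqr_ge0.
- exact: emeasurable_funM.
- by move=> x _; rewrite -EFinM lee_fin mulr_ge0.
- exact: emeasurable_funM.
rewrite EFinD; apply: leeD.
  have -> : (\int[mu]_(x in E) ((16 / l)%:E * (f x ^+ 2)%:E) =
      (16 / l)%:E * \int[mu]_(x in E) (f x ^+ 2)%:E)%E.
    by apply: ge0_integralZl => // x _; rewrite lee_fin sqr_ge0.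
  by rewrite [leRHS]EFinM; apply: lee_wpmul2l.
have -> : (\int[mu]_(x in E) ((2 * l)%:E * (G x)%:E) =
    (2 * l)%:E * \int[mu]_(x in E) (G x)%:E)%E.
  by apply: ge0_integralZl => // x _; rewrite lee_fin.
by rewrite [leRHS]EFinM; apply: lee_wpmul2l.
Qed.

(* l1 makes 16 a / l and 2 l b comparable, as b <= a Y^2 / rho^2.  l3 is shorter
   because the tube E3 carries only part of the mass a.  In M, 18 = 16 + 2. *)
Let l1 := rho / Y.
Let l3 := rho * e / Y.
Let M := 18 * (a / rho) * Y.
Let Y0 : 0 < Y. Proof. exact: lt_le_trans Y1. Qed.
Let l10 : 0 < l1. Proof. by rewrite divr_gt0. Qed.
Let l30 : 0 < l3. Proof. by rewrite divr_gt0// mulr_gt0. Qed.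
Let l1rho : l1 <= rho. Proof. by rewrite /l1 ler_pdivrMr// ler_peMr// ltW. Qed.
Let l3rho : l3 <= rho.
Proof.
have rho0' := ltW rho0; rewrite /l3 ler_pdivrMr// ler_wpM2l//.
exact: le_trans e1 Y1.
Qed.

Let mD : measurable D. Proof. by do 2?apply: measurableX. Qed.
Let E3 : set (T1 * T2 * T3) := s1 `*` s2 `*` S3.
Let mE3 : measurable E3. Proof. by do 2?apply: measurableX. Qed.
Let E3D : E3 `<=` D.
Proof. by move=> x [[x1 x2] x3]; split=> //; split; [exact: sS1|exact: sS2]. Qed.

Let V1 x := ((wt l1 G1 \_ D) x)%:E.
Let V2 x := ((wt l1 G2 \_ D) x)%:E.
Let V3 x := ((wt l3 G3 \_ E3) x)%:E.

Let mV (l : R) (G : T1 * T2 * T3 -> R) (E : set (T1 * T2 * T3)) : measurable E ->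
  measurable_fun setT G -> measurable_fun setT (fun x => ((wt l G \_ E) x)%:E).
Proof.
move=> mE mG; apply/measurable_EFinP; apply/(measurable_restrictT _ mE).
by apply: measurable_funTS; exact: mwt.
Qed.

Let V_ge0 (l : R) (G : T1 * T2 * T3 -> R) (E : set (T1 * T2 * T3)) : 0 < l ->
  (forall x, 0 <= G x) -> forall x, (0 <= ((wt l G \_ E) x)%:E)%E.
Proof.
move=> l0 G0 x; rewrite lee_fin patchE; case: ifP => // _; exact: wt_ge0.
Qed.

Let mV1 : measurable_fun setT V1. Proof. exact: mV. Qed.
Let mV2 : measurable_fun setT V2. Proof. exact: mV. Qed.
Let mV3 : measurable_fun setT V3. Proof. exact: mV. Qed.
Let V10 x : (0 <= V1 x)%E. Proof. exact: V_ge0. Qed.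
Let V20 x : (0 <= V2 x)%E. Proof. exact: V_ge0. Qed.
Let V30 x : (0 <= V3 x)%E. Proof. exact: V_ge0. Qed.

Let w1 (y : T2 * T3) : \bar R := (\int[mu1]_x V1 ((x, y.1), y.2))%E.
Let w2 (y : T1 * T3) : \bar R := (\int[mu2]_x V2 ((y.1, x), y.2))%E.
Let w3 (y : T1 * T2) : \bar R := (\int[mu3]_x V3 (y, x))%E.

Let w1_ge0 y : (0 <= w1 y)%E. Proof. exact: integral_ge0. Qed.
Let w2_ge0 y : (0 <= w2 y)%E. Proof. exact: integral_ge0. Qed.
Let w3_ge0 y : (0 <= w3 y)%E. Proof. exact: integral_ge0. Qed.

Let le_M : 16 / l1 * a + 2 * l1 * b <= M.
Proof.
have : 2 * l1 * b <= 2 * l1 * (a / rho ^+ 2 * Y ^+ 2).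
  by rewrite ler_wpM2l// mulr_ge0// ltW.
have -> : 2 * l1 * (a / rho ^+ 2 * Y ^+ 2) = 2 * (a / rho) * Y.
  by rewrite /l1; field; rewrite !gt_eqF.
have -> : 16 / l1 * a = 16 * (a / rho) * Y.
  by rewrite /l1; field; rewrite !gt_eqF.
rewrite /M; lra.
Qed.

Let int_w1 : (\int[sprod mu2 mu3]_y w1 y <= M%:E)%E.
Proof.
rewrite (triple_fubini1 mu1 mu2 mu3 mV1 V10).
by apply: (le_trans (int_wt mD l10 mG1 G10 Ua G1b)); rewrite lee_fin.
Qed.

Let int_w2 : (\int[sprod mu1 mu3]_y w2 y <= M%:E)%E.
Proof.
rewrite (triple_fubini2 mu1 mu2 mu3 mV2 V20).
by apply: (le_trans (int_wt mD l10 mG2 G20 Ua G2b)); rewrite lee_fin.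
Qed.

Let f_le_w1 : {ae mu, forall x, D x -> ((f x ^+ 2)%:E <= w1 (x.1.2, x.2))%E}.
Proof.
apply: filterS H1 => x hx Dx; apply: (le_trans (hx Dx l1 l10 l1rho)).
rewrite le_eqVlt; apply/orP; left; apply/eqP.
rewrite integral_mkcond; apply: eq_integral => s _; rewrite /V1 !patchE /=.
by case: Dx => -[/= D1 D2] D3; rewrite !in_setX/= (mem_set D2) (mem_set D3) !andbT;
  case: ifP.
Qed.

Let f_le_w2 : {ae mu, forall x, D x -> ((f x ^+ 2)%:E <= w2 (x.1.1, x.2))%E}.
Proof.
apply: filterS H2 => x hx Dx; apply: (le_trans (hx Dx l1 l10 l1rho)).
rewrite le_eqVlt; apply/orP; left; apply/eqP.
rewrite integral_mkcond; apply: eq_integral => s _; rewrite /V2 !patchE /=.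
by case: Dx => -[/= D1 D2] D3; rewrite !in_setX/= (mem_set D1) (mem_set D3) !andbT;
  case: ifP.
Qed.

Let f_le_w3 : {ae mu, forall x, E3 x -> ((f x ^+ 2)%:E <= w3 x.1)%E}.
Proof.
apply: filterS H3 => x hx Ex; apply: (le_trans (hx (E3D Ex) l3 l30 l3rho)).
rewrite le_eqVlt; apply/orP; left; apply/eqP.
rewrite integral_mkcond; apply: eq_integral => s _; rewrite /V3 !patchE /=.
by case: Ex => -[/= D1 D2] D3; rewrite /E3 !in_setX/= (mem_set D1) (mem_set D2)/=;
  case: ifP.
Qed.

(* The first majorant is constant in x1, so integrating it over the thin side s1
   gains the factor mu1 s1 = 2 rho e^2. *)
Let int_tube : (\int[mu]_(x in E3) (f x ^+ 2)%:E <= (2 * rho * e ^+ 2 * M)%:E)%E.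
Proof.
have mw1 : measurable_fun setT w1 by exact: measurable_line1.
pose V (x : T1 * T2 * T3) := ((\1_s1 x.1.1)%:E * w1 (x.1.2, x.2))%E.
have mi : measurable_fun setT (\1_s1 : T1 -> R) by exact: measurable_indic.
have mV' : measurable_fun setT V.
  apply: emeasurable_funM.
    by apply/measurable_EFinP; apply: (measurableT_comp mi); exact: measurableT_comp.
  apply: (measurableT_comp mw1); apply: measurable_fun_pair => //.
  exact: measurableT_comp.
have V0' x : (0 <= V x)%E by rewrite /V mule_ge0// lee_fin.
apply: (@le_trans _ _ (\int[mu]_(x in E3) V x)%E).
  apply: ae_ge0_le_integral => //.
  - by move=> x _; rewrite lee_fin sqr_ge0.
  - by apply: measurable_funTS; apply/measurable_EFinP; exact: measurable_funX.
  - exact: measurable_funTS.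
  apply: filterS f_le_w1 => x hx Ex; apply: (le_trans (hx (E3D Ex))).
  by rewrite /V indicE mem_set ?mul1e//; case: Ex => -[].
apply: (@le_trans _ _ (\int[mu]_x V x)%E); first exact: ge0_subset_integral.
rewrite -(triple_fubini1 mu1 mu2 mu3 mV' V0') /V/=.
have -> : (\int[sprod mu2 mu3]_y \int[mu1]_x ((\1_s1 x)%:E * w1 (y.1, y.2)) =
    \int[sprod mu2 mu3]_y ((2 * rho * e ^+ 2)%:E * w1 y))%E.
  apply: eq_integral => -[y z] _ /=; rewrite ge0_integralZr//; last first.
    by apply/measurable_EFinP; exact: measurable_indic.
  congr (_ * _)%E; rewrite -mu1s1 -[in RHS](setIT s1); exact: integral_indic.
have c0 : 0 <= 2 * rho * e ^+ 2 by rewrite mulr_ge0 ?sqr_ge0// mulr_ge0// ltW.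
have -> : (\int[sprod mu2 mu3]_y ((2 * rho * e ^+ 2)%:E * w1 y) =
   (2 * rho * e ^+ 2)%:E * \int[sprod mu2 mu3]_y w1 y)%E by exact: ge0_integralZl.
by rewrite [leRHS]EFinM; apply: lee_wpmul2l.
Qed.

(* 576 = 16 * 2 * 18 comes from the mass in the tube, and 578 = 576 + 2. *)
Let int_w3 : (\int[sprod mu1 mu2]_y w3 y <= (578 * (a / rho) * e * Y ^+ 2)%:E)%E.
Proof.
rewrite (triple_fubini3 mu1 mu2 mu3 mV3 V30).
have G3b' : (\int[mu]_(x in E3) (G3 x)%:E <= b%:E)%E.
  apply: le_trans G3b; apply: ge0_subset_integral => //.
    by apply: measurable_funTS; exact/measurable_EFinP.
  by move=> x _; rewrite lee_fin.
apply: (le_trans (int_wt mE3 l30 mG3 G30 int_tube G3b')); rewrite lee_fin.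
have : 2 * l3 * b <= 2 * l3 * (a / rho ^+ 2 * Y ^+ 2).
  by rewrite ler_wpM2l// mulr_ge0// ltW.
have -> : 2 * l3 * (a / rho ^+ 2 * Y ^+ 2) = 2 * (a / rho * e * Y).
  by rewrite /l3; field; rewrite !gt_eqF.
have -> : 16 / l3 * (2 * rho * e ^+ 2 * M) = 576 * (a / rho * e * Y ^+ 2).
  by rewrite /l3 /M; field; rewrite !gt_eqF.
have : a / rho * e * Y <= a / rho * e * Y ^+ 2.
  rewrite ler_wpM2l ?expr2 ?ler_peMr// ?ltW//.
  by rewrite mulr_gt0// divr_gt0.
lra.
Qed.

(** The square root of e comes from the third majorant and is the gain over the
    unlocalized inequality; with r = rho e^2 it is (r / rho)^(1/4). *)
Lemma cube_integral_bound :
  (\int[mu]_(x in s1 `*` s2 `*` s3) (f x ^+ 3)%:E <=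
   (Num.sqrt (578 * (a / rho) * e) * (18 * (a / rho)) * Y ^+ 2)%:E)%E.
Proof.
have c0 : (0 : R) < 578 by lra.
have k0 : 0 < 578 * (a / rho) * e := mulr_gt0 (mulr_gt0 c0 (divr_gt0 a0 rho0)) e0.
set k := Num.sqrt _; have K0 : 0 < k * Y by rewrite mulr_gt0// sqrtr_gt0.
have sub : s1 `*` s2 `*` s3 `<=` E3 by move=> x [x12 x3]; split => //; exact: sS3.
have ms : measurable (s1 `*` s2 `*` s3) by do 2?apply: measurableX.
pose g := f \_ (s1 `*` s2 `*` s3).
have mg : measurable_fun setT g by apply/(measurable_restrictT _ ms); exact: measurable_funTS.
have g0 x : 0 <= g x by rewrite /g patchE; case: ifP.
have -> : (\int[mu]_(x in s1 `*` s2 `*` s3) (f x ^+ 3)%:E = \int[mu]_x (g x ^+ 3)%:E)%E.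
  rewrite integral_mkcond; apply: eq_integral => x _; rewrite /g !patchE.
  by case: ifP => // _; rewrite expr0n.
have -> : k * (18 * (a / rho)) * Y ^+ 2 = (k * Y) * M by rewrite /M; ring.
apply: (loomis_whitney_cube (w1 := w1) (w2 := w2) (w3 := w3)) => //.
- exact: measurable_line1.
- exact: measurable_line2.
- exact: measurable_line3.
- apply: filterS3 f_le_w1 f_le_w2 f_le_w3 => x h1 h2 h3.
  rewrite /g patchE; case: ifPn => [/set_mem sx|_]; last by rewrite expr0n/=.
  by have Ex := sub _ sx; have Dx := E3D Ex; split; [exact: h1|exact: h2|exact: h3].
- by rewrite exprMn (sqr_sqrtr (ltW k0)); exact: int_w3.
Qed.

End gagliardo_nirenberg.

(** * Line bounds for squares at every length scale *)

Section line_squares.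
Variable R : realType.
Notation mu := (@lebesgue_measure R).
Notation lam4 := (@lam4 R).
Notation Q := (@pcyl R 1).
Implicit Types (z : Rspacetime R) (u g : Rspacetime R -> R).

Lemma measurable_upd (j : 'I_3) z :
  measurable_fun setT (upd j z : measurableTypeR R -> Rspacetime (measurableTypeR R)).
Proof.
have [_ mupd _] := swappable_crd R j.
exact: (measurableT_comp mupd (pair1_measurable z)).
Qed.

Lemma line_sqr_bound (j : 'I_3) (p q : R) u g :
  - (1 / 2) <= p -> p < q -> q <= 1 / 2 ->
  weak_derivative Q (dirx R j) u g ->
  lam4.-integrable Q (EFin \o u) -> lam4.-integrable Q (EFin \o g) ->
  {ae lam4, forall z, box (side_lo j p) (side_hi j q) z ->
    ((u z ^+ 2)%:E <= \int[mu]_(s in `]p, q[)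
       (8 / (q - p) * (u \_ Q) (upd j z s) ^+ 2 +
        2 * (q - p) * (g \_ Q) (upd j z s) ^+ 2)%:E)%E}.
Proof.
move=> p12 pq q12 wd ui gi.
have mQ := @measurable_pcyl R 1.
have L0 : 0 < q - p by rewrite subr_gt0.
have mres (w : Rspacetime R -> R) : lam4.-integrable Q (EFin \o w) ->
    measurable_fun setT (w \_ Q).
  move=> /integrableP[/measurable_EFinP mw _].
  exact/(measurable_restrictT _ mQ).
have mu' := mres u ui; have mg' := mres g gi.
have := weak_derivative_line_bound p12 pq q12 wd ui gi.
apply: (@filterS _ _ (ae_filter_ringOfSetsType lam4)) => z hz Bz.
pose f s := 2 / (q - p) * `|(u \_ Q) (upd j z s)| + `|(g \_ Q) (upd j z s)|.
have f0 s : 0 <= f s by rewrite addr_ge0// mulr_ge0// divr_ge0// ltW.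
have mupd := measurable_upd j z.
have mabs (w : Rspacetime R -> R) : measurable_fun setT (w \_ Q) ->
   measurable_fun setT (fun s => (w \_ Q) (upd j z s)).
  by move=> mw; exact: (measurableT_comp mw mupd).
have mf : measurable_fun setT f.
  apply: measurable_funD; last by apply: measurableT_comp => //; exact: mabs.
  by apply: measurable_funM => //; apply: measurableT_comp => //; exact: mabs.
have le : (`|u z|%:E <= \int[mu]_(s in `]p, q[) (f s)%:E)%E.
  apply: (le_trans (hz Bz)); rewrite le_eqVlt; apply/orP; left; apply/eqP.
  apply: eq_integral => s; rewrite inE/= in_itv/= => pqs; rewrite /f !patchE.
  by rewrite mem_set//; exact: (box_side_pcyl1 p12 q12 (box_side_upd pqs Bz)).
have mI : measurable (`]p, q[%classic : set (measurableTypeR R)) by exact: measurable_itv.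
have := sqr_le_integral_sqr mI (lebesgue_itvoo pq) L0
  (measurable_funTS mf) f0 (normr_ge0 (u z)) le.
rewrite real_normK ?num_real// => /le_trans; apply.
rewrite -ge0_integralZl//; last 3 first.
- apply: measurable_funTS; apply/measurable_EFinP; exact: measurable_funX.
- by move=> s _; rewrite lee_fin sqr_ge0.
- by rewrite lee_fin ltW.
apply: ge0_le_integral => //.
- by move=> s _; rewrite -EFinM lee_fin mulr_ge0 ?sqr_ge0// ltW.
- apply: measurable_funTS; apply: emeasurable_funM => //.
  by apply/measurable_EFinP; exact: measurable_funX.
- apply: measurable_funTS; apply/measurable_EFinP; apply: measurable_funD;
   apply: measurable_funM => //; apply: measurable_funX; exact: mabs.
move=> s _; rewrite -EFinM lee_fin /f.
move: ((u \_ Q) _) ((g \_ Q) _) => x y.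
rewrite -(real_normK (num_real x)) -(real_normK (num_real y)).
move: (`|x|) (`|y|) => {}x {}y; rewrite -subr_ge0.
have -> : 8 / (q - p) * x ^+ 2 + 2 * (q - p) * y ^+ 2 -
    (q - p) * (2 / (q - p) * x + y) ^+ 2 =
    (q - p) * (2 / (q - p) * x - y) ^+ 2 by field; rewrite gt_eqF.
by rewrite mulr_ge0 ?sqr_ge0// ltW.
Qed.

(** Windows with rational endpoints suffice, which leaves countably many
    exceptional null sets.  The window is placed on the side of x that faces 0 so
    that it stays inside ]-rho, rho[. *)
Lemma rational_window (x l rho : R) : - rho < x < rho -> 0 < l -> l <= rho ->
  exists p q : rat, [/\ - rho <= ratr p, ratr p < x < ratr q, ratr q <= rho,
    l / 2 <= ratr q - ratr p & ratr q - ratr p <= l].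
Proof.
move=> /andP[rx xr] l0 lr.
have [x0|x0] := leP x 0.
- have hp : Num.max (- rho) (x - l / 4) < x by rewrite gt_max rx; lra.
  have hq : x + l / 2 < x + 3 * l / 4 by lra.
  have [p] := rat_in_itvoo hp; have [q] := rat_in_itvoo hq.
  rewrite !in_itv/= gt_max => /andP[q1 q2] /andP[/andP[p0 p1] p2].
  by exists p, q; split; [exact: ltW|apply/andP; split; lra|lra|lra|lra].
- have hq : x < Num.min rho (x + l / 4) by rewrite lt_min xr; lra.
  have hp : x - 3 * l / 4 < x - l / 2 by lra.
  have [p] := rat_in_itvoo hp; have [q] := rat_in_itvoo hq.
  rewrite !in_itv/= lt_min => /andP[q1 /andP[q2 q3]] /andP[p1 p2].
  by exists p, q; split; [lra|apply/andP; split; lra|exact: ltW|lra|lra].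
Qed.

(** For every l the window around the coordinate of z may be chosen of length
    between l/2 and l, inside ]-rho, rho[. *)
Lemma line_sqr_scales (j : 'I_3) (rho : R) u g : 0 < rho -> rho <= 1 / 2 ->
  weak_derivative Q (dirx R j) u g ->
  lam4.-integrable Q (EFin \o u) -> lam4.-integrable Q (EFin \o g) ->
  {ae lam4, forall z, (forall k, (k < 3)%N -> - rho < crd k z < rho) ->
    -1 < crd 3 z < 0 -> forall l : R, 0 < l -> l <= rho ->
    ((u z ^+ 2)%:E <= \int[mu]_(s in `](- rho)%R, rho[)
       (16 / l * (u \_ Q) (upd j z s) ^+ 2 + 2 * l * (g \_ Q) (upd j z s) ^+ 2)%:E)%E}.
Proof.
move=> rho0 rho12 wd ui gi.
have mQ := @measurable_pcyl R 1.
have mres (w : Rspacetime R -> R) : lam4.-integrable Q (EFin \o w) ->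
    measurable_fun setT (w \_ Q).
  move=> /integrableP[/measurable_EFinP mw _].
  exact/(measurable_restrictT _ mQ).
have mu' := mres u ui; have mg' := mres g gi.
have : {ae lam4, forall z, forall i : rat * rat, let p := ratr i.1 in let q := ratr i.2 in
    - (1 / 2) <= p -> p < q -> q <= 1 / 2 ->
    box (side_lo j p) (side_hi j q) z ->
    ((u z ^+ 2)%:E <= \int[mu]_(s in `]p, q[)
       (8 / (q - p) * (u \_ Q) (upd j z s) ^+ 2 +
        2 * (q - p) * (g \_ Q) (upd j z s) ^+ 2)%:E)%E}.
  apply: ae_forall_count => -[p q] /=.
  have [p12|np] := pselect (- (1 / 2) <= ratr p :> R); last by apply: aeW => z /np.
  have [pq|npq] := pselect (ratr p < ratr q :> R); last by apply: aeW => z _ /npq.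
  have [q12|nq] := pselect (ratr q <= 1 / 2 :> R); last by apply: aeW => z _ _ /nq.
  apply: (@filterS _ _ (ae_filter_ringOfSetsType lam4) _ _ _ (line_sqr_bound p12 pq q12 wd ui gi)).
  by move=> z hz _ _ _; exact: hz.
apply: (@filterS _ _ (ae_filter_ringOfSetsType lam4)) => z hz zrho zt l l0 lrho.
have [p [q [rp /andP[px xq] qr lo hi]]] := rational_window (zrho j (ltn_ord j)) l0 lrho.
have pq : ratr p < ratr q :> R by exact: lt_trans px xq.
have p12 : - (1 / 2) <= ratr p :> R by lra.
have q12 : ratr q <= 1 / 2 :> R by lra.
have Bz : box (side_lo j (ratr p)) (side_hi j (ratr q)) z.
  apply/boxP => k k4; rewrite /side_lo /side_hi.
  case: eqP => [->|_]; first by rewrite px xq.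
  case: ltnP => k3; first by have /andP[h1 h2] := zrho k k3; apply/andP; split; lra.
  by have -> : k = 3%N by apply/eqP; rewrite eqn_leq k3 andbT -ltnS.
apply: (le_trans (hz (p, q) p12 pq q12 Bz)) => /=.
have mupd := measurable_upd j z.
have mabs (w : Rspacetime R -> R) : measurable_fun setT (w \_ Q) ->
   measurable_fun setT (fun s => (w \_ Q) (upd j z s) ^+ 2).
  by move=> mw; apply: measurable_funX; exact: (measurableT_comp mw mupd).
have mF (c1 c2 : R) (I : set (measurableTypeR R)) : measurable_fun I
    (fun s => (c1 * (u \_ Q) (upd j z s) ^+ 2 + c2 * (g \_ Q) (upd j z s) ^+ 2)%:E).
  apply: measurable_funTS; apply/measurable_EFinP; apply: measurable_funD;
   apply: measurable_funM => //; exact: mabs.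
have mI (a b : R) : measurable (`]a, b[%classic : set (measurableTypeR R)).
  exact: measurable_itv.
have L0 : 0 < ratr q - ratr p :> R by rewrite subr_gt0.
apply: (@le_trans _ _ (\int[mu]_(s in `]ratr p, ratr q[)
       (16 / l * (u \_ Q) (upd j z s) ^+ 2 + 2 * l * (g \_ Q) (upd j z s) ^+ 2)%:E)%E).
  apply: ge0_le_integral => //.
  - by move=> s _; rewrite lee_fin addr_ge0// mulr_ge0 ?sqr_ge0// ?divr_ge0 ?mulr_ge0// ltW.
  move=> s _; rewrite lee_fin lerD// ler_wpM2r ?sqr_ge0//; last by lra.
  rewrite ler_pdivrMr// mulrAC ler_pdivlMr//; lra.
apply: ge0_subset_integral => //.
- by move=> s _; rewrite lee_fin addr_ge0// mulr_ge0 ?sqr_ge0// ?divr_ge0 ?mulr_ge0// ltW.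
- by move=> s /=; rewrite !in_itv/= => /andP[s1 s2]; apply/andP; split; lra.
Qed.

End line_squares.

(** * The cubic bound on parabolic cylinders *)

Section setX_fubini.
Context d1 d2 (T1 : measurableType d1) (T2 : measurableType d2) (R : realType).
Variables (mu1 : {sigma_finite_measure set T1 -> \bar R})
  (mu2 : {sigma_finite_measure set T2 -> \bar R}).

Lemma integral_setX (A : set T1) (B : set T2) (F : T1 * T2 -> \bar R) :
  measurable A -> measurable B -> measurable_fun setT F -> (forall z, 0 <= F z)%E ->
  (\int[sprod mu1 mu2]_(z in A `*` B) F z =
   \int[mu2]_(y in B) \int[mu1]_(x in A) F (x, y))%E.
Proof.
move=> mA mB mF F0.
have mAB : measurable (A `*` B) by exact: measurableX.
have mF' : measurable_fun setT (F \_ (A `*` B)).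
  by apply/(measurable_restrictT _ mAB); exact: measurable_funTS.
rewrite integral_mkcond [LHS](fubini_tonelli2 _ mF'); last first.
  by move=> z; rewrite patchE; case: ifP.
rewrite [RHS]integral_mkcond; apply: eq_integral => y _.
rewrite /fubini_G patchE; case: ifPn => yB.
  rewrite [RHS]integral_mkcond; apply: eq_integral => x _.
  by rewrite !patchE in_setX/= yB andbT.
rewrite integral0_eq// => x _; rewrite patchE in_setX/= (negbTE yB) andbF//.
Qed.

Lemma measurable_slice_integral (A : set T1) (F : T1 * T2 -> \bar R) :
  measurable A -> measurable_fun setT F -> (forall z, 0 <= F z)%E ->
  measurable_fun setT (fun y => \int[mu1]_(x in A) F (x, y))%E.
Proof.
move=> mA mF F0.
have mAT : measurable (A `*` [set: T2]) by exact: measurableX.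
have mF' : measurable_fun setT (F \_ (A `*` setT)).
  by apply/(measurable_restrictT _ mAT); exact: measurable_funTS.
have F0' z : (0 <= (F \_ (A `*` setT)) z)%E by rewrite patchE; case: ifP.
have := measurable_fun_fubini_tonelli_G (m1 := mu1) _ mF' F0'.
congr measurable_fun; apply/funext => y; rewrite [RHS]integral_mkcond.
by apply: eq_integral => x _; rewrite !patchE in_setX/= in_setT andbT.
Qed.

End setX_fubini.

Section vector_line.
Variable R : realType.
Notation mu := (@lebesgue_measure R).
Notation lam3 := (@lam3 R).
Notation lam4 := (@lam4 R).
Notation Q := (@pcyl R 1).
Variables (v : 'I_3 -> Rspacetime R -> R) (Dv : 'I_3 -> 'I_3 -> Rspacetime R -> R).
Hypotheses (wg : weak_gradient v Dv)
  (vi : forall i, lam4.-integrable Q (EFin \o v i))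
  (Dvi : forall i j, lam4.-integrable Q (EFin \o Dv i j)).

(** Extension by zero makes all the functions below globally measurable. *)
Definition speedQ : Rspacetime R -> R := vabs v \_ Q.
Definition partial_sqrQ (j : 'I_3) (z : Rspacetime R) : R :=
  \sum_(i < 3) (Dv i j \_ Q) z ^+ 2.

Lemma sqr_enorm (I : finType) (a : I -> R) : enorm a ^+ 2 = \sum_i a i ^+ 2.
Proof. by rewrite sqr_sqrtr// sumr_ge0// => i _; exact: sqr_ge0. Qed.

Lemma sqr_speedQ z : speedQ z ^+ 2 = \sum_(i < 3) (v i \_ Q) z ^+ 2.
Proof.
rewrite /speedQ patchE; case: ifPn => zQ.
  by rewrite /vabs sqr_enorm; apply: eq_bigr => i _; rewrite patchE zQ.
rewrite expr0n/= big1// => i _; by rewrite patchE (negbTE zQ) expr0n.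
Qed.

Let mQ := @measurable_pcyl R 1.

Lemma measurable_restrict_int (w : Rspacetime R -> R) :
  lam4.-integrable Q (EFin \o w) -> measurable_fun setT (w \_ Q).
Proof.
move=> /integrableP[/measurable_EFinP mw _].
exact/(measurable_restrictT _ mQ).
Qed.

Lemma measurable_speedQ : measurable_fun setT speedQ.
Proof.
have -> : speedQ = (fun z => Num.sqrt (\sum_(i < 3) (v i \_ Q) z ^+ 2)).
  apply/funext => z; rewrite -sqr_speedQ sqrtr_sqr ger0_norm// /speedQ patchE.
  by case: ifP => // _; exact: sqrtr_ge0.
apply: (measurableT_comp (f := @Num.sqrt R)).
  by apply: continuous_measurable_fun; exact: sqrt_continuous.
apply: measurable_sum => i; apply: measurable_funX; exact: measurable_restrict_int.
Qed.

Lemma measurable_partial_sqrQ j : measurable_fun setT (partial_sqrQ j).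
Proof.
apply: measurable_sum => i; apply: measurable_funX; exact: measurable_restrict_int.
Qed.

Lemma speedQ_ge0 z : 0 <= speedQ z.
Proof. by rewrite /speedQ patchE; case: ifP => // _; exact: sqrtr_ge0. Qed.

Lemma partial_sqrQ_ge0 j z : 0 <= partial_sqrQ j z.
Proof. by apply: sumr_ge0 => i _; exact: sqr_ge0. Qed.

Lemma vector_line_scales (j : 'I_3) (rho : R) : 0 < rho -> rho <= 1 / 2 ->
  {ae lam4, forall z, (forall k, (k < 3)%N -> - rho < crd k z < rho) ->
    -1 < crd 3 z < 0 -> forall l : R, 0 < l -> l <= rho ->
    ((speedQ z ^+ 2)%:E <= \int[mu]_(s in `](- rho)%R, rho[)
       (16 / l * speedQ (upd j z s) ^+ 2 + 2 * l * partial_sqrQ j (upd j z s))%:E)%E}.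
Proof.
move=> rho0 rho12.
have : {ae lam4, forall z, forall i : 'I_3,
    (forall k, (k < 3)%N -> - rho < crd k z < rho) ->
    -1 < crd 3 z < 0 -> forall l : R, 0 < l -> l <= rho ->
    ((v i z ^+ 2)%:E <= \int[mu]_(s in `](- rho)%R, rho[)
       (16 / l * (v i \_ Q) (upd j z s) ^+ 2 + 2 * l * (Dv i j \_ Q) (upd j z s) ^+ 2)%:E)%E}.
  apply: ae_forall_count => i; exact: line_sqr_scales.
apply: (@filterS _ _ (ae_filter_ringOfSetsType lam4)) => z hz zrho zt l l0 lrho.
have mupd := measurable_upd j z.
have mabs (w : Rspacetime R -> R) : measurable_fun setT w ->
   measurable_fun setT (fun s => w (upd j z s)).
  by move=> mw; exact: (measurableT_comp mw mupd).
have -> : (\int[mu]_(s in `](- rho)%R, rho[)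
       (16 / l * speedQ (upd j z s) ^+ 2 + 2 * l * partial_sqrQ j (upd j z s))%:E =
    \sum_(i < 3) \int[mu]_(s in `](- rho)%R, rho[) (16 / l * (v i \_ Q) (upd j z s) ^+ 2 +
       2 * l * (Dv i j \_ Q) (upd j z s) ^+ 2)%:E)%E.
  rewrite -ge0_integral_sum//; last 2 first.
  - move=> i; apply: measurable_funTS; apply/measurable_EFinP.
    by apply: measurable_funD; apply: measurable_funM => //; apply: measurable_funX;
      apply: mabs; exact: measurable_restrict_int.
  - move=> i s _; rewrite lee_fin addr_ge0// mulr_ge0 ?sqr_ge0//.
      by rewrite divr_ge0// ltW.
    by rewrite mulr_ge0// ltW.
  apply: eq_integral => s _; rewrite sumEFin; congr EFin.
  by rewrite sqr_speedQ /partial_sqrQ !mulr_sumr -big_split.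
rewrite sqr_speedQ -sumEFin; apply: lee_sum => i _.
apply: le_trans (hz i zrho zt l l0 lrho); rewrite lee_fin patchE.
by case: ifP => // _; rewrite expr0n sqr_ge0.
Qed.

Definition gn_const (a rho e : R) : R :=
  Num.sqrt (578 * (a / rho) * e) * (18 * (a / rho)).

Lemma mu_itv_sym (r : R) : 0 < r -> mu `](- r), r[%classic = (2 * r)%:E.
Proof. by move=> r0; rewrite lebesgue_itvoo; [congr EFin; lra|lra]. Qed.

Lemma cyl_sub_cube (r : R) : @cyl R r `<=` `](- r), r[ `*` `](- r), r[ `*` `](- r), r[.
Proof.
move=> [[x1 x2] x3] [/= h h3].
have r0 : 0 < r by apply: le_lt_trans h; exact: sqrtr_ge0.
have key (x y : R) : Num.sqrt (x ^+ 2 + y ^+ 2) < r -> `|x| < r.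
  move=> hx; apply: le_lt_trans hx; rewrite -sqrtr_sqr ler_wsqrtr// lerDl sqr_ge0//.
split; [split|]; rewrite /= in_itv/= -ltr_norml//.
- exact: key h.
- by apply: (key x2 x1); rewrite addrC.
Qed.

Lemma cube_sub_cyl (rho : R) : 0 < rho ->
  `](- rho), rho[ `*` `](- rho), rho[ `*` `](- rho), rho[ `<=` @cyl R (2 * rho).
Proof.
move=> rho0 [[x1 x2] x3] [[/= h1 h2] h3]; move: h1 h2 h3; rewrite !in_itv/= -!ltr_norml.
move=> h1 h2 h3; apply: (@cyl_cube _ _ rho); rewrite ?mulr_gt0//=; try exact: ltW.
by lra.
Qed.

(** The exceptional set of times is fixed before b and Y, since these will depend on
    the time. *)
Lemma slice_cube_bound (rho e a : R) : 0 < rho -> rho <= 1 / 2 -> 0 < e -> e <= 1 ->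
  0 < a ->
  {ae mu, forall t, -1 < t < 0 ->
    (\int[lam3]_(x in cyl (2 * rho)) (speedQ (x, t) ^+ 2)%:E <= a%:E)%E ->
    forall b Y : R, (forall j, \int[lam3]_(x in cyl (2 * rho)) (partial_sqrQ j (x, t))%:E <= b%:E)%E ->
    1 <= Y -> b <= a / rho ^+ 2 * Y ^+ 2 ->
    (\int[lam3]_(x in cyl (rho * e ^+ 2)) (speedQ (x, t) ^+ 3)%:E
       <= (gn_const a rho e * Y ^+ 2)%:E)%E}.
Proof.
move=> rho0 rho12 e0 e1 a0.
pose j0 : 'I_3 := Ordinal (isT : (0 < 3)%N).
pose j1 : 'I_3 := Ordinal (isT : (1 < 3)%N).
pose j2 : 'I_3 := Ordinal (isT : (2 < 3)%N).
have H j := ae_ysection (mu1 := lam3) (mu2 := mu) (vector_line_scales j rho0 rho12).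
have r0 : 0 < rho * e ^+ 2 by rewrite mulr_gt0 ?exprn_gt0.
have rrho : rho * e ^+ 2 <= rho by rewrite (ler_piMr (ltW rho0))// exprn_ile1// ltW.
apply: (@filterS3 _ _ (ae_filter_ringOfSetsType mu) _ _ _ _ _
  (H j0) (H j1) (H j2)) => t h0 h1 h2 t01 va b Y Gb Y1 bY.
pose S : set (measurableTypeR R) := `](- rho), rho[%classic.
pose s : set (measurableTypeR R) := `](- (rho * e ^+ 2)), (rho * e ^+ 2)[%classic.
have mS : measurable S by exact: measurable_itv.
have ms : measurable s by exact: measurable_itv.
have sS : s `<=` S by move=> y; rewrite /s /S/= !in_itv/= => /andP[y1 y2]; apply/andP; split; lra.
pose f (x : Rspace (measurableTypeR R)) := speedQ (x, t).
have mf : measurable_fun setT f by exact: (measurableT_comp measurable_speedQ (pair2_measurable t)).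
pose G (j : 'I_3) (x : Rspace (measurableTypeR R)) := partial_sqrQ j (x, t).
have mG j : measurable_fun setT (G j).
  exact: (measurableT_comp (measurable_partial_sqrQ j) (pair2_measurable t)).
have mcyl := @measurable_cyl R.
have sub : S `*` S `*` S `<=` @cyl R (2 * rho) by exact: cube_sub_cyl.
have mSSS : measurable (S `*` S `*` S) by do 2?apply: measurableX.
have Ua : (\int[lam3]_(x in S `*` S `*` S) (f x ^+ 2)%:E <= a%:E)%E.
  apply: le_trans va; apply: ge0_subset_integral => //.
  - apply: measurable_funTS; apply/measurable_EFinP; exact: measurable_funX.
  - by move=> x _; rewrite lee_fin sqr_ge0.
have Gb' j : (\int[lam3]_(x in S `*` S `*` S) (G j x)%:E <= b%:E)%E.
  apply: le_trans (Gb j); apply: ge0_subset_integral => //.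
  - apply: measurable_funTS; apply/measurable_EFinP; exact: mG.
  - by move=> x _; rewrite lee_fin partial_sqrQ_ge0.
have mus : mu s = (2 * rho * e ^+ 2)%:E by rewrite /s mu_itv_sym// mulrA.
have hc (x : Rspace R) : (S `*` S `*` S) x ->
    forall k, (k < 3)%N -> - rho < crd k (x, t) < rho.
  move=> [[x1 x2] x3] [|[|[|//]]] _ /=.
  - by move: x1; rewrite /S/= in_itv.
  - by move: x2; rewrite /S/= in_itv.
  - by move: x3; rewrite /S/= in_itv.
have := @cube_integral_bound _ _ _ _ _ _ R mu mu mu S s S s S s mS mS mS ms ms ms sS sS sS
  f (G j0) (G j1) (G j2) mf (fun x => speedQ_ge0 _)
  (mG _) (fun x => partial_sqrQ_ge0 _ _) (mG _) (fun x => partial_sqrQ_ge0 _ _) (mG _) (fun x => partial_sqrQ_ge0 _ _)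
  rho e a b Y rho0 e0 e1 a0 Y1 bY mus _ _ _ Ua (Gb' _) (Gb' _) (Gb' _).
move=> /(_ _ _ _) main.
apply: (@le_trans _ _ (\int[lam3]_(x in s `*` s `*` s) (f x ^+ 3)%:E)%E).
  apply: ge0_subset_integral => //.
  - by do 2?apply: measurableX.
  - apply: measurable_funTS; apply/measurable_EFinP; exact: measurable_funX.
  - by move=> x _; rewrite lee_fin exprn_ge0// speedQ_ge0.
  - exact: cyl_sub_cube.
apply: main.
- by apply: filterS h0 => x hx Sx l l0 lr; exact: hx (hc x Sx) t01 l l0 lr.
- by apply: filterS h1 => x hx Sx l l0 lr; exact: hx (hc x Sx) t01 l l0 lr.
- by apply: filterS h2 => x hx Sx l l0 lr; exact: hx (hc x Sx) t01 l l0 lr.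
Qed.

Lemma gn_const_gt0 (a rho e : R) : 0 < a -> 0 < rho -> 0 < e -> 0 < gn_const a rho e.
Proof.
move=> a0 rho0 e0; have ar := divr_gt0 a0 rho0.
have c1 : (0 : R) < 578 by lra.
have c2 : (0 : R) < 18 by lra.
by apply: mulr_gt0; [rewrite sqrtr_gt0; exact: mulr_gt0 (mulr_gt0 c1 ar) e0|exact: mulr_gt0].
Qed.

(** On the slice at time t the Dirichlet integral B(t) gives Y^2 = 1 + rho^2 B(t) / a,
    and the slice bound is linear in Y^2, so it can be integrated in time. *)
Lemma parabolic_cube_bound (rho e a bb r : R) : 0 < rho -> rho <= 1 / 2 ->
  0 < e -> e <= 1 -> 0 < a ->
  (forall t, - (2 * rho) ^+ 2 < t < 0 ->
    (\int[lam3]_(x in cyl (2 * rho)) (speedQ (x, t) ^+ 2)%:E <= a%:E)%E) ->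
  (\int[lam4]_(z in pcyl (2 * rho)) (\sum_(j < 3) partial_sqrQ j z)%:E <= bb%:E)%E ->
  r = rho * e ^+ 2 ->
  (\int[lam4]_(z in pcyl r) (speedQ z ^+ 3)%:E <=
   (gn_const a rho e * (r ^+ 2 + rho ^+ 2 / a * bb))%:E)%E.
Proof.
move=> rho0 rho12 e0 e1 a0 va Gb rE.
have C0 := gn_const_gt0 a0 rho0 e0.
have r0 : 0 < r by rewrite rE mulr_gt0 ?exprn_gt0.
have r2rho : r <= 2 * rho.
  apply: (@le_trans _ _ rho); last by lra.
  by rewrite rE (ler_piMr (ltW rho0))// exprn_ile1// ltW.
have r22 : r ^+ 2 <= (2 * rho) ^+ 2.
  by rewrite lerXn2r// nnegrE ?ltW// mulr_gt0.
have rho21 : (2 * rho) ^+ 2 <= 1.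
  by rewrite exprn_ile1//; [rewrite mulr_ge0// ltW|lra].
pose SG z := (\sum_(j < 3) partial_sqrQ j z)%:E.
have mSG : measurable_fun setT SG.
  by apply/measurable_EFinP; apply: measurable_sum => j; exact: measurable_partial_sqrQ.
have SG0 z : (0 <= SG z)%E by rewrite lee_fin sumr_ge0// => j _; exact: partial_sqrQ_ge0.
have mv3 : measurable_fun setT (fun z => (speedQ z ^+ 3)%:E).
  by apply/measurable_EFinP; apply: measurable_funX; exact: measurable_speedQ.
have v30 z : (0 <= (speedQ z ^+ 3)%:E)%E by rewrite lee_fin exprn_ge0// speedQ_ge0.
have mcyl := @measurable_cyl R.
have mI (x : R) : measurable (`](- x), 0%R[%classic : set (measurableTypeR R)).
  exact: measurable_itv.
pose B t := (\int[lam3]_(x in cyl (2 * rho)) SG (x, t))%E.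
have mB : measurable_fun setT B.
  exact: (measurable_slice_integral lam3 (mcyl _) mSG SG0).
have B0 t : (0 <= B t)%E by exact: integral_ge0.
have intB : (\int[mu]_(t in `](- r ^+ 2)%R, 0%R[) B t <= bb%:E)%E.
  apply: le_trans Gb.
  rewrite [leRHS](integral_setX lam3 mu (mcyl _) (mI _) mSG SG0).
  apply: ge0_subset_integral => //; first exact: measurable_funTS.
  by move=> t /=; rewrite !in_itv/= => /andP[t1 ->]; rewrite andbT; apply: le_lt_trans t1; lra.
rewrite (integral_setX lam3 mu (mcyl _) (mI _) mv3 v30).
pose c := rho ^+ 2 / a.
have c0 : 0 < c by rewrite divr_gt0// exprn_gt0.
apply: (@le_trans _ _ (\int[mu]_(t in `](- r ^+ 2)%R, 0%R[)
   ((gn_const a rho e)%:E * (1 + c%:E * B t)))%E).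
  apply: ae_ge0_le_integral => //.
  - by move=> t _; exact: integral_ge0.
  - apply: measurable_funTS.
    exact: (measurable_slice_integral lam3 (mcyl _) mv3 v30).
  - move=> t _; apply: mule_ge0; first by rewrite lee_fin ltW.
    by apply: adde_ge0 => //; apply: mule_ge0 => //; rewrite lee_fin ltW.
  - apply: measurable_funTS; apply: emeasurable_funM => //.
    by apply: emeasurable_funD => //; exact: emeasurable_funM.
  apply: (@filterS _ _ (ae_filter_ringOfSetsType mu) _ _ _
    (slice_cube_bound rho0 rho12 e0 e1 a0)) => t ht.
  rewrite /= in_itv/= => /andP[t1 t0].
  have t01 : -1 < t < 0 by rewrite t0 andbT; apply: le_lt_trans t1; lra.
  have t2 : - (2 * rho) ^+ 2 < t < 0 by rewrite t0 andbT; apply: le_lt_trans t1; lra.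
  have [Boo|] := eqVneq (B t) +oo%E.
    rewrite Boo gt0_muley ?lte_fin// addey// gt0_muley ?lte_fin// leey//.
  rewrite -ltey => Blt.
  have Bf : (fine (B t))%:E = B t by rewrite fineK// ge0_fin_numE.
  have -> : ((gn_const a rho e)%:E * (1 + c%:E * B t) =
      (gn_const a rho e * (1 + c * fine (B t)))%:E)%E by rewrite -Bf.
  have b0 : 0 <= fine (B t) by exact: fine_ge0.
  have Y2 : Num.sqrt (1 + c * fine (B t)) ^+ 2 = 1 + c * fine (B t).
    by rewrite sqr_sqrtr// addr_ge0// mulr_ge0// ltW.
  rewrite rE -Y2; apply: (ht t01 (va t t2) (fine (B t))).
  - move=> j; rewrite Bf; apply: ge0_le_integral => //.
    + by move=> x _; rewrite lee_fin partial_sqrQ_ge0.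
    + apply: measurable_funTS; apply/measurable_EFinP.
      exact: (measurableT_comp (measurable_partial_sqrQ j) (pair2_measurable t)).
    + apply: measurable_funTS; exact: (measurableT_comp mSG (pair2_measurable t)).
    move=> x _; rewrite lee_fin (bigD1 j)//= lerDl sumr_ge0// => k _; exact: partial_sqrQ_ge0.
  - by rewrite -[leLHS]sqrtr1 ler_wsqrtr// lerDl mulr_ge0// ltW.
  - rewrite Y2 /c mulrDr mulr1 [X in _ <= _ + X](_ : _ = fine (B t)).
      by rewrite lerDr divr_ge0 ?sqr_ge0// ltW.
    by field; rewrite !gt_eqF.
have -> : (\int[mu]_(t in `](- r ^+ 2)%R, 0%R[) ((gn_const a rho e)%:E * (1 + c%:E * B t)) =
    (gn_const a rho e)%:E * \int[mu]_(t in `](- r ^+ 2)%R, 0%R[) (1 + c%:E * B t))%E.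
  apply: ge0_integralZl => //.
  - by apply: measurable_funTS; apply: emeasurable_funD => //; exact: emeasurable_funM.
  - by move=> t _; apply: adde_ge0 => //; apply: mule_ge0 => //; rewrite lee_fin ltW.
  - by rewrite lee_fin ltW.
have -> : (\int[mu]_(t in `](- r ^+ 2)%R, 0%R[) (1 + c%:E * B t) =
   (r ^+ 2)%:E + c%:E * \int[mu]_(t in `](- r ^+ 2)%R, 0%R[) B t)%E.
  rewrite ge0_integralD//; last 2 first.
  - by move=> t _; apply: mule_ge0 => //; rewrite lee_fin ltW.
  - by apply: measurable_funTS; exact: emeasurable_funM.
  congr (_ + _)%E.
    have r20 : - r ^+ 2 < 0 by rewrite oppr_lt0 exprn_gt0.
    rewrite integral_cst// mul1e; apply: etrans (lebesgue_itvoo r20) _.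
    by rewrite sub0r opprK.
  by apply: ge0_integralZl => //; [exact: measurable_funTS|rewrite lee_fin ltW].
rewrite [leRHS]EFinM; apply: lee_wpmul2l; first by rewrite lee_fin ltW.
rewrite [leRHS]EFinD; apply: leeD => //.
by rewrite [leRHS]EFinM; apply: lee_wpmul2l => //; rewrite lee_fin ltW.
Qed.

End vector_line.

(** * Choice of the scale and conclusion *)

Section final_scaling.
Variable R : realType.
Implicit Types K L lam e m r : R.

Definition decay_const K : R := 34 * Num.sqrt K * (45 * K).

Lemma decay_const_gt0 K : 0 < K -> 0 < decay_const K.
Proof.
move=> K0; have sK0 : 0 < Num.sqrt K by rewrite sqrtr_gt0.
by rewrite /decay_const; nra.
Qed.

Lemma scale_exponents m0 m : 2 / 5 <= m0 < 1 -> m = 3 * m0 / (2 + m0) ->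
  [/\ 0 < m, m < 1 & 2 * m0 = 2 / (3 - m) * (2 * m)].
Proof.
move=> /andP[m0_ge m0_lt] ->.
have d0 : 0 < 2 + m0 by lra.
have dn : 2 + m0 != 0 by rewrite gt_eqF.
split; first by rewrite divr_gt0//; lra.
  by rewrite ltr_pdivrMr//; lra.
have -> : 3 - 3 * m0 / (2 + m0) = 6 / (2 + m0) by field.
by field.
Qed.

(** Here L stands for lambda^m.  The choice r^2 = lambda^3 / L makes the two terms
    r^2 and rho^2 K L / a equal up to the factor 1/4, so that the powers of lambda
    cancel. *)
Lemma gn_const_scaling K L lam rho e r a : 0 < K -> 0 < L -> 0 < lam -> 0 < e ->
  rho = lam / 2 -> a = K * (L ^+ 2 / lam) -> r ^+ 2 = lam ^+ 3 / L ->
  gn_const a rho e * (r ^+ 2 + rho ^+ 2 / a * (K * L)) =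
  decay_const K * Num.sqrt e * L ^+ 2.
Proof.
move=> K0 L0 lam0 e0 -> -> ->.
have d0 : 0 <= L / lam by rewrite divr_ge0// ltW.
rewrite /gn_const /decay_const; set w := 578 * _ * e.
have -> : w = (34 * (L / lam)) ^+ 2 * (K * e) by rewrite /w; field; rewrite !gt_eqF.
rewrite sqrtrM ?sqr_ge0// sqrtr_sqr ger0_norm; last by rewrite mulr_ge0.
rewrite sqrtrM; last exact: ltW.
by field; rewrite !gt_eqF.
Qed.

Lemma small_scale_ratio (r : nat -> R) (beta delta : R) : 0 < beta -> 0 < delta ->
  (forall k, 0 < r k) -> r @ \oo --> (0 : R) -> exists k, r k `^ beta < delta.
Proof.
move=> b0 d0 r0 rcv.
have /cvgr0Pnorm_lt/(_ _ (powR_gt0 (beta^-1) d0)) := rcv.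
move=> [k _ /(_ k (leqnn k))]; rewrite gtr0_norm// => rk; exists k.
have -> : delta = (delta `^ beta^-1) `^ beta.
  by rewrite -powRrM mulVf ?gt_eqF// powRr1// ltW.
by rewrite gt0_ltr_powR// nnegrE ?powR_ge0// ltW.
Qed.

(** The exponent of r / lambda is positive: this ratio is what tends to zero. *)
Lemma scale_powers (r m : R) : 0 < r -> m < 1 ->
  let lam := r `^ (2 / (3 - m)) in
  r ^+ 2 = lam ^+ 3 / lam `^ m /\ r / lam = r `^ ((1 - m) / (3 - m)).
Proof.
move=> r0 m1 lam.
have lam0 : 0 < lam by exact: powR_gt0.
have m3 : 3 - m != 0 by rewrite gt_eqF//; lra.
split.
  rewrite -(powR_mulrn 3 (ltW lam0)) -powRB; last by rewrite (gt_eqF lam0) implybT.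
  by rewrite -powRrM mulfVK// powR_mulrn// ltW.
rewrite -{1}(powRr1 (ltW r0)) /lam -powRB; last by rewrite (gt_eqF r0) implybT.
by congr (_ `^ _); field.
Qed.

Lemma powR_double (x y : R) : 0 <= x -> x `^ (2 * y) = (x `^ y) ^+ 2.
Proof. by move=> x0; rewrite mulrC powRrM powR_mulrn// powR_ge0. Qed.

End final_scaling.

Lemma sprod_setX d1 d2 (T1 : measurableType d1) (T2 : measurableType d2) (R : realType)
  (mu1 : {sigma_finite_measure set T1 -> \bar R})
  (mu2 : {sigma_finite_measure set T2 -> \bar R}) (A : set T1) (B : set T2) :
  measurable A -> measurable B -> sprod mu1 mu2 (A `*` B) = (mu1 A * mu2 B)%E.
Proof. by move=> mA mB; exact: product_measure1E. Qed.

Section integrability.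
Variable R : realType.
Notation mu := (@lebesgue_measure R).
Notation lam3 := (@lam3 R).
Notation lam4 := (@lam4 R).
Notation Q := (@pcyl R 1).

Lemma lam3_cyl_lty (a : R) : 0 < a -> (lam3 (cyl a) < +oo)%E.
Proof.
move=> a0.
have mI : measurable (`](- a), a[%classic : set (measurableTypeR R)).
  exact: measurable_itv.
apply: (@le_lt_trans _ _ (lam3 (`](- a), a[ `*` `](- a), a[ `*` `](- a), a[))).
  apply: le_measure; rewrite ?inE; [exact: measurable_cyl| |exact: cyl_sub_cube].
  by do 2?apply: measurableX.
have mI2 := measurableX mI mI.
rewrite [ltLHS](sprod_setX (sprod mu mu) mu mI2 mI).
rewrite [X in (X * _)%E](sprod_setX mu mu mI mI).
have muE : mu `](- a), a[%classic = (2 * a)%:E by exact: mu_itv_sym.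
have -> : (mu `](- a)%R, a[%classic * mu `](- a)%R, a[%classic * mu `](- a)%R, a[%classic =
    (2 * a * (2 * a) * (2 * a))%:E)%E by rewrite muE -!EFinM.
exact: ltry.
Qed.

Lemma lam4_pcyl_lty (a : R) : 0 < a -> (lam4 (pcyl a) < +oo)%E.
Proof.
move=> a0.
have mI : measurable (`](- a ^+ 2), 0%R[%classic : set (measurableTypeR R)).
  exact: measurable_itv.
rewrite [ltLHS](sprod_setX lam3 mu (@measurable_cyl R a) mI).
have a20 : - a ^+ 2 < 0 by rewrite oppr_lt0 exprn_gt0.
have muE := lebesgue_itvoo a20.
have cf : lam3 (cyl a) \is a fin_num by rewrite ge0_fin_numE// lam3_cyl_lty.
apply: (@le_lt_trans _ _ (lam3 (cyl a) * (0 - - a ^+ 2)%:E)%E).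
  by rewrite -muE.
by rewrite -(fineK cf) -EFinM ltry.
Qed.

(** |f| <= 1 + f^2 on a set of finite measure. *)
Lemma integrable_of_sqr d (T : measurableType d) (nu : {measure set T -> \bar R})
  (U : set T) (f : T -> R) : measurable U -> (nu U < +oo)%E -> measurable_fun U f ->
  (\int[nu]_(x in U) (f x ^+ 2)%:E < +oo)%E -> nu.-integrable U (EFin \o f).
Proof.
move=> mU Uoo mf f2.
apply/integrableP; split; first exact/measurable_EFinP.
apply: (@le_lt_trans _ _ (\int[nu]_(x in U) (1 + (f x ^+ 2)%:E))%E).
  apply: ge0_le_integral => //.
  - by apply: measurableT_comp => //; exact/measurable_EFinP.
  - apply: emeasurable_funD => //; apply/measurable_EFinP; exact: measurable_funX.
  move=> x _; rewrite /= -EFinD lee_fin -[f x ^+ 2]real_normK ?num_real//.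
  have := sqr_ge0 (`|f x| - 1 / 2); rewrite sqrrB; lra.
rewrite ge0_integralD//; last 2 first.
- by move=> x _; rewrite lee_fin sqr_ge0.
- by apply/measurable_EFinP; exact: measurable_funX.
by rewrite integral_cst// mul1e lte_add_pinfty.
Qed.

End integrability.

Section morrey.
Variable R : realType.
Notation mu := (@lebesgue_measure R).
Notation lam3 := (@lam3 R).
Notation lam4 := (@lam4 R).
Notation Q := (@pcyl R 1).
Variables (v : 'I_3 -> Rspacetime R -> R) (q : Rspacetime R -> R)
  (Dv : 'I_3 -> 'I_3 -> Rspacetime R -> R) (m m1 : R).

Lemma pcyl_mono (a b : R) : 0 < a -> a <= b -> pcyl a `<=` pcyl b.
Proof.
move=> a0 ab [x t] [[/= x1 x2] t1]; split; first by split; apply: lt_le_trans ab.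
move: t1 => /=; rewrite !in_itv/= => /andP[t1 ->]; rewrite andbT.
by apply: le_lt_trans t1; rewrite lerN2 lerXn2r// nnegrE; lra.
Qed.

Definition morrey_bound K :=
  (forall rho t, 0 < rho <= 1 -> - rho ^+ 2 < t < 0 ->
     (\int[lam3]_(x in cyl rho) (vabs v (x, t) ^+ 2)%:E <= (K * rho `^ m1)%:E)%E) /\
  (forall rho, 0 < rho <= 1 ->
     (\int[lam4]_(z in pcyl rho) (grad_abs Dv z ^+ 2)%:E <= (K * rho `^ m)%:E)%E).

(** All three terms of the sum are nonnegative, so each is bounded by the
    supremum; 1 is added to make K positive. *)
Lemma morrey_bound_of_sup :
  (ereal_sup
          [set ereal_sup
                 [set ((rho `^ m1)^-1)%:E *
                      \int[leb3 R]_(x in cyl rho) (vabs v (x, t) ^+ 2)%:E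
                   | t in `](- rho ^+ 2)%R, 0%R[]
               + ((rho `^ (2 * m))^-1)%:E *
                 \int[leb4 R]_(z in pcyl rho) (`|q z| `^ (3 / 2))%:E
               + ((rho `^ m)^-1)%:E *
                 \int[leb4 R]_(z in pcyl rho) (grad_abs Dv z ^+ 2)%:E
            | rho in `]0%R, 1%R]] < +oo)%E ->
  exists2 K, 0 < K & morrey_bound K.
Proof.
set S := ereal_sup _ => Soo.
pose A rho := ereal_sup
                 [set ((rho `^ m1)^-1)%:E *
                      \int[leb3 R]_(x in cyl rho) (vabs v (x, t) ^+ 2)%:E
                   | t in `](- rho ^+ 2)%R, 0%R[]%E.
pose B rho := (((rho `^ (2 * m))^-1)%:E *
                 \int[leb4 R]_(z in pcyl rho) (`|q z| `^ (3 / 2))%:E)%E.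
pose G rho := (((rho `^ m)^-1)%:E *
                 \int[leb4 R]_(z in pcyl rho) (grad_abs Dv z ^+ 2)%:E)%E.
have inv0 (x y : R) : (0 <= ((x `^ y)^-1)%:E)%E by rewrite lee_fin invr_ge0 powR_ge0.
have B0 rho : (0 <= B rho)%E.
  by apply: mule_ge0 => //; apply: integral_ge0 => z _; rewrite lee_fin powR_ge0.
have G0 rho : (0 <= G rho)%E.
  by apply: mule_ge0 => //; apply: integral_ge0 => z _; rewrite lee_fin sqr_ge0.
have At (rho t : R) : - rho ^+ 2 < t < 0 -> (((rho `^ m1)^-1)%:E *
     \int[leb3 R]_(x in cyl rho) (vabs v (x, t) ^+ 2)%:E <= A rho)%E.
  by move=> ht; apply: ereal_sup_ubound; exists t => //=; rewrite in_itv.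
have A0 rho : 0 < rho -> (0 <= A rho)%E.
  move=> r0; apply: le_trans (At rho (- rho ^+ 2 / 2) _).
    by apply: mule_ge0 => //; apply: integral_ge0 => z _; rewrite lee_fin sqr_ge0.
  by have := exprn_gt0 2 r0; move=> h; apply/andP; split; lra.
have sumS rho : 0 < rho <= 1 -> (A rho + B rho + G rho <= S)%E.
  by move=> hr; apply: ereal_sup_ubound; exists rho => //=; rewrite in_itv.
have S0 : (0 <= S)%E.
  by apply: le_trans (sumS 1 _); [rewrite !adde_ge0// A0|rewrite ltr01 lexx].
have Sfin : S \is a fin_num by rewrite ge0_fin_numE.
have fS0 : 0 <= fine S by exact: fine_ge0.
have scale (x y : R) (I : \bar R) : 0 < x -> (((x `^ y)^-1)%:E * I <= S)%E ->
    (I <= ((fine S + 1) * x `^ y)%:E)%E.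
  move=> x0; have p0 := powR_gt0 y x0.
  rewrite muleC lee_pdivrMr// => h; apply: (le_trans h).
  by rewrite -{1}(fineK Sfin) -EFinM lee_fin ler_wpM2r ?lerDl// ltW.
exists (fine S + 1); first by rewrite ltr_wpDl.
split=> [rho t rho01 ht|rho rho01]; have /andP[rho0 _] := rho01; apply: scale => //;
  apply: le_trans (sumS _ rho01).
- by apply: (le_trans (At _ _ ht)); rewrite -addeA leeDl// adde_ge0.
- by rewrite leeDr// adde_ge0// A0.
Qed.

Lemma speedQ_slice rho t : 0 < rho <= 1 -> - rho ^+ 2 < t < 0 ->
  (\int[lam3]_(x in cyl rho) (speedQ v (x, t) ^+ 2)%:E =
   \int[lam3]_(x in cyl rho) (vabs v (x, t) ^+ 2)%:E)%E.
Proof.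
move=> /andP[r0 r1] ht; apply: eq_integral => x; rewrite inE => -[x1 x2].
rewrite /speedQ patchE ifT// inE; apply: (pcyl_mono r0 r1).
by split; [split|rewrite /= in_itv].
Qed.

Lemma sum_partial_sqrQ z : Q z -> \sum_(j < 3) partial_sqrQ Dv j z = grad_abs Dv z ^+ 2.
Proof.
move=> Qz; rewrite /grad_abs sqr_enorm exchange_big pair_bigA/=.
by apply: eq_bigr => -[i j] _; rewrite patchE ifT ?inE.
Qed.

End morrey.

Section cubic_decay.
Variable R : realType.
Notation mu := (@lebesgue_measure R).
Notation lam3 := (@lam3 R).
Notation lam4 := (@lam4 R).
Notation Q := (@pcyl R 1).
Variables (v : 'I_3 -> Rspacetime R -> R)
  (Dv : 'I_3 -> 'I_3 -> Rspacetime R -> R) (m K : R).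
Hypotheses (wg : weak_gradient v Dv) (K0 : 0 < K)
  (mb : morrey_bound v Dv m (2 * m - 1) K).

Lemma sqr_le_enorm (I : finType) (a : I -> R) i : a i ^+ 2 <= enorm a ^+ 2.
Proof. by rewrite sqr_enorm (bigD1 i)//= lerDl sumr_ge0// => j _; exact: sqr_ge0. Qed.

Lemma measurable_sqr_sum (I : finType) (w : I -> Rspacetime R -> R) :
  (forall i, measurable_fun Q (w i)) ->
  measurable_fun setT (fun z => (\sum_i (w i \_ Q) z ^+ 2)%:E).
Proof.
move=> mw; apply/measurable_EFinP; apply: measurable_sum => i.
apply: measurable_funX; apply/(measurable_restrictT _ (@measurable_pcyl R 1)); exact: mw.
Qed.

Lemma component_integrable i : lam4.-integrable Q (EFin \o v i).
Proof.
have mv k : measurable_fun Q (v k) by have [[]] := wg k ord0.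
have mQ := @measurable_pcyl R 1.
apply: (integrable_of_sqr mQ (lam4_pcyl_lty ltr01) (mv i)).
have mI : measurable (`](- 1 ^+ 2), 0%R[%classic : set (measurableTypeR R)).
  exact: measurable_itv.
pose F z := (\sum_k (v k \_ Q) z ^+ 2)%:E.
have mF : measurable_fun setT F by exact: measurable_sqr_sum.
have F0 z : (0 <= F z)%E by rewrite lee_fin sumr_ge0// => k _; exact: sqr_ge0.
apply: (@le_lt_trans _ _ (\int[lam4]_(z in Q) F z)%E).
  apply: ge0_le_integral => //.
  - by move=> z _; rewrite lee_fin sqr_ge0.
  - by apply/measurable_EFinP; apply: measurable_funX; exact: mv.
  - exact: measurable_funTS.
  move=> z Qz; rewrite lee_fin (bigD1 i)//= patchE ifT ?inE// lerDl.
  by rewrite sumr_ge0// => k _; exact: sqr_ge0.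
rewrite [ltLHS](integral_setX lam3 mu (@measurable_cyl R 1) mI mF F0).
apply: (@le_lt_trans _ _ (\int[mu]_(t in `](- 1 ^+ 2)%R, 0%R[) K%:E)%E).
  apply: ge0_le_integral => //.
  - by move=> t _; exact: integral_ge0.
  - apply: measurable_funTS.
    exact: (measurable_slice_integral lam3 (@measurable_cyl R 1) mF F0).
  move=> t; rewrite /= in_itv/= => ht.
  have h1 : 0 < (1 : R) <= 1 by rewrite ltr01 lexx.
  have := mb.1 1 t h1 ht; rewrite powR1 mulr1 -speedQ_slice//.
  by under eq_integral do rewrite sqr_speedQ.
have m10 : - 1 ^+ 2 < 0 :> R by rewrite expr1n oppr_lt0.
rewrite integral_cst//.
apply: (@le_lt_trans _ _ (K%:E * (0 - - 1 ^+ 2)%:E)%E); last by rewrite -EFinM ltry.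
by rewrite -(lebesgue_itvoo m10).
Qed.

Lemma gradient_integrable i j : lam4.-integrable Q (EFin \o Dv i j).
Proof.
have mD k l : measurable_fun Q (Dv k l) by have [_ []] := wg k l.
have mQ := @measurable_pcyl R 1.
apply: (integrable_of_sqr mQ (lam4_pcyl_lty ltr01) (mD i j)).
have h1 : 0 < (1 : R) <= 1 by rewrite ltr01 lexx.
apply: (le_lt_trans _ (ltry (K * 1 `^ m))); apply: le_trans (mb.2 1 h1).
have mG : measurable_fun Q (fun z => (grad_abs Dv z ^+ 2)%:E).
  apply/measurable_EFinP.
  have -> : (fun z => grad_abs Dv z ^+ 2) =
      (fun z => \sum_(ij : 'I_3 * 'I_3) Dv ij.1 ij.2 z ^+ 2).
    by apply/funext => z; exact: sqr_enorm.
  by apply: measurable_sum => ij; apply: measurable_funX; exact: mD.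
apply: ge0_le_integral => //.
- by move=> z _; rewrite lee_fin sqr_ge0.
- by apply/measurable_EFinP; apply: measurable_funX; exact: mD.
by move=> z _; rewrite lee_fin; exact: (sqr_le_enorm (fun ij => Dv ij.1 ij.2 z) (i, j)).
Qed.

(** [parabolic_cube_bound] at rho = lambda / 2, a = K lambda^(2m-1) and
    e = (r / rho)^(1/2). *)
Lemma cubic_decay lam r : 0 < lam <= 1 -> 0 < r -> r <= lam / 2 ->
  r ^+ 2 = lam ^+ 3 / lam `^ m ->
  (\int[lam4]_(z in pcyl r) (vabs v z ^+ 3)%:E <=
   (decay_const K * Num.sqrt (Num.sqrt (2 * (r / lam)))
     * (lam `^ m) ^+ 2)%:E)%E.
Proof.
move=> lam01 r0 rlam r2; have /andP[lam0 lam1] := lam01.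
have r1 : r <= 1 by lra.
have L0 := powR_gt0 m lam0.
set rho := lam / 2 in rlam; have rho0 : 0 < rho by rewrite divr_gt0.
have twor : 2 * rho = lam by rewrite /rho; field.
have q0 : 0 < 2 * (r / lam) by rewrite mulr_gt0// divr_gt0.
set e := Num.sqrt (2 * (r / lam)).
have e0 : 0 < e by rewrite sqrtr_gt0.
have e2 : e ^+ 2 = 2 * (r / lam) by rewrite sqr_sqrtr// ltW.
have e1 : e <= 1.
  rewrite -[leRHS]sqrtr1 ler_wsqrtr// mulrA ler_pdivrMr//; lra.
have rE : r = rho * e ^+ 2 by rewrite e2 /rho; field; rewrite gt_eqF.
set a := K * (lam `^ m ^+ 2 / lam).
have aE : K * lam `^ (2 * m - 1) = a.
  rewrite /a powRB; last by rewrite (gt_eqF lam0) implybT.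
  by rewrite powR_double ?powRr1// ltW.
have a0 : 0 < a by rewrite mulr_gt0// divr_gt0// exprn_gt0.
have -> : (\int[lam4]_(z in pcyl r) (vabs v z ^+ 3)%:E =
    \int[lam4]_(z in pcyl r) (speedQ v z ^+ 3)%:E)%E.
  apply: eq_integral => z; rewrite inE => rz.
  by rewrite /speedQ patchE ifT// inE; exact: pcyl_mono rz.
rewrite -(gn_const_scaling K0 L0 lam0 e0 (erefl rho) (erefl a) r2).
apply: (parabolic_cube_bound wg component_integrable gradient_integrable) => //.
- by rewrite /rho ler_wpM2r.
- move=> t; rewrite twor => ht; rewrite speedQ_slice// -aE; exact: mb.1.
- rewrite twor; apply: le_trans (mb.2 lam lam01).
  rewrite le_eqVlt; apply/orP; left; apply/eqP; apply: eq_integral => z; rewrite inE => lz.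
  by rewrite sum_partial_sqrQ//; exact: pcyl_mono lz.
Qed.

(** The decay factor of [cubic_decay] is a positive power of r_k, while
    concentration keeps the quotient above c1. *)
Lemma no_concentration (m0 : R) (r : nat -> R) (c1 : R) : 0 < m -> m < 1 ->
  2 * m0 = 2 / (3 - m) * (2 * m) ->
  (forall k, 0 < r k <= 1) -> r @ \oo --> (0 : R) -> 0 < c1 ->
  ~ (forall k, (c1%:E <= ((r k `^ (2 * m0))^-1)%:E *
          \int[lam4]_(z in pcyl (r k)) (vabs v z ^+ 3)%:E)%E).
Proof.
move=> m_gt0 m_lt1 m0E r01 rcv c10 hr.
have C0 := decay_const_gt0 K0; set C := decay_const K in C0.
have cC : 0 < c1 / C by rewrite divr_gt0.
(* r / lambda < 1/2 puts r below lambda / 2, and the fourth power undoes the two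
   square roots of the decay factor. *)
pose d := Num.min (1 / 2) ((c1 / C) ^+ 4 / 2).
have d0 : 0 < d.
  by rewrite lt_min; apply/andP; split; rewrite divr_gt0// exprn_gt0.
have b0 : 0 < (1 - m) / (3 - m) by rewrite divr_gt0; lra.
have r0 k : 0 < r k by have /andP[] := r01 k.
have [k rk] := small_scale_ratio b0 d0 r0 rcv.
have [] := scale_powers (r0 k) m_lt1; set lam := _ `^ _ => r2 rlam.
have lam0 : 0 < lam by exact: powR_gt0.
have rd : r k / lam < d by rewrite rlam.
have lam1 : lam <= 1.
  rewrite -(powRr0 (r k)); apply: ger_powR; first exact: r01.
  by rewrite divr_ge0; lra.
have rlam2 : r k <= lam / 2.
  have : r k / lam < 1 / 2 by apply: (lt_le_trans rd); rewrite ge_min lexx.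
  by rewrite ltr_pdivrMr// => /ltW; rewrite mulrC mulrA mulr1.
have l01 : 0 < lam <= 1 by rewrite lam0.
have := cubic_decay l01 (r0 k) rlam2 r2.
have := hr k; rewrite muleC lee_pdivlMr ?powR_gt0// => h1 /(le_trans h1).
rewrite -EFinM lee_fin m0E powRrM -/lam.
rewrite (powR_double _ (ltW lam0)) ler_pM2r; last first.
  by rewrite exprn_gt0// powR_gt0.
apply/negP; rewrite -ltNge -ltr_pdivlMl// [C^-1 * _]mulrC.
have q0 : 0 <= 2 * (r k / lam) by rewrite mulr_ge0// ltW// divr_gt0.
rewrite -(@ltr_pXn2r _ 4 isT) ?nnegrE ?sqrtr_ge0//; last exact: ltW.
rewrite (exprM _ 2 2) sqr_sqrtr ?sqrtr_ge0// sqr_sqrtr//.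
have : d <= (c1 / C) ^+ 4 / 2 by rewrite ge_min lexx orbT.
move=> h2; have := lt_le_trans rd h2; lra.
Qed.

End cubic_decay.

Theorem proposition2p3 (R : realType)
  (v : 'I_3 -> Rspacetime R -> R) (q : Rspacetime R -> R)
  (Dv : 'I_3 -> 'I_3 -> Rspacetime R -> R)
  (D2v : 'I_3 -> 'I_3 -> 'I_3 -> Rspacetime R -> R)
  (dtv : 'I_3 -> Rspacetime R -> R)
  (m0 m m1 alpha s1 l1 gammas qbar : R)
  (hsuitable : suitable_weak_solution v q Dv)
  (haxi : axisymmetric v q)
  (hD2v : weak_hessian Dv D2v)
  (hdtv : weak_time_derivative v dtv)
  (hm0 : 2 / 5 <= m0 < 1)
  (hm : m = 3 * m0 / (2 + m0))
  (hm1 : m1 = 2 * m - 1)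
  (halpha : alpha = 2 - m)
  (hs1 : 1 < s1) (hl1 : 1 < l1)
  (hs1l1 : 3 / s1 + 2 / l1 = 4)
  (hgammas : gammas = 1 - (3 / (2 * s1) - 1) * (1 - m))
  (hqbar : qbar = 3 / (2 - m))
  (hhigher :
    (ereal_sup
      [set ((rho `^ (gammas * l1))^-1)%:E *
           \int[leb1 R]_(t in `](- rho ^+ 2)%R, 0%R[)
             (\int[leb3 R]_(x in cyl rho)
                (hess_abs D2v (x, t) `^ s1 + vabs dtv (x, t) `^ s1)%:E)
             `^ (l1 / s1)
        | rho in `]0%R, 1%R[] < +oo)%E)
  (hml1 : m < (4 * l1 - 3) / (l1 + 1))
  (hLqbar :
    (ess_sup (leb1 R)
      ((fun t : R => \int[leb3 R]_(x in cyl 1) (vabs v (x, t) `^ qbar)%:E)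
       \_ `](-1)%R, 0%R[) < +oo)%E)
  (htypeII : type_II_origin v Dv)
  (hseq : exists (r : nat -> R) (c1 : R),
    [/\ (forall k, 0 < r k <= 1), r @ \oo --> (0 : R), 0 < c1
      & forall k, (c1%:E <= ((r k `^ (2 * m0))^-1)%:E *
          \int[leb4 R]_(z in pcyl (r k)) (vabs v z ^+ 3)%:E)%E]) :
  [\/ ~ (ereal_sup
          [set ereal_sup
                 [set ((rho `^ m1)^-1)%:E *
                      \int[leb3 R]_(x in cyl rho) (vabs v (x, t) ^+ 2)%:E
                   | t in `](- rho ^+ 2)%R, 0%R[]
               + ((rho `^ (2 * m))^-1)%:E *
                 \int[leb4 R]_(z in pcyl rho) (`|q z| `^ (3 / 2))%:E
               + ((rho `^ m)^-1)%:E *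
                 \int[leb4 R]_(z in pcyl rho) (grad_abs Dv z ^+ 2)%:E
            | rho in `]0%R, 1%R]] < +oo)%E,
      ~ (exists c : R, forall z : Rspacetime R,
          pcyl 1 z -> 0 < axis_dist z.1 ->
          vabs v z <= c / (axis_dist z.1 `^ alpha))
    | ~ (l1 <= s1)].
Proof.
apply: Or31 => hi.
have [K K0 mb] := morrey_bound_of_sup hi.
have [_ [wg _] _ _ _] := hsuitable.
have [r [c1 [r01 rcv c10 hr]]] := hseq.
have [m_gt0 m_lt1 m0E] := scale_exponents hm0 hm.
rewrite hm1 in mb.
exact: (no_concentration wg K0 mb m_gt0 m_lt1 m0E r01 rcv c10 hr).
Qed.
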